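(* Let $\beta_+,\beta_->0$ and let $(D_+,D_-)$ be a pair of disjoint bounded domains in $\mathbb{C}$ such that $\partial D_+$ and $\partial D_-$ are piecewise $C^1$. Then $(D_+,D_-)$ has a two-phase Schwarz function (with constants $\beta_+,\beta_-$) if and only if $(D_+,D_-)$ is a $(\beta_+,\beta_-)$-two-phase quadrature domain for analytic functions with respect to some distribution $\mu$.
   Context: We work in $\mathbb{R}^2=\mathbb{C}$; $\lambda$ denotes Lebesgue measure, $A(\Omega)$ the analytic functions in an open set $\Omega$, and $C(E)$ the continuous functions on $E$. Let $D_+,D_-$ be disjoint bounded open sets, $\beta_+,\beta_->0$ constants, $D=D_+\cup D_-$ and $\Gamma=\partial D_+\cap\partial D_-$. Two-phase Schwarz function: if there are compact subsets $C_\pm\subset D_\pm$ and functions $S_\pm\in C(\overline{D}_\pm)\cap A(D_\pm\setminus C_\pm)$ such that $S_\pm(z)=\pm\beta_\pm\overline{z}$ for $z\in\partial D_\pm\setminus\Gamma$ and $S_+(z)-S_-(z)=(\beta_++\beta_-)\overline{z}$ for $z\in\Gamma$, then the pair $(S_+,S_-)$ is called a two-phase Schwarz function for $(D_+,D_-)$. Two-phase quadrature domain for analytic functions: $(D_+,D_-)$ is a $(\beta_+,\beta_-)$-two-phase quadrature domain for analytic functions with respect to the (possibly complex-valued) distribution $\mu$ if $\mu$ has compact support in $D$ and $$\beta_+\int_{D_+}f\,d\lambda-\beta_-\int_{D_-}f\,d\lambda=\langle\mu,f\rangle\quad\text{for all } f\in A(D)\cap C(\overline{D}).$$ *)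

(* Defs.v *)
From HB Require Import structures.
From mathcomp Require Import all_boot all_order all_algebra.
From mathcomp Require Import all_classical all_reals all_analysis.
From mathcomp Require Import complex.

Set Implicit Arguments.
Unset Strict Implicit.
Unset Printing Implicit Defensive.

Import Order.TTheory GRing.Theory Num.Theory.
Import numFieldNormedType.Exports.

Local Open Scope classical_set_scope.
Local Open Scope ring_scope.
Local Open Scope complex_scope.

(* The complex plane is [R[i]^o]: the regular-algebra copy of [R[i]] is the one
   that carries the topology, the norm and the complex vector space structure.
   Functions on a subset of the plane are total functions of which only the
   values on that subset matter. *)

Section plane.
Variable R : realType.
Local Notation C := (R[i]^o).
Implicit Types (D U K : set C) (f phi : C -> C).

Definition of_coord (p : R * R) : C := p.1 +i* p.2.

Definition frontier D : set C := closure D `\` D°.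

Definition plane_domain D := [/\ open D, connected D & D !=set0].

(* The limit defining [derivable f z 1] is taken over complex increments, so
   this is complex differentiability at every point of [D]. *)
Definition analytic_in D f := forall z, D z -> derivable f z 1.

Definition plane_measure := (@lebesgue_measure R \x @lebesgue_measure R)%E.

Definition plane_integral D f : C :=
  (\int[plane_measure]_(p in of_coord @^-1` D) complex.Re (f (of_coord p))) +i*
  (\int[plane_measure]_(p in of_coord @^-1` D) complex.Im (f (of_coord p))).

(* Being C^1 on [0, 1] with one-sided derivatives at the end points is the same
   as being the restriction of a C^1 function on the line. *)
Definition C1_arc (g : R -> C) :=
  [/\ (forall t, derivable (@complex.Re R \o g) t 1) /\ continuous (derive1 (@complex.Re R \o g)),
      (forall t, derivable (@complex.Im R \o g) t 1) /\ continuous (derive1 (@complex.Im R \o g)),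
      forall t, t \in `[0, 1] ->
        ~ ((derive1 (@complex.Re R \o g)) t = 0 /\ (derive1 (@complex.Im R \o g)) t = 0)
    & {in `[0, 1] &, injective g}].

(* The boundary consists of finitely many regular C^1 arcs which meet only at
   their end points (corners and cusps are allowed there), and, as usual for a
   set with C^1 boundary, the set lies on one side of its boundary. The last
   clause excludes slits; without it a slit disc would qualify. *)
Definition piecewise_C1_boundary D :=
  exists n (g : 'I_n -> R -> C),
    [/\ forall i, C1_arc (g i),
        frontier D = \bigcup_(i in [set: 'I_n]) (g i @` [set` `[0, 1]]),
        forall i j s t, i != j -> s \in `[0, 1] -> t \in `[0, 1] ->
          g i s = g j t -> (s = 0 \/ s = 1) /\ (t = 0 \/ t = 1)
      & frontier D `<=` closure (~` closure D)].

(* Iterated partial derivatives: [false] is d/dx and [true] is d/dy. *)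
Fixpoint partial (s : seq bool) (u : R * R -> R) : R * R -> R :=
  if s is b :: s' then
    'D_(if b then (0, 1) else (1, 0)) (partial s' u)
  else u.

Definition smooth (u : R * R -> R) := forall s,
  continuous (partial s u) /\
  forall (p : R * R) (b : bool),
    derivable (partial s u) p (if b then (0, 1) else (1, 0)).

Definition cpartial (s : seq bool) phi (p : R * R) : C :=
  partial s (@complex.Re R \o phi \o of_coord) p +i*
  partial s (@complex.Im R \o phi \o of_coord) p.

Definition supp phi : set C := closure [set z | phi z != 0].

Definition test_function phi :=
  [/\ smooth (@complex.Re R \o phi \o of_coord), smooth (@complex.Im R \o phi \o of_coord)
    & compact (supp phi)].

(* Complex-valued distributions on the plane; only the values of [mu] on test
   functions matter. *)
Definition plane_distribution (mu : (C -> C) -> C) :=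
  (forall (a : R[i]) phi psi, test_function phi -> test_function psi ->
     mu (fun z => a * phi z + psi z) = a * mu phi + mu psi) /\
  (forall K, compact K -> exists N (c : R), forall phi (M : R),
     test_function phi -> supp phi `<=` K ->
     (forall s p, (size s <= N)%N -> `|cpartial s phi p| <= M%:C) ->
     `|mu phi| <= (c * M)%:C).

Definition distribution_supp (mu : (C -> C) -> C) : set C :=
  ~` [set z | exists U, [/\ open U, U z &
    forall phi, test_function phi -> supp phi `<=` U -> mu phi = 0]].

Definition compact_support_in D (mu : (C -> C) -> C) :=
  compact (distribution_supp mu) /\ distribution_supp mu `<=` D.

(* [<mu, f> = v], where [mu] has compact support in the open set [D] and [f] is
   smooth in [D]: as usual <mu, f> = mu (chi f) for any smooth cutoff function
   chi supported in [D] and equal to 1 near the support of [mu]. Such cutoff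
   functions exist, and the value does not depend on the one chosen. *)
Definition pairing D (mu : (C -> C) -> C) f (v : C) :=
  forall chi, test_function chi -> supp chi `<=` D ->
    (exists U, [/\ open U, distribution_supp mu `<=` U &
       forall z, U z -> chi z = 1]) ->
    mu (fun z => chi z * f z) = v.

Definition two_phase_Schwarz_function (bp bm : R) (Dp Dm : set C)
    (Sp Sm : C -> C) :=
  let Gamma := frontier Dp `&` frontier Dm in
  exists Cp Cm : set C,
    [/\ [/\ compact Cp, Cp `<=` Dp, compact Cm & Cm `<=` Dm],
        {within closure Dp, continuous Sp} /\ analytic_in (Dp `\` Cp) Sp,
        {within closure Dm, continuous Sm} /\ analytic_in (Dm `\` Cm) Sm,
        (forall z, (frontier Dp `\` Gamma) z -> Sp z = bp%:C * conjc z) /\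
        (forall z, (frontier Dm `\` Gamma) z -> Sm z = - (bm%:C * conjc z))
      & forall z, Gamma z -> Sp z - Sm z = (bp + bm)%:C * conjc z].

Definition two_phase_quadrature_domain (bp bm : R) (Dp Dm : set C)
    (mu : (C -> C) -> C) :=
  let D := Dp `|` Dm in
  compact_support_in D mu /\
  forall f, analytic_in D f -> {within closure D, continuous f} ->
    pairing D mu f
      (bp%:C * plane_integral Dp f - bm%:C * plane_integral Dm f).

End plane.

(* Main.v *)
Require Import Defs.
From mathcomp Require Import all_boot all_order all_algebra.
From mathcomp Require Import all_classical all_reals all_analysis.
From mathcomp Require Import measurable_realfun complex ring lra.

(* Given (S_+, S_-), choose a smooth cutoff chi which is 1 near C_+ and C_- and
   supported in D, and let mu have density g = - S_+/- * dbar chi on D_+/-. The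
   function equal to S_+ (1 - chi) - beta_+ conj z on D_+, to
   S_- (1 - chi) + beta_- conj z on D_- and to 0 elsewhere is continuous on the
   plane, and multiplying it by f gives a function whose dbar derivative is
   (g - beta_+) f on D_+ and (g + beta_-) f on D_-. The integral of this
   derivative vanishes by Green's formula, which holds because the boundaries
   are covered by O(n) of the n^2 squares of a grid. Continuity at a point of
   Gamma which is a limit of exterior points uses that such a point is a limit
   of boundary points outside Gamma.

   Conversely let v(z) = beta_+ T_+(z) - beta_- T_-(z) - <mu, 1/(w - z)>, where
   T_+/- is the integral of 1/(w - z) over D_+/-, taken as a uniform limit over
   the kernels obtained by smoothing 1/w on small discs. Then v is continuous off
   the support of mu, vanishes off the closure of D by the quadrature identity, and has dbar
   derivative - c beta_+ on D_+ and c beta_- on D_- for a constant c > 0. Hence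
   +/- beta_+/- conj z + v / c is the two-phase Schwarz function, after cutting
   it off near the support of mu. *)

Set Implicit Arguments.
Unset Strict Implicit.
Unset Printing Implicit Defensive.

Import Order.TTheory GRing.Theory Num.Theory.
Import numFieldNormedType.Exports.

Local Open Scope classical_set_scope.
Local Open Scope ring_scope.
Local Open Scope complex_scope.

(** * The real modulus and epsilon-delta continuity *)

Section complex_basics.
Variable R : realType.
Local Notation C := (R[i]^o).
Implicit Types (z w : C) (r s : R).

(** The Schwarz functions are only continuous up to the boundary and only complex differentiable
    inside, so Green's formula is proved on one large square for a function that is continuous
    everywhere and differentiable off the boundaries. A boundary square of side [s] has circulation
    [o(s)] by uniform continuity; as [s] is of order [1/n], the [O(n)] of them contribute [o(1)].

    The identity to be proved for mu involves every cutoff that is 1 near the support of mu. Hence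
    all points where g is nonzero must be shown to lie in that support.

    In the converse the smoothed kernels are odd, so two of them differ by an odd function living on
    a small disc. Over a disc inside the domain it integrates to 0: the limit T coincides locally
    with a smoothed potential, which can be differentiated under the integral sign. The constant c
    is pi; what matters is that it is positive and the same at all points.

    On Gamma the values of v do not matter, as v is added to both functions and cancels in the
    difference. A boundary point outside Gamma is a limit of points off both closures, because the
    domain lies on one side of its boundary; there v = 0. *)

Definition nm (z : R[i]) : R := Num.sqrt (complex.Re z ^+ 2 + complex.Im z ^+ 2).

Lemma normE (z : R[i]) : `|z| = (nm z)%:C.
Proof. exact: normc_def. Qed.

Lemma nm_ge0 (z : R[i]) : 0 <= nm z. Proof. exact: sqrtr_ge0. Qed.

Lemma nm_sqr (z : R[i]) : nm z ^+ 2 = complex.Re z ^+ 2 + complex.Im z ^+ 2.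
Proof. by rewrite sqr_sqrtr// addr_ge0// sqr_ge0. Qed.

Lemma nmD (z w : R[i]) : nm (z + w) <= nm z + nm w.
Proof. by rewrite -lecR rmorphD/= -!normE ler_normD. Qed.

Lemma nmM (z w : R[i]) : nm (z * w) = nm z * nm w.
Proof. by apply/eqP; rewrite -(inj_eq (@complexI R)) rmorphM/= -!normE normrM. Qed.

Lemma nmN (z : R[i]) : nm (- z) = nm z.
Proof. by apply/eqP; rewrite -(inj_eq (@complexI R)) -!normE normrN. Qed.

Lemma nm0 : nm 0 = 0.
Proof. by rewrite /nm/= expr0n/= addr0 sqrtr0. Qed.

Lemma nmC (a : R) : nm a%:C = `|a|.
Proof. by rewrite /nm/= expr0n/= addr0 sqrtr_sqr. Qed.

Lemma nm_conj (z : R[i]) : nm (conjc z) = nm z.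
Proof. by case: z => a b; rewrite /nm/= sqrrN. Qed.

Lemma nm_eq0 (z : R[i]) : (nm z == 0) = (z == 0).
Proof. by rewrite -(inj_eq (@complexI R)) -normE normr_eq0. Qed.

Lemma nm_gt0 (z : R[i]) : (0 < nm z) = (z != 0).
Proof. by rewrite lt_def nm_ge0 andbT nm_eq0. Qed.

Lemma nmV (z : R[i]) : nm z^-1 = (nm z)^-1.
Proof.
have [->|z0] := eqVneq z 0; first by rewrite invr0 nm0 invr0.
apply: (@mulfI _ (nm z)); first by rewrite nm_eq0.
rewrite -nmM divff// divff ?nm_eq0//.
by rewrite (_ : 1 = 1%:C)// nmC normr1.
Qed.

Lemma nmB (z w : R[i]) : nm (z - w) <= nm z + nm w.
Proof. by rewrite (le_trans (nmD _ _))// nmN. Qed.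

Lemma nm_distC (z w : R[i]) : nm (z - w) = nm (w - z).
Proof. by rewrite -nmN opprB. Qed.

Lemma nm_triB (x z w : R[i]) : nm (x - w) <= nm (x - z) + nm (z - w).
Proof. by rewrite (le_trans _ (nmD _ _))// addrA subrK. Qed.

Lemma Re_nm (z : R[i]) : `|complex.Re z| <= nm z.
Proof.
by rewrite -(ler_pXn2r (_ : 0 < 2)%N) ?nnegrE ?nm_ge0// nm_sqr real_normK ?num_real// lerDl sqr_ge0.
Qed.

Lemma Im_nm (z : R[i]) : `|complex.Im z| <= nm z.
Proof.
by rewrite -(ler_pXn2r (_ : 0 < 2)%N) ?nnegrE ?nm_ge0// nm_sqr real_normK ?num_real// lerDr sqr_ge0.
Qed.

Lemma nm_ReIm (z : R[i]) : nm z <= `|complex.Re z| + `|complex.Im z|.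
Proof.
rewrite -(ler_pXn2r (_ : 0 < 2)%N) ?nnegrE ?nm_ge0 ?addr_ge0// nm_sqr sqrrD.
by rewrite !real_normK ?num_real// addrAC lerDl mulrn_wge0// mulr_ge0.
Qed.

Lemma complexE (z : R[i]) : z = complex.Re z +i* complex.Im z.
Proof. by case: z. Qed.

Lemma nbhs_complexP z (U : set C) :
  nbhs z U <-> exists2 r : R, 0 < r & forall w, nm (w - z) < r -> U w.
Proof.
split=> [/nbhs_ballP[e /= e0 eU]|[r r0 rU]].
  move: e0; rewrite ltcE/= => /andP[/eqP ie e0].
  exists (complex.Re e) => // w wr; apply: eU.
  rewrite -ball_normE/= -normrN opprB normE [ltRHS]complexE ie.
  by rewrite [X in _ < X](_ : _ = (complex.Re e)%:C)// ltcR.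
apply/nbhs_ballP; exists (r%:C) => /=; first by rewrite ltcR.
move=> w; rewrite -ball_normE/= -normrN opprB normE ltcR; exact: rU.
Qed.

Lemma open_complexP (U : set C) :
  open U <-> forall z, U z -> exists2 r : R, 0 < r & forall w, nm (w - z) < r -> U w.
Proof.
rewrite openE; split=> [oU z /oU|oU z /oU rz]; first by move/nbhs_complexP.
exact/nbhs_complexP.
Qed.

Lemma closure_complexP (K : set C) z :
  closure K z <-> forall r : R, 0 < r -> exists2 w, K w & nm (w - z) < r.
Proof.
split=> [Kz r r0|H U /nbhs_complexP[r r0 rU]].
  have /Kz[w [Kw wr]] : nbhs z [set w | nm (w - z) < r].
    by apply/nbhs_complexP; exists r.
  by exists w.
by have [w Kw wr] := H _ r0; exists w; split=> //; exact: rU.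
Qed.

Definition ccont (K : set C) (f : C -> C) := forall z, K z -> forall e : R, 0 < e ->
  exists2 d : R, 0 < d & forall w, K w -> nm (w - z) < d -> nm (f w - f z) < e.

Lemma ccontP (K : set C) f : {within K, continuous f} <-> ccont K f.
Proof.
rewrite subspace_continuousP; split=> [cf z Kz e e0|cf z Kz].
  have /(cf z Kz)/nbhs_complexP[d d0 dV] : nbhs (f z) [set w | nm (w - f z) < e].
    by apply/nbhs_complexP; exists e.
  by exists d => // w Kw wz; exact: dV.
move=> U /nbhs_complexP[e e0 eU]; have [d d0 dH] := cf z Kz e e0.
by apply/nbhs_complexP; exists d => // w wz /= Kw; apply: eU; exact: dH.
Qed.

End complex_basics.

(** * Integration over the plane *)

Section bounded_measurable.
Context d (T : measurableType d) (R : realType) (mu : {measure set T -> \bar R}).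
Implicit Types (D : set T) (f g : T -> R).

(** Unlike integrability, this property is stable under products, and it implies integrability on
    every set of finite measure. *)
Definition bdm D f := measurable_fun D f /\ exists M : R, forall x, D x -> `|f x| <= M.

Lemma bdm_integrable D f : measurable D -> (mu D < +oo)%E -> bdm D f ->
  mu.-integrable D (EFin \o f).
Proof.
move=> mD finD [mf [M fM]]; apply: measurable_bounded_integrable => //.
exists M; split; first exact: num_real.
by move=> r Mr x Dx /=; rewrite (le_trans (fM _ Dx))// ltW.
Qed.

Lemma bdm_cst D (c : R) : bdm D (cst c).
Proof. by split; [exact: measurable_cst|exists `|c|]. Qed.

Lemma bdmD D f g : bdm D f -> bdm D g -> bdm D (fun x => f x + g x).
Proof.
move=> [mf [M fM]] [mg [N gN]]; split; first exact: measurable_funD.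
by exists (M + N) => x Dx; rewrite (le_trans (ler_normD _ _))// lerD ?fM ?gN.
Qed.

Lemma bdmM D f g : bdm D f -> bdm D g -> bdm D (fun x => f x * g x).
Proof.
move=> [mf [M fM]] [mg [N gN]]; split; first exact: measurable_funM.
by exists (M * N) => x Dx; rewrite normrM ler_pM ?fM ?gN.
Qed.

Lemma bdmN D f : bdm D f -> bdm D (fun x => - f x).
Proof.
move=> /(bdmM (bdm_cst D (-1))); congr bdm.
by apply/funext => x; rewrite /cst/= mulN1r.
Qed.

Lemma bdmB D f g : bdm D f -> bdm D g -> bdm D (fun x => f x - g x).
Proof. by move=> ? ?; apply: bdmD => //; exact: bdmN. Qed.

Lemma bdm_sub D E f : measurable E -> D `<=` E -> bdm E f -> bdm D f.
Proof.
move=> mE DE [mf [M fM]]; split; first exact: measurable_funS mf.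
by exists M => x /DE; exact: fM.
Qed.

Lemma bdm_eq D f g : {in D, f =1 g} -> bdm D f -> bdm D g.
Proof.
move=> fg [mf [M fM]]; split; first exact: eq_measurable_fun mf.
by exists M => x Dx; rewrite -fg ?inE// fM.
Qed.

Lemma Rintegral_bound D f (M : R) : measurable D -> (mu D < +oo)%E -> bdm D f ->
  (forall x, D x -> `|f x| <= M) -> `|\int[mu]_(x in D) f x| <= M * fine (mu D).
Proof.
move=> mD finD bf fM; have intf := bdm_integrable mD finD bf.
rewrite (le_trans (le_normr_Rintegral mD intf))// -Rintegral_cst//.
apply: le_Rintegral => //; first exact: integrable_norm intf.
by apply: bdm_integrable => //; exact: bdm_cst.
Qed.

End bounded_measurable.

Section plane_measure.
Variable R : realType.
Notation mu2 := (@plane_measure R).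
Notation C := (R[i]^o).

Lemma nbhs2 (p : R * R) (U : set (R * R)) :
  nbhs p U <-> exists2 r : R, 0 < r &
    forall q, `|q.1 - p.1| < r -> `|q.2 - p.2| < r -> U q.
Proof.
split=> [/nbhs_ballP[e /= e0 eU]|[r r0 rU]].
  by exists e => // q q1 q2; apply: eU; split; rewrite /ball/= distrC.
apply/nbhs_ballP; exists r => //= q [q1 q2].
by apply: rU; rewrite distrC.
Qed.

Lemma continuous2 (u : R * R -> R) (p : R * R) : {for p, continuous u} <->
  forall e, 0 < e -> exists2 r : R, 0 < r &
    forall q, `|q.1 - p.1| < r -> `|q.2 - p.2| < r -> `|u q - u p| < e.
Proof.
split=> [cu e e0|H].
  have /cu/nbhs2[r r0 rH] : nbhs (u p) (ball (u p) e) by apply: nbhsx_ballx.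
  by exists r => // q q1 q2; have := rH _ q1 q2; rewrite /ball/= distrC.
apply/cvgrPdist_lt => e e0; have [r r0 rH] := H _ e0.
by apply/nbhs2; exists r => // q q1 q2; rewrite distrC; exact: rH.
Qed.

(** The measurable sets are generated by rectangles, so the open set is written as the union of the
    countably many boxes with rational centre and radius that it contains. *)
Lemma open_measurable2 (U : set (R * R)) : open U -> measurable U.
Proof.
rewrite openE => oU.
pose box (q : rat * rat * rat) : set (R * R) :=
  `]ratr q.1.1 - ratr q.2, ratr q.1.1 + ratr q.2[ `*`
  `]ratr q.1.2 - ratr q.2, ratr q.1.2 + ratr q.2[.
pose F q := if `[< box q `<=` U >] then box q else set0.
have -> : U = \bigcup_q F q.
  apply/seteqP; split=> [[x y] Uxy|p [q _]]; last first.
    by rewrite /F; case: asboolP => // qU /qU.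
  have /nbhs2[e e0 eU] := oU _ Uxy.
  (* With radius below [e / 2] and centre within the radius of the point, the box stays within [e]
     of it. *)
  have [r] := @rat_in_itvoo R 0 (e / 2) (divr_gt0 e0 (ltr0n R 2)).
  rewrite in_itv/= => /andP[r0 re].
  have [q1] := @rat_in_itvoo R (x - ratr r) (x + ratr r) ltac:(lra).
  rewrite in_itv/= => /andP[q1l q1r].
  have [q2] := @rat_in_itvoo R (y - ratr r) (y + ratr r) ltac:(lra).
  rewrite in_itv/= => /andP[q2l q2r].
  exists (q1, q2, r) => //; rewrite /F; case: asboolP => [_|]; last first.
    case=> -[x' y'] []/=; rewrite !in_itv/= => /andP[a1 a2] /andP[b1 b2].
    by apply: eU; rewrite /= ltr_distl; apply/andP; split; lra.
  by split; rewrite /= in_itv/=; apply/andP; split; lra.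
apply: countable_bigcupT_measurable => // q; rewrite /F; case: asboolP => // _.
exact: measurableX.
Qed.

Lemma continuous_measurable2 (W : set (R * R)) (u : R * R -> R) :
  open W -> (forall p, W p -> {for p, continuous u}) -> measurable_fun W u.
Proof.
move=> oW cu; apply: (measurability _ (RGenOpens.measurableE R)).
move=> _ [_ [a [b ->] <-]]; apply: open_measurable2; rewrite openE => p [Wp abp].
move: oW; rewrite openE => /(_ _ Wp) Wn; apply: filterI => //.
by apply: (cu _ Wp); apply: open_nbhs_nbhs; split => //; exact: interval_open.
Qed.

Lemma bdm_integrable2 (W : set (R * R)) (u : R * R -> R) :
  measurable W -> (mu2 W < +oo)%E -> bdm W u -> mu2.-integrable W (EFin \o u).
Proof. exact: (@bdm_integrable _ _ R (@lebesgue_measure R \x @lebesgue_measure R)%E). Qed.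

Lemma Rintegral_bound2 (W : set (R * R)) (u : R * R -> R) (M : R) :
  measurable W -> (mu2 W < +oo)%E -> bdm W u ->
  (forall p, W p -> `|u p| <= M) -> `|\int[mu2]_(p in W) u p| <= M * fine (mu2 W).
Proof. exact: (@Rintegral_bound _ _ R (@lebesgue_measure R \x @lebesgue_measure R)%E). Qed.

Lemma open_of_coord (A : set C) : open A -> open (@of_coord R @^-1` A).
Proof.
move=> /open_complexP oA; rewrite openE => p /= /oA[r r0 rA].
apply/nbhs2; exists (r / 2); first by rewrite divr_gt0.
by move=> q q1 q2; apply: rA; rewrite (le_lt_trans (nm_ReIm _))//= [ltRHS]splitr ltrD.
Qed.

(** Half-open on both axes, so that the cells of a grid are disjoint and their union is again such a
    rectangle. *)
Definition rect (a b c d : R) : set (R * R) := `]a, b] `*` `]c, d].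

Lemma measurable_rect a b c d : measurable (rect a b c d).
Proof. exact: measurableX. Qed.

Lemma mu2_rect a b c d : a <= b -> c <= d ->
  mu2 (rect a b c d) = ((b - a) * (d - c))%:E.
Proof.
move=> ab cd; rewrite /plane_measure product_measure1E//= !lebesgue_measure_itv/= !lte_fin.
move: ab cd; rewrite !le_eqVlt => /predU1P[->|ab].
  by rewrite ltxx subrr mul0r mul0e.
by rewrite ab => /predU1P[->|->]; [rewrite ltxx subrr mulr0 mule0|rewrite EFinM !EFinB].
Qed.

Lemma of_coord_continuous (p : R * R) : {for p, continuous (@of_coord R)}.
Proof.
move=> U /nbhs_complexP[e e0 eU]; apply/nbhs2; exists (e / 2); first by rewrite divr_gt0.
move=> q q1 q2; apply: eU; rewrite (le_lt_trans (nm_ReIm _))//=.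
by rewrite [ltRHS]splitr ltrD.
Qed.

Definition finite_area (D : set C) :=
  measurable (@of_coord R @^-1` D) /\ (mu2 (@of_coord R @^-1` D) < +oo)%E.

Definition cbdm (D : set C) (f : C -> C) :=
  bdm (@of_coord R @^-1` D) (@complex.Re R \o f \o @of_coord R) /\
  bdm (@of_coord R @^-1` D) (@complex.Im R \o f \o @of_coord R).

Implicit Types (D E : set C) (f g : C -> C) (c : C).

Definition area (D : set C) : R := fine (mu2 (@of_coord R @^-1` D)).

Lemma area_ge0 D : 0 <= area D.
Proof. by rewrite fine_ge0. Qed.

Lemma cbdmD D f g : cbdm D f -> cbdm D g -> cbdm D (fun z => f z + g z).
Proof.
move=> [f1 f2] [g1 g2]; split.
  by apply: bdm_eq (bdmD f1 g1) => p _ /=; case: (f _) (g _) => ? ? [].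
by apply: bdm_eq (bdmD f2 g2) => p _ /=; case: (f _) (g _) => ? ? [].
Qed.

Lemma cbdmM D f g : cbdm D f -> cbdm D g -> cbdm D (fun z => f z * g z).
Proof.
move=> [f1 f2] [g1 g2]; split.
  apply: bdm_eq (bdmB (bdmM f1 g1) (bdmM f2 g2)) => p _ /=.
  by case: (f _) (g _) => ? ? [].
apply: bdm_eq (bdmD (bdmM f1 g2) (bdmM f2 g1)) => p _ /=.
by case: (f _) (g _) => ? ? [].
Qed.

Lemma cbdm_cst D c : cbdm D (cst c).
Proof. by split; exact: bdm_cst. Qed.

Lemma cbdmZ D c f : cbdm D f -> cbdm D (fun z => c * f z).
Proof. by move=> ?; apply: cbdmM => //; exact: cbdm_cst. Qed.

Lemma cbdm_eq D f g : (forall z, D z -> f z = g z) -> cbdm D f -> cbdm D g.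
Proof.
by move=> fg [f1 f2]; split; [apply: bdm_eq f1|apply: bdm_eq f2] => p;
  rewrite inE /= => /fg ->.
Qed.

Lemma cbdm_sub D E f : measurable (@of_coord R @^-1` E) -> D `<=` E -> cbdm E f -> cbdm D f.
Proof.
by move=> mE DE [f1 f2]; split; [apply: bdm_sub f1|apply: bdm_sub f2] => // p /DE.
Qed.

Lemma addcE (a b c d : R) : (a +i* b : C) + (c +i* d) = (a + c) +i* (b + d).
Proof. by []. Qed.

Lemma mulcE (a b c d : R) :
  (a +i* b : C) * (c +i* d) = (a * c - b * d) +i* (a * d + b * c).
Proof. by []. Qed.

Lemma eq_plane_integral D f g : (forall z, D z -> f z = g z) ->
  plane_integral D f = plane_integral D g.
Proof.
by move=> fg; congr (_ +i* _); apply: eq_Rintegral => p; rewrite inE /= => /fg ->.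
Qed.

Lemma plane_integralD D f g : finite_area D -> cbdm D f -> cbdm D g ->
  plane_integral D (fun z => f z + g z) = plane_integral D f + plane_integral D g.
Proof.
move=> [mD fD] [f1 f2] [g1 g2]; rewrite /plane_integral.
rewrite addcE -!RintegralD//; try exact: bdm_integrable2.
by congr (_ +i* _); apply: eq_Rintegral => p _; case: (f _) (g _) => ? ? [].
Qed.

Lemma plane_integralZ D c f : finite_area D -> cbdm D f ->
  plane_integral D (fun z => c * f z) = c * plane_integral D f.
Proof.
move=> [mD fD] [f1 f2]; rewrite /plane_integral; case: c => a b.

rewrite mulcE -!RintegralZl; try exact: bdm_integrable2; try by [].
have i1 r : mu2.-integrable (@of_coord R @^-1` D)
    (EFin \o (fun p => r * complex.Re (f (of_coord p)))).
  by apply: bdm_integrable2 => //; apply: bdmM => //; exact: bdm_cst.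
have i2 r : mu2.-integrable (@of_coord R @^-1` D)
    (EFin \o (fun p => r * complex.Im (f (of_coord p)))).
  by apply: bdm_integrable2 => //; apply: bdmM => //; exact: bdm_cst.
rewrite -RintegralB// -RintegralD//.
by congr (_ +i* _); apply: eq_Rintegral => p _ /=; case: (f _).
Qed.

(** The factor 2 comes from estimating the real and imaginary parts separately. *)
Lemma plane_integral_bound D f (M : R) : finite_area D -> cbdm D f ->
  (forall z, D z -> nm (f z) <= M) -> nm (plane_integral D f) <= 2 * M * area D.
Proof.
move=> [mD fD] [f1 f2] fM.
rewrite (le_trans (nm_ReIm _))// mulrAC mulr2n mulrDl mul1r mulrDl.
rewrite mulrC lerD//= Rintegral_bound2// => p Dp /=.
  by rewrite (le_trans (Re_nm _))// fM.
by rewrite (le_trans (Im_nm _))// fM.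
Qed.

Lemma plane_integralU D E f : finite_area D -> finite_area E -> D `&` E = set0 ->
  cbdm (D `|` E) f ->
  plane_integral (D `|` E) f = plane_integral D f + plane_integral E f.
Proof.
move=> [mD fD] [mE fE] DE [f1 f2]; rewrite /plane_integral preimage_setU.
have fU : (mu2 (@of_coord R @^-1` D `|` @of_coord R @^-1` E) < +oo)%E.
  by rewrite (le_lt_trans (measureU2 _ _ _))// lte_add_pinfty.
have dis : [disjoint @of_coord R @^-1` D & @of_coord R @^-1` E].
  by apply/disj_setPS => p /=; have : (D `&` E) (of_coord p) -> False by rewrite DE.
by rewrite !Rintegral_setU//; exact: bdm_integrable2 (measurableU _ _ mD mE) _ _.
Qed.

End plane_measure.

(** * Line integrals and the Green defect of a rectangle *)

Section interval_integral.
Variable R : realType.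
Notation lb := (@lebesgue_measure R).
Implicit Types (f g : R -> R) (a b m : R).

Definition iint f a b : R := \int[lb]_(x in `]a, b]) f x.

Lemma itvoc_finite a b : (lb `]a, b] < +oo)%E.
Proof. by rewrite lebesgue_measure_itv/=; case: ifP => // _; rewrite -EFinB ltry. Qed.

Lemma itvoc_measure a b : a <= b -> fine (lb `]a, b]) = b - a.
Proof.
rewrite lebesgue_measure_itv/= lte_fin le_eqVlt => /predU1P[->|->] //.
by rewrite ltxx/= subrr.
Qed.

Lemma bdm_itvoc f a b : bdm setT f -> bdm `]a, b] f.
Proof. by apply: bdm_sub. Qed.

Lemma iint_integrable f a b : bdm setT f -> lb.-integrable `]a, b] (EFin \o f).
Proof.
by move=> bf; apply: bdm_integrable => //; [exact: itvoc_finite|exact: bdm_itvoc].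
Qed.

Lemma iint_split f a m b : bdm setT f -> a <= m -> m <= b ->
  iint f a b = iint f a m + iint f m b.
Proof.
move=> bf am mb; rewrite /iint.
have E : `]a, b]%classic = `]a, m]%classic `|` `]m, b]%classic :> set R.
  by rewrite -itv_bndbnd_setU// bnd_simp.
rewrite E Rintegral_setU//; first by rewrite -E; exact: iint_integrable.
apply/disj_setPS => x /= []; rewrite !in_itv/= => /andP[_ xm] /andP[mx _].
by have := lt_le_trans mx xm; rewrite ltxx.
Qed.

Lemma iintB f g a b : bdm setT f -> bdm setT g ->
  iint (fun x => f x - g x) a b = iint f a b - iint g a b.
Proof. by move=> bf bg; rewrite /iint RintegralB//; exact: iint_integrable. Qed.

Lemma iint_bound f a b M : bdm setT f -> a <= b ->
  (forall x, a < x -> x <= b -> `|f x| <= M) -> `|iint f a b| <= M * (b - a).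
Proof.
move=> bf ab fM; rewrite -itvoc_measure//; apply: Rintegral_bound => //.
- exact: itvoc_finite.
- exact: bdm_itvoc.
- by move=> x /=; rewrite in_itv/= => /andP[]; exact: fM.
Qed.

Lemma iint_approx f a b (c0 M : R) : bdm setT f -> a <= b ->
  (forall x, a < x -> x <= b -> `|f x - c0| <= M) ->
  `|iint f a b - c0 * (b - a)| <= M * (b - a).
Proof.
move=> bf ab fM.
have -> : c0 * (b - a) = iint (cst c0) a b.
  by rewrite /iint Rintegral_cst// itvoc_measure.
rewrite -iintB//; last exact: bdm_cst.
by apply: iint_bound => //; apply: bdmB => //; exact: bdm_cst.
Qed.

End interval_integral.

Section green.
Variable R : realType.
Notation mu2 := (@plane_measure R).
Variables A B G : R * R -> R.
Hypothesis Ax : forall c, bdm setT (fun x => A (x, c)).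
Hypothesis By : forall a, bdm setT (fun y => B (a, y)).
Hypothesis bG : bdm setT G.

(** The counterclockwise circulation of [A dx + B dy]. *)
Definition bdry a b c d : R :=
  iint (fun x => A (x, c)) a b - iint (fun x => A (x, d)) a b
  + (iint (fun y => B (b, y)) c d - iint (fun y => B (a, y)) c d).

(** The defect in Green's formula, with [G] in the role of [B_x - A_y]. It is additive under
    subdivision because the circulations along a common edge cancel. *)
Definition Phi a b c d : R := bdry a b c d - \int[mu2]_(p in rect a b c d) G p.

Lemma rect_finite (a b c d : R) : (mu2 (rect a b c d) < +oo)%E.
Proof.
rewrite /plane_measure /rect product_measure1E//; apply: lte_mul_pinfty => //.
- by rewrite ge0_fin_numE// itvoc_finite.
- exact: itvoc_finite.
Qed.

Lemma bdm_rect a b c d : bdm (rect a b c d) G.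
Proof. by apply: bdm_sub bG. Qed.

Lemma rect_integrable a b c d : mu2.-integrable (rect a b c d) (EFin \o G).
Proof.
apply: bdm_integrable2; [exact: measurable_rect|exact: rect_finite|exact: bdm_rect].
Qed.

Lemma Phi_splitx a m b c d : a <= m -> m <= b ->
  Phi a b c d = Phi a m c d + Phi m b c d.
Proof.
move=> am mb; rewrite /Phi /bdry !(iint_split (Ax _) am mb).
have E : rect a b c d = rect a m c d `|` rect m b c d.
  apply/seteqP; split=> -[x y]; rewrite /rect/= !in_itv/=.
    by move=> [/andP[x1 x2] /andP[y1 y2]]; case: (leP x m) => h;
      [left|right]; rewrite ?x1 ?x2 ?y1 ?y2.
  by move=> [] [/andP[x1 x2] /andP[y1 y2]]; split;
    apply/andP; split; lra.
rewrite E Rintegral_setU; first by ring.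
- exact: measurable_rect.
- exact: measurable_rect.
- by rewrite -E; exact: rect_integrable.
apply/disj_setPS => x /= [] [/= + _] [/= + _]; rewrite !in_itv/= => /andP[_ xm] /andP[mx _].
by have := lt_le_trans mx xm; rewrite ltxx.
Qed.

Lemma Phi_splity a b c m d : c <= m -> m <= d ->
  Phi a b c d = Phi a b c m + Phi a b m d.
Proof.
move=> cm md; rewrite /Phi /bdry !(iint_split (By _) cm md).
have E : rect a b c d = rect a b c m `|` rect a b m d.
  apply/seteqP; split=> -[x y]; rewrite /rect/= !in_itv/=.
    by move=> [/andP[x1 x2] /andP[y1 y2]]; case: (leP y m) => h;
      [left|right]; rewrite ?x1 ?x2 ?y1 ?y2.
  by move=> [] [/andP[x1 x2] /andP[y1 y2]]; split;
    apply/andP; split; lra.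
rewrite E Rintegral_setU; first by ring.
- exact: measurable_rect.
- exact: measurable_rect.
- by rewrite -E; exact: rect_integrable.
apply/disj_setPS => x /= [] [_ /= +] [_ /= +]; rewrite !in_itv/= => /andP[_ xm] /andP[mx _].
by have := lt_le_trans mx xm; rewrite ltxx.
Qed.

Lemma Phi_gridx a s c d (n : nat) : 0 <= s ->
  Phi a (a + n%:R * s) c d =
  \sum_(i < n) Phi (a + i%:R * s) (a + i.+1%:R * s) c d.
Proof.
move=> s0; elim: n => [|n IH].
  rewrite big_ord0 mul0r addr0.
  (* A degenerate rectangle splits into two copies of itself, so its defect is 0. *)
  have /eqP := Phi_splitx c d (lexx a) (lexx a).
  by rewrite -subr_eq subrr eq_sym => /eqP.
rewrite big_ord_recr/= -IH; apply: Phi_splitx.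
  by rewrite lerDl mulr_ge0.
by rewrite lerD2l ler_wpM2r// ler_nat.
Qed.

Lemma Phi_gridy a b c s (n : nat) : 0 <= s ->
  Phi a b c (c + n%:R * s) =
  \sum_(j < n) Phi a b (c + j%:R * s) (c + j.+1%:R * s).
Proof.
move=> s0; elim: n => [|n IH].
  rewrite big_ord0 mul0r addr0.
  have /eqP := Phi_splity a b (lexx c) (lexx c).
  by rewrite -subr_eq subrr eq_sym => /eqP.
rewrite big_ord_recr/= -IH; apply: Phi_splity.
  by rewrite lerDl mulr_ge0.
by rewrite lerD2l ler_wpM2r// ler_nat.
Qed.

Lemma Phi_grid a c s (n : nat) : 0 <= s ->
  Phi a (a + n%:R * s) c (c + n%:R * s) =
  \sum_(i < n) \sum_(j < n)
    Phi (a + i%:R * s) (a + i.+1%:R * s) (c + j%:R * s) (c + j.+1%:R * s).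
Proof.
by move=> s0; rewrite Phi_gridx//; apply: eq_bigr => i _; exact: Phi_gridy.
Qed.

(** The affine parts of [A] and [B] have circulation exactly [(B1 - A2) * s ^+ 2]. Each pair of
    opposite sides adds an error of at most [2 * w * s], and the integral of [G] one of at most
    [k * s ^+ 2]. *)
Lemma Phi_approx (p : R * R) (A1 A2 B1 B2 g0 w k a b c d s : R) :
  b = a + s -> d = c + s -> 0 <= s ->
  (forall q, a <= q.1 <= b -> c <= q.2 <= d ->
    `|A q - A p - A1 * (q.1 - p.1) - A2 * (q.2 - p.2)| <= w) ->
  (forall q, a <= q.1 <= b -> c <= q.2 <= d ->
    `|B q - B p - B1 * (q.1 - p.1) - B2 * (q.2 - p.2)| <= w) ->
  (forall q, a <= q.1 <= b -> c <= q.2 <= d -> `|G q - g0| <= k) ->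
  `|Phi a b c d - (B1 - A2 - g0) * s ^+ 2| <= 4 * w * s + k * s ^+ 2.
Proof.
move=> bE dE s0 Aw Bw Gk.
have ab : a <= b by rewrite bE lerDl.
have cd : c <= d by rewrite dE lerDl.
have bas : b - a = s by rewrite bE addrC addKr.
have dcs : d - c = s by rewrite dE addrC addKr.
have HA : `|iint (fun x => A (x, c)) a b - iint (fun x => A (x, d)) a b + A2 * s * s|
    <= 2 * w * s.
  rewrite -iintB// -[X in `|_ + X|]opprK -mulNr -[X in _ - _ * X]bas -[X in _ <= _ * X]bas.
  apply: iint_approx => //; first exact: bdmB.
  move=> x ax xb.
  have := Aw (x, c); have := Aw (x, d); rewrite /= (ltW ax) xb lexx cd/= lexx.
  move=> /(_ isT isT) + /(_ isT isT).
  rewrite !ler_norml => /andP[h1 h2] /andP[h3 h4]; subst d; apply/andP; split; nra.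
have HB : `|iint (fun y => B (b, y)) c d - iint (fun y => B (a, y)) c d - B1 * s * s|
    <= 2 * w * s.
  rewrite -iintB// -[X in `|_ - _ * X|]dcs -[X in _ <= _ * X]dcs.
  apply: iint_approx => //; first exact: bdmB.
  move=> y cy yd.
  have := Bw (a, y); have := Bw (b, y); rewrite /= (ltW cy) yd lexx ab/= lexx.
  move=> /(_ isT isT) + /(_ isT isT).
  rewrite !ler_norml => /andP[h1 h2] /andP[h3 h4]; subst b; apply/andP; split; nra.
have HG : `|\int[mu2]_(p in rect a b c d) G p - g0 * s ^+ 2| <= k * s ^+ 2.
  have ms : fine (mu2 (rect a b c d)) = s ^+ 2.
    by rewrite mu2_rect//= bas dcs expr2.
  have -> : g0 * s ^+ 2 = \int[mu2]_(p in rect a b c d) g0.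
    by rewrite Rintegral_cst ?ms//; exact: measurable_rect.
  rewrite -RintegralB//; last 3 first.
  - exact: measurable_rect.
  - exact: rect_integrable.
  - apply: bdm_integrable2; [exact: measurable_rect|exact: rect_finite|exact: bdm_cst].
  rewrite -ms; apply: Rintegral_bound2; [exact: measurable_rect|exact: rect_finite| |].
    by apply: bdmB; [exact: bdm_rect|exact: bdm_cst].
  move=> q [/=]; rewrite !in_itv/= => /andP[q1 q2] /andP[q3 q4].
  by apply: Gk; rewrite ?q2 ?q4 ltW.
rewrite /Phi /bdry; move: HA HB HG; rewrite !ler_norml.
move=> /andP[h1 h2] /andP[h3 h4] /andP[h5 h6].
by apply/andP; split; nra.
Qed.

End green.

(** * Goursat's lemma and Green's formula *)

Section goursat.
Variable R : realType.
Notation mu2 := (@plane_measure R).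

Let five_sixths (d : R) : 0 < d -> 5 * (d / 6) <= d.
Proof. by move=> ?; lra. Qed.

Let arith1 (K e : R) : 0 <= K -> 0 < e -> 4 * K * (e / (8 * (K + 1))) <= e / 2.
Proof. by move=> K0 e0; rewrite mulrA ler_pdivrMr; [nra|lra]. Qed.

Let arith2 (e x y : R) : x <= e / 2 -> y <= e / 2 -> x + y <= e.
Proof. by move=> ? ?; lra. Qed.

Definition rdiff (u : R * R -> R) (p : R * R) (u1 u2 : R) :=
  forall e, 0 < e -> exists2 r : R, 0 < r & forall q,
    `|q.1 - p.1| <= r -> `|q.2 - p.2| <= r ->
    `|u q - u p - u1 * (q.1 - p.1) - u2 * (q.2 - p.2)|
      <= e * Num.max `|q.1 - p.1| `|q.2 - p.2|.

Variables A B G : R * R -> R.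
Hypothesis Ax : forall c, bdm setT (fun x => A (x, c)).
Hypothesis By : forall a, bdm setT (fun y => B (a, y)).
Hypothesis bG : bdm setT G.

Notation Psi := (Phi A B G).

Lemma pow2_small (s e : R) : 0 < e -> exists n, s / 2 ^+ n < e.
Proof.
move=> e0; exists (Num.truncn (s / e)).+1.
rewrite ltr_pdivrMr ?exprn_gt0// mulrC -ltr_pdivrMr//.
rewrite (lt_le_trans (truncnS_gt _))//.
by rewrite -natrX ler_nat ltnW// ltn_expl.
Qed.

Lemma sqr_itv_dist (x y a s : R) : a <= x <= a + s -> a <= y <= a + s -> `|x - y| <= s.
Proof.
by move=> /andP[? ?] /andP[? ?]; rewrite ler_norml; apply/andP; split; lra.
Qed.

Lemma Phi_quarter (x y t k : R) : 0 <= t ->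
  (forall i j : bool, `|Psi (x + t *+ i) (x + t *+ i + t) (y + t *+ j) (y + t *+ j + t)| <= k) ->
  `|Psi x (x + (t + t)) y (y + (t + t))| <= 4 * k.
Proof.
move=> t0 h; rewrite !addrA (Phi_splitx B Ax bG (m := x + t)) ?lerDl//.
rewrite (Phi_splity A By bG x _ (m := y + t)) ?lerDl//.
rewrite (Phi_splity A By bG (x + t) _ (m := y + t)) ?lerDl//.
have := h false false; have := h true false; have := h false true; have := h true true.
rewrite !mulr1n !mulr0n !addr0 => h1 h2 h3 h4.
rewrite (le_trans (ler_normD _ _))// (le_trans (lerD (ler_normD _ _) (ler_normD _ _)))//.
by rewrite [leRHS](_ : _ = (k + k) + (k + k)) ?lerD//; ring.
Qed.

Lemma sub_itv (x t : R) (i : bool) : 0 <= t ->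
  x <= x + t *+ i /\ x + t *+ i + t <= x + (t + t).
Proof. by case: i; rewrite ?mulr1n ?mulr0n => t0; split; lra. Qed.

(* Bisection: a square violating [|Psi| <= d * area] has a quarter violating it. *)
Lemma goursat (a c s : R) : 0 < s ->
  (forall p, a <= p.1 <= a + s -> c <= p.2 <= c + s ->
     {for p, continuous G} /\
     exists A1 A2 B1 B2, [/\ rdiff A p A1 A2, rdiff B p B1 B2 & G p = B1 - A2]) ->
  Psi a (a + s) c (c + s) = 0.
Proof.
move=> s0 H; apply/eqP; rewrite -normr_eq0 eq_le normr_ge0 andbT.
apply/ler_addgt0Pr => e e0; rewrite add0r leNgt; apply/negP => bad.
(* The ratio for which the initial square violates the bound [d * area]. *)
pose d := e / s ^+ 2.
have d0 : 0 < d by rewrite divr_gt0 ?exprn_gt0.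
pose sz n : R := s / 2 ^+ n.
have sz0 n : 0 < sz n by rewrite divr_gt0 ?exprn_gt0.
have szS n : sz n = sz n.+1 + sz n.+1.
  by rewrite /sz exprS invfM; lra.
pose P n (q : R * R) := d * sz n ^+ 2 < `|Psi q.1 (q.1 + sz n) q.2 (q.2 + sz n)|.
(* The hypothesis [P n q] stands under the existential, so that choosing [q'] gives a total function
   to iterate. *)
have step n q : exists q' : R * R, P n q ->
    [/\ P n.+1 q', q.1 <= q'.1, q'.1 + sz n.+1 <= q.1 + sz n,
        q.2 <= q'.2 & q'.2 + sz n.+1 <= q.2 + sz n].
  have [Pq|] := pselect (P n q); last by exists q.
  apply: contrapT => /forallNP nq.
  have {}nq q' : q.1 <= q'.1 -> q'.1 + sz n.+1 <= q.1 + sz n -> q.2 <= q'.2 ->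
      q'.2 + sz n.+1 <= q.2 + sz n ->
      `|Psi q'.1 (q'.1 + sz n.+1) q'.2 (q'.2 + sz n.+1)| <= d * sz n.+1 ^+ 2.
    by move=> h1 h2 h3 h4; rewrite leNgt; apply/negP => h; apply: (nq q').
  move: Pq; rewrite /P (szS n) ltNge => /negP; apply.
  have t0 : 0 <= sz n.+1 by exact/ltW/sz0.
  rewrite [leRHS](_ : _ = 4 * (d * sz n.+1 ^+ 2)); last by ring.
  apply: Phi_quarter => // i1 i2; rewrite (szS n) in nq.
  have [h1 h2] := sub_itv q.1 i1 t0; have [h3 h4] := sub_itv q.2 i2 t0.
  exact: (nq (q.1 + sz n.+1 *+ i1, q.2 + sz n.+1 *+ i2) h1 h2 h3 h4).
pose f n q := sval (cid (step n q)).
have fP n q : P n q -> [/\ P n.+1 (f n q), q.1 <= (f n q).1,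
   (f n q).1 + sz n.+1 <= q.1 + sz n, q.2 <= (f n q).2 & (f n q).2 + sz n.+1 <= q.2 + sz n].
  by move=> Pq; rewrite /f; case: cid => /= q' /(_ Pq).
pose u := fix u n := if n is m.+1 then f m (u m) else (a, c).
have Pu n : P n (u n).
  elim: n => [|n /fP[]//]; rewrite /P/= /sz expr0 divr1 /d divfK//.
  by rewrite expf_neq0// gt_eqF.
have mono (n k : nat) : [/\ (u n).1 <= (u (n + k)%N).1,
    (u (n + k)%N).1 + sz (n + k)%N <= (u n).1 + sz n, (u n).2 <= (u (n + k)%N).2 &
    (u (n + k)%N).2 + sz (n + k)%N <= (u n).2 + sz n].
  elim: k => [|k [h1 h2 h3 h4]]; first by rewrite addn0.
  have [_ g1 g2 g3 g4] := fP _ _ (Pu (n + k)%N).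
  rewrite addnS /=; split.
  - exact: le_trans h1 g1.
  - exact: le_trans g2 h2.
  - exact: le_trans h3 g3.
  - exact: le_trans g4 h4.
(* Nested intervals, once for each coordinate: the supremum of the left ends lies in all of them. *)
have lim (pr : R * R -> R) : (forall n k, pr (u n) <= pr (u (n + k)%N) /\
     pr (u (n + k)%N) + sz (n + k)%N <= pr (u n) + sz n) ->
   exists x, forall n, pr (u n) <= x <= pr (u n) + sz n.
  move=> hp.
  have ub m n : pr (u n) <= pr (u m) + sz m.
    have [h1 _] := hp n m; have [_ h2] := hp m n; rewrite addnC in h2.
    by have := sz0 (n + m)%N; lra.
  exists (sup [set pr (u n) | n in setT]) => n; apply/andP; split.
    apply: ub_le_sup; last by exists n.
    by exists (pr (u 0%N) + sz 0%N) => _ [m _ <-].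
  by apply: ge_sup; [exists (pr (u 0%N)), 0%N|move=> _ [m _ <-]].
have [x hx] := lim fst ltac:(by move=> n k; have [] := mono n k).
have [y hy] := lim snd ltac:(by move=> n k; have [] := mono n k).
have [] := H (x, y).
- by have := hx 0%N; rewrite /= /sz expr0 divr1.
- by have := hy 0%N; rewrite /= /sz expr0 divr1.
move=> /continuous2 Gc [A1 [A2 [B1 [B2 [hA hB Gp]]]]].
(* The two sides contribute [4 * k] and the integral [k], so the defect is at most [5 / 6 * d] times
   the area, against the lower bound [d] times the area. The main term drops out because
   [G p = B1 - A2]. *)
pose k := d / 6; have k0 : 0 < k by rewrite /k; lra.
have [r1 r10 {}hA] := hA k k0.
have [r2 r20 {}hB] := hB k k0.
have [r3 r30 {}Gc] := Gc k k0.
have [n] := @pow2_small s (Num.min r1 (Num.min r2 r3)) ltac:(by rewrite !lt_min r10 r20 r30).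
rewrite -/(sz n) !lt_min => /and3P[n1 n2 n3].
have sn0 := sz0 n.
have dist q : (u n).1 <= q.1 <= (u n).1 + sz n -> (u n).2 <= q.2 <= (u n).2 + sz n ->
   [/\ `|q.1 - x| <= sz n, `|q.2 - y| <= sz n & Num.max `|q.1 - x| `|q.2 - y| <= sz n].
  move=> q1 q2; rewrite ge_max.
  by rewrite !(sqr_itv_dist q1 (hx n)) !(sqr_itv_dist q2 (hy n)).
have := @Phi_approx _ A B G Ax By bG (x, y) A1 A2 B1 B2 (B1 - A2) (k * sz n) k
  (u n).1 ((u n).1 + sz n) (u n).2 ((u n).2 + sz n) (sz n) erefl erefl (ltW sn0).
rewrite subrr mul0r subr0 => Hn.
have : `|Psi (u n).1 ((u n).1 + sz n) (u n).2 ((u n).2 + sz n)| <=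
    4 * (k * sz n) * sz n + k * sz n ^+ 2.
  apply: Hn => q /dist h /h[h1 h2 h3].
  - by rewrite (le_trans (hA _ _ _))//= ?(le_trans h1) ?(le_trans h2) ?ler_wpM2l// ltW.
  - by rewrite (le_trans (hB _ _ _))//= ?(le_trans h1) ?(le_trans h2) ?ler_wpM2l// ltW.
  - by rewrite -Gp ltW// Gc//= ?(le_lt_trans h1) ?(le_lt_trans h2).
have := Pu n; rewrite /P => h1 h2.
have := lt_le_trans h1 h2; rewrite ltNge => /negP; apply.
have T0 : 0 < sz n ^+ 2 by rewrite exprn_gt0.
rewrite [leLHS](_ : _ = 5 * k * sz n ^+ 2); last by ring.
by rewrite ler_pM2r// five_sixths.
Qed.

(** The cells are closed here: a cell that does not meet [E] then satisfies the hypotheses of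
    [goursat] at all of its points, edges included. *)
Definition meets (E : set (R * R)) (a c s : R) (i j : nat) : Prop :=
  exists2 p, E p & (a + i%:R * s <= p.1 <= a + i.+1%:R * s) /\
                   (c + j%:R * s <= p.2 <= c + j.+1%:R * s).

Definition ucont (u : R * R -> R) := forall e, 0 < e -> exists2 r : R, 0 < r &
  forall p q, `|p.1 - q.1| <= r -> `|p.2 - q.2| <= r -> `|u p - u q| <= e.

(** Out of [n * n] cells only linearly many are met, as for a curve of finite length. *)
Definition grid_thin (E : set (R * R)) (a c L : R) := exists K : nat,
  forall n : nat, (0 < n)%N ->
    (\sum_(i < n) \sum_(j < n) `[< meets E a c (L / n%:R) i j >] <= K * n)%N.

(** A cell that misses [E] has defect 0 by [goursat]. Each of the at most [K * n] others has
    circulation at most [4 * eta * s] by uniform continuity and integral at most [M * s ^+ 2]; with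
    [s = L / n] the total is [4 * K * L * eta + K * M * L ^+ 2 / n]. The circulation along the outer
    square is 0 because [A] and [B] vanish there. *)
Lemma green_removable (E : set (R * R)) (a c L : R) : 0 < L ->
  ucont A -> ucont B ->
  (forall p, A p != 0 -> [/\ a < p.1, p.1 < a + L, c < p.2 & p.2 < c + L]) ->
  (forall p, B p != 0 -> [/\ a < p.1, p.1 < a + L, c < p.2 & p.2 < c + L]) ->
  (forall p, ~ E p -> {for p, continuous G} /\
     exists A1 A2 B1 B2, [/\ rdiff A p A1 A2, rdiff B p B1 B2 & G p = B1 - A2]) ->
  grid_thin E a c L ->
  \int[mu2]_(p in rect a (a + L) c (c + L)) G p = 0.
Proof.
move=> L0 uA uB sA sB HE [K HK].
have [_ [M GM]] := bG.
have M0 : 0 <= M by rewrite (le_trans _ (GM (0, 0) I)).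
have bd0 : bdry A B a (a + L) c (c + L) = 0.
  have i0 (u : R -> R) x y : (forall t, u t = 0) -> iint u x y = 0.
    by move=> u0; rewrite /iint; under eq_Rintegral do rewrite u0; rewrite Rintegral_cst// mul0r.
  rewrite /bdry !i0 ?subrr ?addr0// => t; apply/eqP; apply: contraT.
  - by move=> /sB[]/=; rewrite ltxx.
  - by move=> /sB[]/=; rewrite ltxx.
  - by move=> /sA[]/=; rewrite ltxx.
  - by move=> /sA[]/=; rewrite ltxx.
apply/eqP; rewrite -normr_eq0 eq_le normr_ge0 andbT.
apply/ler_addgt0Pr => e e0; rewrite add0r.
have -> : \int[mu2]_(p in rect a (a + L) c (c + L)) G p = - Psi a (a + L) c (c + L).
  by rewrite /Phi bd0 sub0r opprK.
rewrite normrN.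
(* Makes the first term of the total at most [e / 2]. *)
pose eta := e / (8 * (K%:R * L + 1)).
have KL : 0 <= K%:R * L by rewrite mulr_ge0// ltW.
have eta0 : 0 < eta by rewrite divr_gt0// mulr_gt0// ltr_wpDl.
have [r1 r10 {}uA] := uA _ eta0.
have [r2 r20 {}uB] := uB _ eta0.
(* For [n] beyond the first summand the mesh is within the moduli of continuity of [A] and [B];
   beyond the second, the term in [M] is at most [e / 2]. *)
pose Q := L / Num.min r1 r2 + 2 * (K%:R * M * L ^+ 2) / e.
pose n := (Num.truncn Q).+1.
have nQ : Q < n%:R by exact: truncnS_gt.
have n0 : 0 < n%:R :> R by rewrite ltr0n.
have r0 : 0 < Num.min r1 r2 by rewrite lt_min r10.
have KM : 0 <= K%:R * M * L ^+ 2 by rewrite !mulr_ge0// ltW.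
have sr : L / n%:R <= Num.min r1 r2.
  rewrite ler_pdivrMr// mulrC -ler_pdivrMr// ltW// (le_lt_trans _ nQ)//.
  by rewrite lerDl divr_ge0// ?mulr_ge0// ltW.
have ne : K%:R * M * L ^+ 2 / n%:R <= e / 2.
  rewrite ler_pdivrMr// [leRHS]mulrC -ler_pdivrMr ?divr_gt0// ltW// (le_lt_trans _ nQ)//.
  rewrite [leLHS](_ : _ = 2 * (K%:R * M * L ^+ 2) / e); last by rewrite invf_div; ring.
  by rewrite lerDr divr_ge0// ltW.
set s := L / n%:R in sr.
have s0 : 0 < s by rewrite divr_gt0.
have Ls : L = n%:R * s by rewrite /s mulrC divfK// gt_eqF.
rewrite [in X in X <= _]Ls (Phi_grid Ax By bG)//; last exact: ltW.
rewrite (le_trans (ler_norm_sum _ _ _))//.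
pose b (i j : 'I_n) := `[< meets E a c s i j >].
have cell (i j : 'I_n) : `|Psi (a + i%:R * s) (a + i.+1%:R * s) (c + j%:R * s) (c + j.+1%:R * s)|
    <= (b i j)%:R * (4 * eta * s + M * s ^+ 2).
  have e1 : a + i.+1%:R * s = a + i%:R * s + s by rewrite -[i.+1]addn1 natrD mulrDl mul1r addrA.
  have e2 : c + j.+1%:R * s = c + j%:R * s + s by rewrite -[j.+1]addn1 natrD mulrDl mul1r addrA.
  rewrite /b; case: asboolP => [_|nm].
    rewrite mul1r.
    (* All linear coefficients are 0: on a cell meeting [E], [A] and [B] are compared with
       constants. *)
    have := Phi_approx Ax By bG (p := (a + i%:R * s, c + j%:R * s)) (A1 := 0) (A2 := 0)
      (B1 := 0) (B2 := 0) (g0 := 0) (w := eta) (k := M) e1 e2 (ltW s0).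
    have d1 q : a + i%:R * s <= q <= a + i.+1%:R * s -> `|q - (a + i%:R * s)| <= Num.min r1 r2.
      move=> q1; rewrite (le_trans _ sr)// (sqr_itv_dist (a := a + i%:R * s)) -?e1//.
      by rewrite lexx e1 lerDl ltW.
    have d2 q : c + j%:R * s <= q <= c + j.+1%:R * s -> `|q - (c + j%:R * s)| <= Num.min r1 r2.
      move=> q1; rewrite (le_trans _ sr)// (sqr_itv_dist (a := c + j%:R * s)) -?e2//.
      by rewrite lexx e2 lerDl ltW.
    rewrite !subr0 mul0r subr0; apply=> q /d1 q1 /d2 q2; rewrite ?mul0r ?subr0.
    - by rewrite uA//= ?(le_trans q1) ?(le_trans q2)// ge_min lexx.
    - by rewrite uB//= ?(le_trans q1) ?(le_trans q2)// ge_min lexx orbT.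
    - exact: GM.
  rewrite mul0r e1 e2 normr_le0; apply/eqP/goursat => // p p1 p2; apply: HE => Ep.
  by apply: nm; exists p => //; rewrite e1 e2.
rewrite (le_trans (ler_sum _ (fun i _ => le_trans (ler_norm_sum _ _ _)
  (ler_sum _ (fun j _ => cell i j)))))//.
under eq_bigr do rewrite -mulr_suml.
rewrite -mulr_suml.
have -> : \sum_(i < n) \sum_(j < n) (b i j)%:R = (\sum_(i < n) \sum_(j < n) b i j)%:R :> R.
  by rewrite natr_sum; apply: eq_bigr => i _; rewrite natr_sum.
have w0 : 0 <= 4 * eta * s + M * s ^+ 2.
  have s00 := ltW s0; have e00 := ltW eta0.
  apply: addr_ge0; last by apply: mulr_ge0 => //; exact: exprn_ge0.
  by apply: mulr_ge0 => //; apply: mulr_ge0.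
rewrite (le_trans (ler_wpM2r w0 (_ : _ <= (K * n)%:R)))//; first by rewrite ler_nat HK.
rewrite natrM.
rewrite [leLHS](_ : _ = 4 * (K%:R * L) * eta + K%:R * M * L ^+ 2 / n%:R); last first.
  by rewrite /s; field; rewrite gt_eqF.
by apply: arith2 => //; exact: arith1.
Qed.

End goursat.

(** * Smooth cutoff functions *)

Section uniform_bounds.
Variable R : realType.
Implicit Types (u v : R * R -> R) (W : set (R * R)).

Definition dir (b : bool) : R * R := if b then (0, 1) else (1, 0).

(* [ub n W F]: on [W] the functions of the family [F] have partial derivatives
   up to order [n], continuous and bounded uniformly in the index. *)
Fixpoint ub (I : Type) (n : nat) W (F : I -> R * R -> R) : Prop :=
  [/\ exists M : R, forall i p, W p -> `|F i p| <= M,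
      forall i p, W p -> {for p, continuous (F i)}
    & if n is m.+1 then
        (forall i p b, W p -> derivable (F i) p (dir b)) /\
        (forall b, ub m W (fun i => 'D_(dir b) (F i)))
      else True].

Lemma ubS I n W (F : I -> R * R -> R) : ub n.+1 W F -> ub n W F.
Proof.
elim: n F => [|n IH] F; first by case.
move=> [h1 h2 [h3 h4]]; split=> //; split=> // b; exact: IH.
Qed.

Lemma ub_sub I n W V (F : I -> R * R -> R) : W `<=` V -> ub n V F -> ub n W F.
Proof.
move=> WV; elim: n F => [|n IH] F [[M h1] h2 h3].
  by split=> //; [exists M => i p /WV; exact: h1|move=> i p /WV; exact: h2].
split; [by exists M => i p /WV; exact: h1|by move=> i p /WV; exact: h2|].
case: h3 => h3 h4; split; first by move=> i p b /WV; exact: h3.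
by move=> b; apply: IH; [exact: h4..].
Qed.

Lemma ub_union I n W V (F : I -> R * R -> R) : ub n W F -> ub n V F -> ub n (W `|` V) F.
Proof.
elim: n F => [|n IH] F [[M h1] h2 h3] [[N g1] g2 g3].
  split=> //; last by move=> i p [Wp|Wp]; [exact: h2|exact: g2].
  by exists (Num.max M N) => i p [/h1|/g1] h; rewrite le_max h ?orbT.
case: h3 g3 => h3 h4 [g3 g4]; split.
- by exists (Num.max M N) => i p [/h1|/g1] h; rewrite le_max h ?orbT.
- by move=> i p [Wp|Wp]; [exact: h2|exact: g2].
- split; first by move=> i p b [Wp|Wp]; [exact: h3|exact: g3].
  by move=> b; apply: IH; [exact: h4|exact: g4].
Qed.

Lemma ub_comp I J n W (F : I -> R * R -> R) (k : J -> I) :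
  ub n W F -> ub n W (F \o k).
Proof.
elim: n F => [|n IH] F [[M h1] h2 h3]; split=> //.
- by exists M => i p; exact: h1.
- by move=> i p; exact: h2.
- by exists M => i p; exact: h1.
- by move=> i p; exact: h2.
- by case: h3 => h3 h4; split=> [i p b|b]; [exact: h3|exact: IH (h4 b)].
Qed.

Lemma open_near W (P : R * R -> Prop) p : open W -> W p -> (forall q, W q -> P q) ->
  \forall q \near p, P q.
Proof.
by move=> oW Wp H; have := open_nbhs_nbhs (conj oW Wp); apply: filterS.
Qed.

Lemma ub_eq I n W (F G : I -> R * R -> R) : open W ->
  (forall i p, W p -> F i p = G i p) -> ub n W F -> ub n W G.
Proof.
move=> oW; elim: n F G => [|n IH] F G FG [[M h1] h2 h3].
all: have nFG i p : W p -> {near p, F i =1 G i} by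
  move=> Wp; apply: (open_near oW) => // q; exact: FG.
all: have c i p : W p -> {for p, continuous (G i)} by
  move=> Wp; rewrite /prop_for /continuous_at -FG//;
  apply: cvg_trans (h2 i p Wp); apply: near_eq_cvg; exact: nFG.
all: have bd : exists M, forall i p, W p -> `|G i p| <= M by
  exists M => i p Wp; rewrite -FG// h1.
  by [].
split=> //; case: h3 => h3 h4; split.
  move=> i p b Wp; exact: near_eq_derivable (nFG i p Wp) (h3 i p b Wp).
move=> b; apply: IH (h4 b) => i p Wp.
by apply: near_eq_derive; exact: nFG.
Qed.

Lemma ub_cst I n W (c : I -> R) (M : R) : (forall i, `|c i| <= M) ->
  ub n W (fun i => cst (c i)).
Proof.
elim: n c M => [|n IH] c M cM; split=> //.
- by exists M => i p _; exact: cM.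
- by move=> i p _; exact: cst_continuous.
- by exists M => i p _; exact: cM.
- by move=> i p _; exact: cst_continuous.
- split=> // b; rewrite (_ : (fun i => _) = fun i => cst 0).
    by apply: (IH _ 0) => i; rewrite normr0.
  by apply/funext => i; apply/funext => p; rewrite derive_cst.
Qed.

Lemma ub_add I n W (F G : I -> R * R -> R) : open W ->
  ub n W F -> ub n W G -> ub n W (fun i p => F i p + G i p).
Proof.
move=> oW; elim: n F G => [|n IH] F G [[M h1] h2 h3] [[N g1] g2 g3].
all: have bd : exists M0, forall i p, W p -> `|F i p + G i p| <= M0 by
  exists (M + N) => i p Wp; rewrite (le_trans (ler_normD _ _))// lerD ?h1 ?g1.
all: have c i p : W p -> {for p, continuous (fun p => F i p + G i p)} by
  move=> Wp; apply: continuousD; [exact: h2|exact: g2].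
  by [].
split=> //; case: h3 g3 => h3 h4 [g3 g4]; split.
  by move=> i p b Wp; apply: derivableD; [exact: h3|exact: g3].
move=> b; apply: ub_eq (IH _ _ (h4 b) (g4 b)) => // i p Wp.
by rewrite deriveD//; [exact: h3|exact: g3].
Qed.

Lemma ub_mul I n W (F G : I -> R * R -> R) : open W ->
  ub n W F -> ub n W G -> ub n W (fun i p => F i p * G i p).
Proof.
move=> oW; elim: n F G => [|n IH] F G uF uG;
  have [[M h1] h2 h3] := uF; have [[N g1] g2 g3] := uG.
all: have bd : exists M0, forall i p, W p -> `|F i p * G i p| <= M0 by
  exists (M * N) => i p Wp; rewrite normrM ler_pM ?h1 ?g1.
all: have c i p : W p -> {for p, continuous (fun p => F i p * G i p)} by
  move=> Wp; apply: continuousM; [exact: h2|exact: g2].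
  by [].
split=> //; case: h3 g3 => h3 h4 [g3 g4]; split.
  by move=> i p b Wp; apply: derivableM; [exact: h3|exact: g3].
move=> b; apply: ub_eq (ub_add oW (IH _ _ (ubS uF) (g4 b)) (IH _ _ (ubS uG) (h4 b))) => // i p Wp.
by rewrite deriveM//; [exact: h3|exact: g3].
Qed.

Lemma ub_opp I n W (F : I -> R * R -> R) : open W ->
  ub n W F -> ub n W (fun i p => - F i p).
Proof.
move=> oW uF.
have := ub_mul oW (@ub_cst I n W (fun=> -1) 1 ltac:(by move=> i; rewrite normrN normr1)) uF.
by apply: ub_eq => // i p _; rewrite /cst mulN1r.
Qed.

Lemma ub_inv I n W (F : I -> R * R -> R) (d : R) : open W -> 0 < d ->
  (forall i p, W p -> d <= `|F i p|) -> ub n W F -> ub n W (fun i p => (F i p)^-1).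
Proof.
move=> oW d0 dF; elim: n F dF => [|n IH] F dF uF; have [[M h1] h2 h3] := uF.
all: have F0 i p : W p -> F i p != 0 by
  move=> Wp; rewrite -normr_gt0 (lt_le_trans d0)// dF.
all: have bd : exists M0, forall i p, W p -> `|(F i p)^-1| <= M0 by
  exists d^-1 => i p Wp; rewrite normfV lef_pV2 ?dF// posrE ?normr_gt0 ?F0.
all: have c i p : W p -> {for p, continuous (fun p => (F i p)^-1)} by
  move=> Wp; apply: continuousV; [exact: F0|exact: h2].
  by [].
split=> //; case: h3 => h3 h4; split.
  by move=> i p b Wp; apply: derivableV; [exact: F0|exact: h3].
move=> b; have ui := IH F dF (ubS uF).
apply: ub_eq (ub_mul oW (ub_opp oW (ub_mul oW ui ui)) (h4 b)) => // i p Wp.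
rewrite deriveV//; [|exact: F0|exact: h3].
by rewrite /GRing.scale/= -exprVn expr2.
Qed.

Lemma derive_line (u : R * R -> R) (p v : R * R) :
  'D_v u p = 'D_1 (fun h : R => u (h *: v + p)) 0.
Proof.
rewrite /derive; set g1 := fun h => h^-1 *: _; set g2 := fun h => h^-1 *: _.
suff -> : g1 = g2 by [].
by rewrite funeqE /g1 /g2 => h /=; rewrite addr0 scale0r add0r [_%:A]mulr1.
Qed.

Definition coord (b : bool) (p : R * R) : R := if b then p.2 else p.1.

Lemma coord_line (b b' : bool) h p :
  coord b (h *: dir b' + p) = h * (b == b')%:R + coord b p.
Proof. by case: b; case: b'; rewrite /coord /dir/= /GRing.scale/= ?(mulr0, mulr1, add0r). Qed.

Lemma coord_continuous b p : {for p, continuous (coord b)}.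
Proof. by case: b; [exact: cvg_snd|exact: cvg_fst]. Qed.

Lemma is_derive_coord (f f' : R -> R) (b b' : bool) (c d : R) p :
  is_derive (c * coord b p + d) 1 f (f' (c * coord b p + d)) ->
  is_derive p (dir b') (fun q => f (c * coord b q + d))
    (c * (b == b')%:R * f' (c * coord b p + d)).
Proof.
move=> df.
have E : (fun h : R => f (c * coord b (h *: dir b' + p) + d)) =
    f \o (fun h => (c * (b == b')%:R) * h + (c * coord b p + d)).
  by apply/funext => h /=; rewrite coord_line; congr f; ring.
have df1 : is_derive (0 : R) 1
   (f \o (fun h => (c * (b == b')%:R) * h + (c * coord b p + d)))
   (c * (b == b')%:R * f' (c * coord b p + d)).
  apply: is_derive_eq.
    apply: is_derive1_comp; rewrite mulr0 add0r; exact: df.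
  by rewrite /GRing.scale/=; ring.
have [df2 df3] := df1.
apply: DeriveDef; first by apply/derivable1P; rewrite E.
by rewrite derive_line E.
Qed.

End uniform_bounds.

Section cutoff.
Variable R : realType.
Notation C := (R[i]^o).

(** The powers of [t^-1] make the family closed under differentiation: the derivative of [flat m] is
    [- m * flat m.+1 + flat m.+2]. *)
Definition flat (m : nat) (t : R) : R := if 0 < t then t^-1 ^+ m * expR (- t^-1) else 0.

Lemma flat_ge0 m t : 0 <= flat m t.
Proof.
rewrite /flat; case: ifP => // t0.
by rewrite mulr_ge0 ?expR_ge0// exprn_ge0// invr_ge0 ltW.
Qed.

(** With [s = t^-1] this is [s ^+ m <= m! * expR s], a single term of the exponential series. *)
Lemma flat_le m t : flat m t <= m`!%:R.
Proof.
rewrite /flat; case: ifP => // t0.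
have s0 : 0 <= t^-1 by rewrite invr_ge0 ltW.
rewrite expRN ler_pdivrMr ?expR_gt0//.
case: m => [|m]; first by rewrite expr0 fact0 mul1r ltW// expR_gt1 invr_gt0.
have := expR_ge1Dxn m s0.
have f0 : 0 < m.+1`!%:R :> R by rewrite ltr0n fact_gt0.
by move=> h; rewrite mulrC -ler_pdivrMr// (le_trans _ h)// lerDr ler01.
Qed.

Lemma flatS m t : flat m t = t * flat m.+1 t.
Proof.
rewrite /flat; case: ifP => t0; last by rewrite mulr0.
by rewrite exprS !mulrA divff ?gt_eqF// mul1r.
Qed.

Lemma is_derive_flat (m : nat) (t : R) : is_derive t 1 (flat m) (- m%:R * flat m.+1 t + flat m.+2 t).
Proof.
have [t0|t0|t0] := ltgtP 0 t; last first.
- rewrite -t0 /flat ltxx mulr0 addr0.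
  have H : h^-1 *: (flat m (h *: 1 + 0) - flat m 0) @[h --> (0:R)^'] --> (0 : R).
    apply/cvgrPdist_le => e e0.
    near=> h.
    (* Two uses of [flatS] give [flat m h = h * h * flat m.+2 h], so the difference quotient at 0 is
       at most a constant times the modulus of [h]. *)
    rewrite sub0r normrN {2}/flat ltxx subr0 addr0 [h *: 1]mulr1 flatS flatS.
    rewrite /GRing.scale/= mulKf; last by near: h; exact: nbhs_dnbhs_neq.
    rewrite normrM (ger0_norm (flat_ge0 _ _)).
    apply: (le_trans (ler_wpM2l (normr_ge0 _) (flat_le _ _))).
    rewrite -ler_pdivlMr ?ltr0n ?fact_gt0//.
    near: h; apply: dnbhs0_le; rewrite divr_gt0// ltr0n fact_gt0//.
  apply: DeriveDef; first by apply/cvg_ex; exists 0.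
  exact/cvg_lim.
- have nE : \forall x \near t, cst 0 x = flat m x.
    near=> x; rewrite /flat ifF//; apply/negbTE; rewrite -leNgt ltW//; near: x.
    exact: lt_nbhsl.
  rewrite /flat ltNge (ltW t0)/= mulr0 addr0.
  exact: near_eq_is_derive nE _.
have nE : \forall x \near t, ((fun x : R => x^-1 ^+ m) * (fun x : R => expR (- x^-1))) x = flat m x.
  near=> x; rewrite /flat ifT//; near: x; exact: lt_nbhsr.
apply: near_eq_is_derive nE _.
have dV : is_derive t 1 (fun x : R => x^-1) (- t ^- 2).
  have := @is_deriveV R id t 1 1; rewrite /= gt_eqF// => /(_ isT (is_derive_id _ _)).
  by rewrite [_ *: _]mulr1.
have dE : is_derive t 1 (fun x : R => expR (- x^-1)) (expR (- t^-1) * t ^- 2).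
  have := @is_derive1_comp _ expR (- (fun x : R => x^-1)) t _ _ (is_derive_expR _) (is_deriveN dV).
  by rewrite opprK.
have dX : is_derive t 1 (fun x : R => x^-1 ^+ m) (m%:R * t^-1 ^+ m.-1 * - t ^- 2).
  have -> : (fun x : R => x^-1 ^+ m) = (fun x : R => x^-1) ^+ m.
    by apply/funext => x; rewrite exprfctE.
  by apply: is_derive_eq.
apply: is_derive_eq; rewrite /GRing.scale/= /flat t0 -exprVn.
case: m {dX} => [|m]; rewrite ?mul0r ?mulr0 ?addr0 ?exprS ?expr0; first by ring.
rewrite /=; ring.
Unshelve. all: end_near.
Qed.

Lemma ub_flat n (I : Type) W m (b : bool) (c d : R) : open W ->
  ub n W (fun (_ : I) p => flat m (c * coord b p + d)).
Proof.
move=> oW.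
have dF m' b' p := @is_derive_coord R (flat m') (fun t => - m'%:R * flat m'.+1 t + flat m'.+2 t)
  b b' c d p (is_derive_flat m' (c * coord b p + d)).
have cF m' p : {for p, continuous (fun p => flat m' (c * coord b p + d))}.
  apply: (@continuous_comp _ _ _ (fun p => c * coord b p + d) (flat m')).
    apply: (@continuousD _ R^o).
      by apply: continuousM; [exact: cst_continuous|exact: coord_continuous].
    exact: cst_continuous.
  have [+ _] := is_derive_flat m' (c * coord b p + d).
  by move=> /derivable1_diffP/differentiable_continuous.
have bd m' : exists M, forall (i : I) (p : R * R), W p -> `|flat m' (c * coord b p + d)| <= M.
  by exists m'`!%:R => _ p _; rewrite ger0_norm ?flat_ge0// flat_le.
(* The induction is over all [m] at once, since differentiation raises [m]. *)
elim: n m => [|n IH] m; first by split.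
split=> //; split; first by move=> i p b' _; have [] := dF m b' p.
move=> b'.
apply: (@ub_eq _ I n W (fun _ p => c * (b == b')%:R *
   (- m%:R * flat m.+1 (c * coord b p + d) + flat m.+2 (c * coord b p + d)))) => //.
  by move=> _ p _; rewrite (@derive_val _ _ _ _ _ _ _ (dF m b' p)).
apply: ub_mul => //; first exact: (@ub_cst _ I n W (fun=> c * (b == b')%:R) _ (fun=> lexx _)).
apply: ub_add => //; apply: ub_mul => //.
exact: (@ub_cst _ I n W (fun=> - m%:R) _ (fun=> lexx _)).
Qed.

Definition ramp (x : R) := flat 0 x / (flat 0 x + flat 0 (1 - x)).

Lemma flat0_half x : 1 / 2 <= x -> expR (- 2) <= flat 0 x.
Proof.
move=> hx; have x0 : 0 < x by rewrite (lt_le_trans _ hx).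
rewrite /flat x0 expr0 mul1r ler_expR lerN2 invf_ple ?posrE//.
by rewrite -[X in X <= _]mul1r.
Qed.

(** One of [x] and [1 - x] is at least 1/2. A positive lower bound, rather than mere positivity, is
    what [ub_inv] asks for. *)
Lemma ramp_den x : expR (- 2) <= flat 0 x + flat 0 (1 - x).
Proof.
have [h|h] := leP (1 / 2) x.
  by rewrite (le_trans (flat0_half h))// lerDl flat_ge0.
by rewrite (le_trans (flat0_half _) (_ : flat 0 (1 - x) <= _)) ?lerDr ?flat_ge0//; lra.
Qed.

Lemma ramp_den_gt0 x : 0 < flat 0 x + flat 0 (1 - x).
Proof. exact: lt_le_trans (expR_gt0 _) (ramp_den x). Qed.

Lemma ramp1 x : 1 <= x -> ramp x = 1.
Proof.
move=> x1; have := ramp_den_gt0 x; rewrite /ramp.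
have -> : flat 0 (1 - x) = 0 by rewrite /flat subr_gt0 ltNge x1.
by rewrite addr0 => h; rewrite divff ?gt_eqF.
Qed.

Lemma ramp0 x : x <= 0 -> ramp x = 0.
Proof. by move=> x0; rewrite /ramp {1}/flat ltNge x0 mul0r. Qed.

Lemma ramp_ge0 x : 0 <= ramp x.
Proof. by rewrite divr_ge0 ?flat_ge0// ltW// ramp_den_gt0. Qed.

Lemma ub_ramp n (I : Type) W (b : bool) (c d : R) : open W ->
  ub n W (fun (_ : I) p => ramp (c * coord b p + d)).
Proof.
move=> oW; apply: ub_mul => //; first exact: ub_flat.
apply: (@ub_inv _ _ _ _ _ (expR (- 2))) => //.
  by move=> _ p _; exact: le_trans (ramp_den _) (ler_norm _).
apply: ub_add => //; first exact: ub_flat.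
apply: ub_eq (@ub_flat n I W 0 b (- c) (1 - d) oW) => // _ p _.
by congr flat; ring.
Qed.

(** With [x = (coord b p - a) / r] this is [ramp (x + 2) * ramp (2 - x)], a rising and a falling
    step: 1 for [x] in [[-1, 1]] and 0 outside []-2, 2[]. *)
Definition plateau (r : R) (a : R) (b : bool) (p : R * R) :=
  ramp (r^-1 * coord b p + (2 - a / r)) * ramp (- r^-1 * coord b p + (2 + a / r)).

Definition bump (r : R) (a : R * R) (p : R * R) :=
  plateau r a.1 false p * plateau r a.2 true p.

Lemma ub_bump n (I : Type) W (r : R) (a : R * R) : open W ->
  ub n W (fun (_ : I) => bump r a).
Proof.
by move=> oW; apply: ub_mul => //; apply: ub_mul => //; exact: ub_ramp.
Qed.

Lemma plateau_ge0 r a b p : 0 <= plateau r a b p.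
Proof. by rewrite mulr_ge0// ramp_ge0. Qed.

Lemma bump_ge0 r a p : 0 <= bump r a p.
Proof. by rewrite mulr_ge0// plateau_ge0. Qed.

Lemma plateau1 r a b p : 0 < r -> `|coord b p - a| <= r -> plateau r a b p = 1.
Proof.
move=> r0; rewrite ler_norml => /andP[h1 h2]; rewrite /plateau.
have -> : r^-1 * coord b p + (2 - a / r) = (coord b p - a) / r + 2 by ring.
have -> : - r^-1 * coord b p + (2 + a / r) = - ((coord b p - a) / r) + 2 by ring.
have : - 1 <= (coord b p - a) / r by rewrite ler_pdivlMr// mulN1r.
have : (coord b p - a) / r <= 1 by rewrite ler_pdivrMr// mul1r.
by move=> ? ?; rewrite !ramp1 ?mulr1//; lra.
Qed.

Lemma plateau0 r a b p : 0 < r -> 2 * r <= `|coord b p - a| -> plateau r a b p = 0.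
Proof.
move=> r0; rewrite ler_normr /plateau.
have -> : r^-1 * coord b p + (2 - a / r) = (coord b p - a) / r + 2 by ring.
have -> : - r^-1 * coord b p + (2 + a / r) = - ((coord b p - a) / r) + 2 by ring.
move=> /orP[h|h].
  have : 2 <= (coord b p - a) / r by rewrite ler_pdivlMr.
  by move=> ?; rewrite (@ramp0 (- _ + 2)) ?mulr0//; lra.
have : 2 <= - (coord b p - a) / r by rewrite ler_pdivlMr.
by rewrite mulNr => ?; rewrite (@ramp0 (_ + 2)) ?mul0r//; lra.
Qed.

Lemma bump1 r a p : 0 < r -> `|p.1 - a.1| <= r -> `|p.2 - a.2| <= r -> bump r a p = 1.
Proof. by move=> r0 h1 h2; rewrite /bump !plateau1 ?mulr1. Qed.

Lemma bump_supp r a p : 0 < r -> bump r a p != 0 ->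
  `|p.1 - a.1| < 2 * r /\ `|p.2 - a.2| < 2 * r.
Proof.
move=> r0 h; split; rewrite ltNge; apply: contra h => h; apply/eqP.
  by rewrite /bump (@plateau0 r a.1 false) ?mul0r.
by rewrite /bump (@plateau0 r a.2 true) ?mulr0.
Qed.

End cutoff.

(** * Compact sets and cutoffs in the plane *)

Section test_functions.
Variable R : realType.
Notation C := (R[i]^o).
Implicit Types (D K U : set C) (z w : C).

Definition to_coord z : R * R := (complex.Re z, complex.Im z).

Lemma to_coordK z : of_coord (to_coord z) = z.
Proof. by case: z. Qed.

Lemma of_coordK (p : R * R) : to_coord (of_coord p) = p.
Proof. by case: p. Qed.

Lemma complex_hausdorff : hausdorff_space C.
Proof. exact: norm_hausdorff. Qed.

Definition cbox z (r : R) : set C :=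
  [set w | `|complex.Re w - complex.Re z| <= r /\ `|complex.Im w - complex.Im z| <= r].

Lemma cbox_compact z r : compact (cbox z r).
Proof.
have -> : cbox z r = @of_coord R @` (
   `[complex.Re z - r, complex.Re z + r] `*` `[complex.Im z - r, complex.Im z + r]).
  apply/seteqP; split=> [w [w1 w2]|_ [p [p1 p2] <-]].
    exists (to_coord w); last exact: to_coordK.
    by move: w1 w2; rewrite !ler_distl /= !in_itv/=.
  by move: p1 p2; rewrite /= !in_itv/= /cbox/= !ler_distl.
apply: continuous_compact.
  by apply: continuous_subspaceT => p; exact: of_coord_continuous.
by apply: compact_setX; exact: segment_compact.
Qed.

Lemma cbox_closed z r : closed (cbox z r).
Proof. by apply: compact_closed; [exact: complex_hausdorff|exact: cbox_compact]. Qed.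

Lemma bounded_closed_compact K (M : R) : closed K -> (forall z, K z -> nm z <= M) ->
  compact K.
Proof.
move=> cK KM; apply: (subclosed_compact cK (@cbox_compact 0 M)) => z /KM zM.
by split; rewrite subr0 (le_trans _ zM)// (Re_nm, Im_nm).
Qed.

Lemma bounded_setC D : bounded_set D -> exists2 M : R, 0 < M & forall z, D z -> nm z <= M.
Proof.
move=> [M0 [/= rM0 H]].
have [a aM0] : exists a : R, M0 = a%:C.
  by move: rM0; rewrite /Num.real/= => /orP[]; rewrite lecE/= => /andP[/eqP h _];
   exists (complex.Re M0); case: M0 h {H} => x y /= ?; subst y.
exists (Num.max 1 (a + 1)); first by rewrite lt_max ltr01.
move=> z Dz; have /H/(_ _ Dz) : M0 < (a + 1)%:C by rewrite aM0 ltcR ltrDl.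
by rewrite /= normE lecR => h; rewrite le_max h orbT.
Qed.

Lemma compact_boundedC K : compact K -> exists2 M : R, 0 < M & forall z, K z -> nm z <= M.
Proof.
move=> /compact_near_coveringP/(_ R (nbhs +oo) (fun M z => nm z <= M) _)[|M0 [rM0 H]].
  move=> z Kz; exists ([set w | nm (w - z) < 1], [set M | nm z + 1 < M]); last first.
    move=> [w M] /= [wz zM]; rewrite ltW// (le_lt_trans _ zM)//.
    by rewrite -(subrK z w) (le_trans (nmD _ _))// addrC lerD2l ltW.
  split=> /=; first by apply/nbhs_complexP; exists 1.
  by exists (nm z + 1); split=> //; exact: num_real.
exists (Num.max 1 (M0 + 1)); first by rewrite lt_max ltr01.
by move=> z Kz; rewrite le_max (H (M0 + 1)) ?orbT// ltrDl.
Qed.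

(** [partial] applies the head of the list last, whereas [ub] takes the innermost derivative first;
    hence the inductions from the end of the list below. *)
Lemma partial_rcons (s : seq bool) b u :
  partial (rcons s b) u = partial s ('D_(dir R b) u).
Proof. by elim: s => //= b' s ->. Qed.

Lemma ub_partialS (I : Type) n W (F : I -> R * R -> R) :
  ub n W F -> exists M : R, forall i p s, W p -> (size s <= n)%N -> `|partial s (F i) p| <= M.
Proof.
elim: n F => [|n IH] F.
  by move=> [[M HM] _ _]; exists M => i p [|//] Wp _; exact: HM.
move=> [[M HM] _ [_ h]].
have [N0 HN0] := IH _ (h false); have [N1 HN1] := IH _ (h true).
exists (Num.max M (Num.max N0 N1)) => i p s Wp.
case: (lastP s) => [_|{}s b]; first by rewrite le_max HM.
rewrite size_rcons partial_rcons => sn; rewrite !le_max.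
apply/orP; right; apply/orP.
by case: b; [right; exact: HN1|left; exact: HN0].
Qed.

Lemma ub_partial_ub (I : Type) n k W (F : I -> R * R -> R) (s : seq bool) :
  (size s + k <= n)%N -> ub n W F -> ub k W (fun i => partial s (F i)).
Proof.
elim/last_ind: s n F => [|s b IH] n F.
  rewrite add0n => + uF; elim: n uF => [|n IH] uF.
    by rewrite leqn0 => /eqP ->.
  by rewrite leq_eqVlt => /predU1P[->//|]; exact/IH/ubS.
rewrite size_rcons; case: n => // n sn [_ _ [_ /(_ b) h]].
have := IH n _ sn h; congr ub.
by apply/funext => i; rewrite partial_rcons.
Qed.

Lemma ub_smooth (u : R * R -> R) :
  (forall n, ub n setT (fun _ : unit => u)) -> smooth u.
Proof.
move=> H s; have uS := ub_partial_ub (leqnn (size s + 1)) (H (size s + 1)%N).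
case: uS => [_ h2 [h3 _]]; split; first by move=> p; exact: (h2 tt p I).
by move=> p b; exact: (h3 tt p b I).
Qed.

Definition toC (u : R * R -> R) : C -> C := fun z => (u (to_coord z))%:C.

Lemma toC_test (u : R * R -> R) : (forall n, ub n setT (fun _ : unit => u)) ->
  compact (supp (toC u)) -> test_function (toC u).
Proof.
move=> H cu; split=> //.
  have -> : (@complex.Re R \o toC u) \o @of_coord R = u.
    by apply/funext => p; rewrite /= /toC/= of_coordK.
  exact: ub_smooth.
have -> : (@complex.Im R \o toC u) \o @of_coord R = cst 0 by apply/funext => p.
apply: ub_smooth => n; apply: (@ub_cst R unit n setT (fun=> 0) 0) => _.
by rewrite normr0.
Qed.

Lemma supp_sub (f : C -> C) K : closed K -> (forall z, f z != 0 -> K z) -> supp f `<=` K.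
Proof. by move=> cK H; rewrite [K](closure_id _).1//; apply: closureS. Qed.

Lemma notin_supp (f : C -> C) z : ~ supp f z -> f z = 0.
Proof. by move=> nz; apply/eqP/negP => /negP fz; apply: nz; exact: subset_closure. Qed.

Definition is_cutoff D K (u : R * R -> R) :=
  [/\ forall n, ub n setT (fun _ : unit => u), compact (supp (toC u)),
      supp (toC u) `<=` D
    & exists U, [/\ open U, K `<=` U & forall z, U z -> u (to_coord z) = 1]].

Lemma open_cboxP U : open U <->
  forall z, U z -> exists2 r : R, 0 < r & forall w,
    `|complex.Re w - complex.Re z| < r -> `|complex.Im w - complex.Im z| < r -> U w.
Proof.
split=> [/open_complexP oU z /oU[r r0 H]|H]; last first.
  apply/open_complexP => z /H[r r0 rH]; exists r => // w wr.
  by apply: rH; rewrite -raddfB (le_lt_trans _ wr)// (Re_nm, Im_nm).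
exists (r / 2); first by rewrite divr_gt0.
move=> w w1 w2; apply: H; rewrite (le_lt_trans (nm_ReIm _))// !raddfB.
by rewrite [ltRHS]splitr ltrD.
Qed.

Lemma is_cutoff_box D z : open D -> D z ->
  exists r u, 0 < r /\ is_cutoff D [set w | `|complex.Re w - complex.Re z| < r /\
     `|complex.Im w - complex.Im z| < r] u.
Proof.
move=> /open_cboxP oD /oD[d d0 dD].
have r0 : 0 < d / 3 by rewrite divr_gt0.
exists (d / 3), (bump (d / 3) (to_coord z)); split=> //.
have sb : supp (toC (bump (d / 3) (to_coord z))) `<=` cbox z (2 * (d / 3)).
  apply: supp_sub; first exact: cbox_closed.
  move=> w; rewrite /toC => h.
  have : bump (d / 3) (to_coord z) (to_coord w) != 0.
    by apply: contra h => /eqP ->.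
  by move=> /(bump_supp r0)[h1 h2]; split; exact: ltW.
split.
- by move=> n; apply: ub_bump; exact: openT.
- exact: (subclosed_compact (@closed_closure _ _) (@cbox_compact _ _) sb).
- by move=> w /sb[h1 h2]; apply: dD; apply: le_lt_trans (h1) _ || apply: le_lt_trans (h2) _; lra.
eexists; split; [|exact: subset_refl|].
  apply/open_cboxP => w [w1 w2].
  exists (Num.min (d / 3 - `|complex.Re w - complex.Re z|)
                  (d / 3 - `|complex.Im w - complex.Im z|)).
    by rewrite lt_min !subr_gt0 w1 w2.
  move=> v; rewrite !lt_min => /andP[v1 _] /andP[_ v2]; split.
    by rewrite (le_lt_trans (ler_distD (complex.Re w) _ _))// -ltrBrDr.
  by rewrite (le_lt_trans (ler_distD (complex.Im w) _ _))// -ltrBrDr.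
by move=> w /= [h1 h2]; apply: bump1 => //; exact: ltW.
Qed.

(** The combination is 1 where either function is 1 and 0 where both are 0. *)
Lemma is_cutoffU D K K' u v : is_cutoff D K u -> is_cutoff D K' v ->
  is_cutoff D (K `|` K') (fun p => 1 - (1 - u p) * (1 - v p)).
Proof.
move=> [u1 u2 u3 [U [oU KU U1]]] [v1 v2 v3 [V [oV KV V1]]].
set w := (X in is_cutoff _ _ X).
have sw : supp (toC w) `<=` supp (toC u) `|` supp (toC v).
  apply: supp_sub; first by apply: closedU; exact: closed_closure.
  move=> z h; apply: contrapT => /not_orP[/notin_supp h1 /notin_supp h2].
  move: h1 h2 h; rewrite /toC /w => /(congr1 (@complex.Re R))/= ->.
  by move=> /(congr1 (@complex.Re R))/= ->; rewrite subr0 mulr1 subrr eqxx.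
have one n : ub n setT (fun _ : unit => cst (1 : R)).
  exact: (@ub_cst R unit n setT (fun=> 1) _ (fun=> lexx _)).
split.
- move=> n; apply: ub_add openT (one n) _; apply: ub_opp; first exact: openT.
  apply: ub_mul; first exact: openT.
  + by apply: ub_add openT (one n) _; apply: ub_opp => //; exact: openT.
  + by apply: ub_add openT (one n) _; apply: ub_opp => //; exact: openT.
- exact: (subclosed_compact (@closed_closure _ _) (compactU u2 v2) sw).
- by move=> z /sw[/u3|/v3].
exists (U `|` V); split; first exact: openU.
- by move=> z [/KU|/KV]; [left|right].
- by move=> z [/U1|/V1] h; rewrite /w h subrr ?mulr0 ?mul0r subr0.
Qed.

Lemma is_cutoff_sub D K K' u : K `<=` K' -> is_cutoff D K' u -> is_cutoff D K u.
Proof.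
move=> KK' [h1 h2 h3 [U [oU KU U1]]]; split=> //; exists U; split=> //.
by move=> z /KK'/KU.
Qed.

Lemma is_cutoff0 D : is_cutoff D set0 (cst 0).
Proof.
have s0 : supp (toC (cst (0 : R))) = set0.
  by apply/seteqP; split=> // z; apply: supp_sub; [exact: closed0|move=> w; rewrite eqxx].
split.
- by move=> n; apply: (@ub_cst R unit n setT (fun=> 0) _ (fun=> lexx _)).
- by rewrite s0; exact: compact0.
- by rewrite s0.
- by exists set0; split=> //; exact: open0.
Qed.

(** By compactness finitely many boxes with cutoffs from [is_cutoff_box] cover [K]; these are merged
    one at a time by [is_cutoffU]. *)
Lemma cutoff_exists D K : open D -> compact K -> K `<=` D -> exists u, is_cutoff D K u.
Proof.
move=> oD cK KD.
pose P z (r : R) := 0 < r /\ exists u, is_cutoff D [set w | `|complex.Re w - complex.Re z| < r /\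
     `|complex.Im w - complex.Im z| < r] u.
have rP z : exists r, D z -> P z r.
  have [Dz|] := pselect (D z); last by exists 0.
  by have [r [u [r0 ru]]] := is_cutoff_box oD Dz; exists r; split=> //; exists u.
have [r rH] := choice rP.
pose F z := [set w : C | `|complex.Re w - complex.Re z| < r z /\ `|complex.Im w - complex.Im z| < r z].
have oF z : K z -> open (F z).
  move=> /KD/rH[rz _]; apply/open_cboxP => w [w1 w2].
  exists (Num.min (r z - `|complex.Re w - complex.Re z|)
                  (r z - `|complex.Im w - complex.Im z|)).
    by rewrite lt_min !subr_gt0 w1 w2.
  move=> v; rewrite !lt_min => /andP[v1 _] /andP[_ v2]; split.
    by rewrite (le_lt_trans (ler_distD (complex.Re w) _ _))// -ltrBrDr.
  by rewrite (le_lt_trans (ler_distD (complex.Im w) _ _))// -ltrBrDr.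
have KF : K `<=` cover K F.
  by move=> z Kz; exists z => //; have [rz _] := rH _ (KD _ Kz); rewrite /F/= !subrr normr0.
move: cK; rewrite compact_cover => /(_ _ K F oF KF)[D' D'K KD'].
have : forall s : seq C, {subset s <= K} -> exists u, is_cutoff D (\bigcup_(z in [set` s]) F z) u.
  elim=> [_|z s IH sK].
    by exists (cst 0); apply: is_cutoff_sub (is_cutoff0 D) => w [].
  have [|u hu] := IH; first by move=> w ws; apply: sK; rewrite inE ws orbT.
  have /set_mem/KD/rH[_ [v hv]] := sK z (mem_head _ _).
  exists (fun p => 1 - (1 - v p) * (1 - u p)).
  apply: is_cutoff_sub (is_cutoffU hv hu) => w [z' /=]; rewrite inE => /predU1P[->|z's] Fw.
    by left.
  by right; exists z'.
move=> /(_ (finmap.enum_fset D') D'K)[u hu]; exists u; exact: is_cutoff_sub hu.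
Qed.

End test_functions.

(** * Piecewise C^1 boundaries *)

Section thin_arcs.
Variable R : realType.

Lemma meetsU (E F : set (R * R)) (a c s : R) (i j : nat) :
  meets (E `|` F) a c s i j -> meets E a c s i j \/ meets F a c s i j.
Proof. by move=> [p [Ep|Fp] h]; [left|right]; exists p. Qed.

Lemma grid_thinU (E F : set (R * R)) (a c L : R) :
  grid_thin E a c L -> grid_thin F a c L -> grid_thin (E `|` F) a c L.
Proof.
move=> [K HK] [M HM]; exists (K + M)%N => n n0.
rewrite mulnDl (leq_trans _ (leq_add (HK n n0) (HM n n0)))//.
rewrite -big_split/= leq_sum// => i _; rewrite -big_split/= leq_sum// => j _.
case: asboolP => //= /meetsU[h|h].
  by rewrite (asboolT h).
by rewrite (asboolT h) addn1.
Qed.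

Lemma grid_thin0 (a c L : R) : grid_thin set0 a c L.
Proof.
exists 0%N => n _; rewrite mul0n leqn0; apply/eqP.
by rewrite big1// => i _; rewrite big1// => j _; case: asboolP => // -[].
Qed.

Lemma grid_thin_sub (E F : set (R * R)) (a c L : R) : E `<=` F ->
  grid_thin F a c L -> grid_thin E a c L.
Proof.
move=> EF [K HK]; exists K => n n0; rewrite (leq_trans _ (HK n n0))//.
apply: leq_sum => i _; apply: leq_sum => j _.
case: asboolP => // -[p /EF Fp h]; rewrite asboolT//; by exists p.
Qed.

Lemma grid_thin_bigcup (I : finType) (E : I -> set (R * R)) (a c L : R) :
  (forall i, grid_thin (E i) a c L) -> grid_thin (\bigcup_(i in [set: I]) E i) a c L.
Proof.
move=> H.
suff : forall s : seq I, grid_thin (\bigcup_(i in [set` s]) E i) a c L.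
  move=> /(_ (enum I)); apply: grid_thin_sub => p [i _ Ep]; exists i => //=.
  by rewrite mem_enum.
elim=> [|i s IH]; first by apply: grid_thin_sub (grid_thin0 a c L) => p [].
apply: grid_thin_sub (grid_thinU (H i) IH) => p [j /=].
by rewrite inE => /predU1P[->|js] Ep; [left|right; exists j].
Qed.

(** With [X = (x - a) / s] the index lies between [X - 2] and [X + 1], hence in a window of five
    indices. The truncation is 0 when [X - 2] is negative, which is harmless since [i] is a natural
    number. *)
Let index_range (a s x q : R) (i : nat) : 0 < s -> a + i%:R * s <= q <= a + i.+1%:R * s ->
  `|q - x| <= s -> exists2 u : nat, (u < 5)%N & i = (Num.truncn ((x - a) / s - 2) + u)%N.
Proof.
move=> s0 /andP[h1 h2] h3.
set X := (x - a) / s; have xE : x = a + X * s by rewrite /X divfK ?gt_eqF// addrC subrK.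
have i1 : i%:R <= X + 1.
  rewrite -(ler_pM2r s0); move: h3; rewrite xE ler_norml => /andP[h4 h5].
  by rewrite mulrDl mul1r; lra.
have i2 : X <= i%:R + 2.
  rewrite -(ler_pM2r s0); move: h3 h2; rewrite xE ler_norml -natr1 mulrDl mul1r => /andP[h4 h5] h2.
  by rewrite mulrDl; lra.
have t1 : X - 2 < (Num.truncn (X - 2)).+1%:R by exact: truncnS_gt.
have t2 : (Num.truncn (X - 2) <= i)%N.
  by rewrite real_truncn_le_nat ?num_real// -natr1; lra.
exists (i - Num.truncn (X - 2))%N; last by rewrite subnKC.
rewrite ltn_subLR// -(ltr_nat R) natrD.
by move: t1; rewrite -natr1 => t1; lra.
Qed.

(** The curve is sampled at the parameters [l / m] with [m = n * k] and [K <= L * k], so that every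
    point of it is within one mesh of a sample. A sample accounts for at most [5 * 5] cells, which
    gives [25 * (m + 1) <= 50 * k * n] cells. *)
Lemma grid_thin_lipschitz (g : R -> R * R) (K a c L : R) : 0 < L ->
  (forall s t, 0 <= s <= 1 -> 0 <= t <= 1 ->
     `|(g s).1 - (g t).1| <= K * `|s - t| /\ `|(g s).2 - (g t).2| <= K * `|s - t|) ->
  grid_thin (g @` `[0, 1]) a c L.
Proof.
move=> L0 gK.
pose k := (Num.truncn (K / L)).+1.
have kK : K <= L * k%:R.
  by rewrite mulrC -ler_pdivrMr// ltW// truncnS_gt.
exists (50 * k)%N => n n0.
have nR : 0 < n%:R :> R by rewrite ltr0n.
pose s := L / n%:R; have s0 : 0 < s by rewrite divr_gt0.
pose m := (n * k)%N; have m0 : (0 < m)%N by rewrite muln_gt0 n0.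
have mR : 0 < m%:R :> R by rewrite ltr0n.
pose pt (l : nat) := g (l%:R / m%:R).
case: n n0 nR @s s0 @m m0 mR @pt => // n' _ nR s s0 m m0 mR pt.
(* Sends a sample and two offsets to a cell; the cells met by the curve all lie in its image. *)
pose f (x : 'I_m.+1 * 'I_5 * 'I_5) : 'I_n'.+1 * 'I_n'.+1 :=
  (inord (Num.truncn (((pt x.1.1).1 - a) / s - 2) + x.1.2),
   inord (Num.truncn (((pt x.1.1).2 - c) / s - 2) + x.2)).
rewrite pair_big/=.
pose P (p : 'I_n'.+1 * 'I_n'.+1) := `[< meets (g @` `[0, 1]) a c s p.1 p.2 >].
have -> : (\sum_p (P p : nat) = #|[set p | P p]%SET|)%N.
  rewrite -[RHS]sum1_card [RHS]big_mkcond/=; apply: eq_bigr => p _.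
  by rewrite inE; case: (P p).
apply: leq_trans (_ : #|f @: [set: 'I_m.+1 * 'I_5 * 'I_5]|%SET <= _)%N.
  apply: subset_leq_card; apply/fintype.subsetP => -[i j]; rewrite inE/= => /asboolP[p [t /=]].
  rewrite in_itv/= => t01 <- [h1 h2].
  have [t0 t1] := andP t01.
  have tm0 : 0 <= t * m%:R by rewrite mulr_ge0.
  pose l := Num.truncn (t * m%:R).
  have /andP[l1 l2] := truncn_itv tm0.
  have lm : (l <= m)%N.
    by rewrite -(ler_nat R) (le_trans l1)// ler_piMl.
  have tl : `|t - l%:R / m%:R| <= m%:R^-1.
    have -> : t - l%:R / m%:R = (t * m%:R - l%:R) / m%:R by field; rewrite gt_eqF.
    rewrite normrM normfV (gtr0_norm mR) ler_piMl ?invr_ge0// ger0_norm ?subr_ge0//.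
    by rewrite lerBlDr addrC natr1 ltW.
  have l01 : 0 <= (l%:R / m%:R : R) <= 1.
    by apply/andP; split; [exact: divr_ge0|rewrite ler_pdivrMr// mul1r ler_nat].
  have Ks (x : R) : x <= K * `|t - l%:R / m%:R| -> x <= s.
    move=> xK; rewrite (le_trans xK)//.
    have [K0|K0] := leP 0 K; last first.
      by apply: (@le_trans _ _ 0); [rewrite nmulr_rle0|exact: ltW].
    rewrite (le_trans (ler_wpM2l K0 tl))// ler_pdivrMr// /s /m natrM mulrA divfK ?gt_eqF//.
  have [/Ks g1 /Ks g2] := gK _ _ t01 l01.
  have [u u5 iE] := index_range s0 h1 g1.
  have [v v5 jE] := index_range s0 h2 g2.
  apply/imsetP; exists (inord l, inord u, inord v); first by rewrite inE.
  have El : nat_of_ord (inord l : 'I_m.+1) = l by rewrite inordK// ltnS.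
  have Eu : nat_of_ord (inord u : 'I_5) = u by rewrite inordK.
  have Ev : nat_of_ord (inord v : 'I_5) = v by rewrite inordK.
  rewrite /f /pt [(_, _).1]/= El Eu Ev; congr pair.
    by rewrite -iE inord_val.
  by rewrite -jE inord_val.
rewrite (leq_trans (leq_imset_card _ _))// cardsT !card_prod !card_ord.
have -> : (m.+1 * 5 * 5 = 25 * m.+1)%N by rewrite -mulnA mulnC.
rewrite -[(50 * k * _)%N]mulnA [(k * _)%N]mulnC -/m -[50%N]/(25 * 2)%N -mulnA.
by rewrite leq_mul2l/= mul2n -addnn -addn1 leq_add2l.
Qed.

End thin_arcs.

(** * Arcs as local graphs and their two sides *)

Section local_graph.
Variable R : realType.
Implicit Types (f h : R -> R).

Lemma C1_lipschitz f : (forall t, derivable f t 1) -> continuous (derive1 f) ->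
  exists K : R, forall s t, 0 <= s <= 1 -> 0 <= t <= 1 -> `|f s - f t| <= K * `|s - t|.
Proof.
move=> df cf.
have cn : {within `[0, 1], continuous (fun t => `|derive1 f t|)}.
  by apply: continuous_subspaceT => t; apply: (continuous_comp (cf t)); exact: norm_continuous.
have [c _ cM] := EVT_max ler01 cn.
exists `|derive1 f c|.
have H s t : s <= t -> 0 <= s <= 1 -> 0 <= t <= 1 ->
    `|f t - f s| <= `|derive1 f c| * `|t - s|.
  move=> st /andP[s0 s1] /andP[t0 t1].
  have [||u uI ->] := @MVT_segment R f (derive1 f) s t st.
  - by move=> x _; rewrite derive1E; apply: DeriveDef.
  - by apply: continuous_subspaceT => x; exact/differentiable_continuous/derivable1_diffP.
  rewrite normrM ler_wpM2r// cM//.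
  move: uI; rewrite !in_itv/= => /andP[su ut].
  by rewrite (le_trans s0 su) (le_trans ut t1).
move=> s t hs ht; have [st|/ltW ts] := leP s t; last exact: H.
by rewrite distrC [X in _ * X]distrC; exact: H.
Qed.

(** [f] and [h] stand for the two coordinates of an arc. Near [t] the function [f] is strictly
    increasing, so the arc is a graph over the [f] axis, parametrized by the intermediate value
    theorem. [d0] is fixed before [k], because the rest of the boundary has to be separated from the
    point before the height [k] of the box can be chosen. *)
Lemma local_graph_pos f h t (d : R) : (forall t, derivable f t 1) ->
  continuous (derive1 f) -> continuous h -> 0 < derive1 f t -> 0 < d ->
  exists d0, [/\ 0 < d0, d0 <= d,
    forall r s, `|r - t| <= d0 -> `|s - t| <= d0 -> f r = f s -> r = s &
    forall k, 0 < k -> exists2 e : R, 0 < e & forall x, `|x - f t| < e ->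
      exists s, [/\ `|s - t| < d0, f s = x & `|h s - h t| < k]].
Proof.
move=> df cf ch ft d_gt0.
have : \forall s \near t, 0 < derive1 f s.
  by apply: (cf t [set y | 0 < y]); apply: open_nbhs_nbhs; split=> //; exact: open_gt.
move=> /nbhs_ballP[d1 /= d1_gt0 d1H].
pose d0 := Num.min d (d1 / 2).
have d0_gt0 : 0 < d0 by rewrite lt_min d_gt0 divr_gt0.
have fcont : continuous f by move=> x; exact/differentiable_continuous/derivable1_diffP.
have pos s : `|s - t| <= d0 -> 0 < derive1 f s.
  move=> st; apply: d1H; rewrite /ball/= distrC (le_lt_trans st)//.
  by rewrite gt_min; apply/orP; right; rewrite ltr_pdivrMr// ltr_pMr// ltr1n.
have incr : forall x y : R, t - d0 <= x -> x < y -> y <= t + d0 -> f x < f y.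
  apply: gtr0_derive1_incr => //; last exact: continuous_subspaceT.
  move=> x; rewrite in_itv/= => /andP[x1 x2]; apply: pos.
  by rewrite ler_distl !ltW.
exists d0; split=> //; first by rewrite ge_min lexx.
  move=> r s; rewrite !ler_distl => /andP[r1 r2] /andP[s1 s2] frs.
  have [rs|sr|//] := ltgtP r s.
    by have := incr _ _ r1 rs s2; rewrite frs ltxx.
  by have := incr _ _ s1 sr r2; rewrite frs ltxx.
move=> k k0.
have /cvgrPdist_lt/(_ k k0)/nbhs_ballP[d2 /= d2_gt0 d2H] := ch t.
pose e := Num.min (d0 / 2) (d2 / 2).
have e0 : 0 < e by rewrite lt_min !divr_gt0.
have ed0 : e < d0 by rewrite gt_min ltr_pdivrMr// ltr_pMr// ltr1n.
have ed2 : e < d2.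
  by rewrite gt_min; apply/orP; right; rewrite ltr_pdivrMr// ltr_pMr// ltr1n.
have te1 : f (t - e) < f t.
  by apply: incr; move: e0 ed0; clear; lra.
have te2 : f t < f (t + e).
  by apply: incr; move: e0 ed0; clear; lra.
exists (Num.min (f (t + e) - f t) (f t - f (t - e))).
  by rewrite lt_min !subr_gt0 te1 te2.
move=> x; rewrite ltr_distl => /andP[x1 x2].
have [|||s sI fs] := @IVT R f (t - e) (t + e) x.
- by rewrite lerD2l (le_trans _ (ltW e0))// oppr_le0 ltW.
- exact: continuous_subspaceT.
- have lt12 := lt_trans te1 te2.
  rewrite (min_l (ltW lt12)) (max_r (ltW lt12)).
  have h1 : Num.min (f (t + e) - f t) (f t - f (t - e)) <= f (t + e) - f t.
    by rewrite ge_min lexx.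
  have h2 : Num.min (f (t + e) - f t) (f t - f (t - e)) <= f t - f (t - e).
    by rewrite ge_min lexx orbT.
  by move: x1 x2 h1 h2; clear => *; apply/andP; split; lra.
have sd : `|s - t| <= e by move: sI; rewrite in_itv/= ler_distl.
exists s; split=> //; first exact: le_lt_trans sd ed0.
by rewrite distrC; apply: d2H; rewrite /ball/= distrC (le_lt_trans sd).
Qed.

Lemma local_graph f h t (d : R) : (forall t, derivable f t 1) ->
  continuous (derive1 f) -> continuous h -> derive1 f t != 0 -> 0 < d ->
  exists d0, [/\ 0 < d0, d0 <= d,
    forall r s, `|r - t| <= d0 -> `|s - t| <= d0 -> f r = f s -> r = s &
    forall k, 0 < k -> exists2 e : R, 0 < e & forall x, `|x - f t| < e ->
      exists s, [/\ `|s - t| < d0, f s = x & `|h s - h t| < k]].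
Proof.
move=> df cf ch; rewrite neq_lt => /orP[ft|ft] d0; last exact: local_graph_pos.
have dN x : derive1 (- f) x = - derive1 f x by rewrite !derive1E deriveN.
have [|||e [e0 ed inj H]] := @local_graph_pos (- f) h t d _ _ ch _ d0.
- by move=> x; exact: derivableN.
- have -> : derive1 (- f) = - derive1 f by apply/funext => x; rewrite dN.
  by move=> x; apply: continuousN; exact: cf.
- by rewrite dN oppr_gt0.
exists e; split=> //; first by move=> r s hr hs frs; apply: inj => //=; rewrite /GRing.opp/= frs.
move=> k k0; have [e1 e10 e1H] := H k k0; exists e1 => // x xe.
have [s [s1 s2 s3]] : exists s, [/\ `|s - t| < e, (- f) s = - x & `|h s - h t| < k].
  by apply: e1H; rewrite /GRing.opp/= -opprB normrN opprK addrC.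
by exists s; split=> //; apply: oppr_inj.
Qed.

End local_graph.

Section segments.
Variable R : realType.
Notation C := (R[i]^o).
Implicit Types (D O A N : set C) (z w p q : C).

(** The boolean lets graphs over the horizontal and the vertical axis be treated together. *)
Definition axis (b : bool) z : R := if b then complex.Im z else complex.Re z.
Definition of_axis (b : bool) (x y : R) : C := if b then y +i* x else x +i* y.

Lemma axis_of b x y : axis b (of_axis b x y) = x /\ axis (~~ b) (of_axis b x y) = y.
Proof. by case: b. Qed.

Lemma of_axisK b z : of_axis b (axis b z) (axis (~~ b) z) = z.
Proof. by case: b; case: z. Qed.

Definition seg p q (t : R) : C :=
  of_coord (complex.Re p + t * (complex.Re q - complex.Re p),
            complex.Im p + t * (complex.Im q - complex.Im p)).

Lemma axis_seg b p q t : axis b (seg p q t) = axis b p + t * (axis b q - axis b p).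
Proof. by case: b. Qed.

Lemma seg0 p q : seg p q 0 = p.
Proof. by rewrite /seg !mul0r !addr0; exact: to_coordK. Qed.

Lemma seg1 p q : seg p q 1 = q.
Proof. by rewrite /seg !mul1r ![_ + (_ - _)]addrC !subrK; exact: to_coordK. Qed.

Lemma continuous_of_coord2 (u v : R -> R) : continuous u -> continuous v ->
  continuous (fun t => of_coord (u t, v t)).
Proof.
move=> cu cv t; apply: (@continuous_comp _ _ _ (fun t => (u t, v t)) (@of_coord R)).
  have near_r (w : R -> R) (r : R) : continuous w -> 0 < r -> \forall s \near t, `|w s - w t| < r.
    move=> cw r0; have /cvgrPdist_lt/(_ r r0) := cw t.
    by apply: filterS => s; rewrite distrC.
  move=> U /nbhs2[r r0 rU].
  by apply: filterS2 (near_r u r cu r0) (near_r v r cv r0) => s us vs; exact: rU.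
exact: of_coord_continuous.
Qed.

Lemma seg_continuous p q : continuous (seg p q).
Proof.
have aff (a b : R) : continuous (fun t : R => a + t * b).
  by move=> t; apply: cvgD; [exact: cvg_cst|apply: cvgM; [exact: cvg_id|exact: cvg_cst]].
exact: continuous_of_coord2.
Qed.

(** Since [A] avoids the frontier, its trace on [O] is also its trace on [closure O]; it is
    therefore open and closed in [A]. *)
Lemma connected_frontier A O : connected A -> open O -> (A `&` frontier O) = set0 ->
  (A `&` O) !=set0 -> A `<=` O.
Proof.
move=> cA oO AF AO.
suff <- : A `&` O = A by move=> z [].
apply: cA => //; first by exists O.
exists (closure O); first exact: closed_closure.
apply/seteqP; split=> z [Az h]; split=> //; first exact: subset_closure.
apply: contrapT => nO; have : (A `&` frontier O) z.
  by split=> //; split=> // /interior_subset.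
by rewrite AF.
Qed.

Lemma seg_frontier O p q : open O -> O p ->
  (forall t, 0 <= t <= 1 -> ~ frontier O (seg p q t)) -> O q.
Proof.
move=> oO Op H.
have := @connected_frontier (seg p q @` `[0, 1]) O.
move=> /(_ _ oO _ _ q) h; apply: h.
- apply: connected_continuous_connected; first exact: segment_connected.
  exact/continuous_subspaceT/seg_continuous.
- apply/seteqP; split=> // z [[t /= t01 <-]]; apply: H.
  by move: t01; rewrite in_itv.
- by exists p; split=> //; exists 0; rewrite ?seg0//= in_itv/= lexx ler01.
- by exists 1; rewrite ?seg1//= in_itv/= lexx ler01.
Qed.

Lemma convex_gt (x y c t : R) : 0 <= t <= 1 -> c < x -> c < y -> c < x + t * (y - x).
Proof.
move=> /andP[t0 t1] cx cy; have [->|tn0] := eqVneq t 0; first by rewrite mul0r addr0.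
have h1 : 0 < t * (y - c) by rewrite mulr_gt0 ?subr_gt0// lt_def tn0.
have h2 : 0 <= (1 - t) * (x - c) by rewrite mulr_ge0 ?subr_ge0// ltW.
by rewrite -subr_gt0 (_ : _ - c = t * (y - c) + (1 - t) * (x - c)) ?ltr_wpDr//; ring.
Qed.

Lemma convex_lt (x y c t : R) : 0 <= t <= 1 -> x < c -> y < c -> x + t * (y - x) < c.
Proof.
move=> t01 cx cy; rewrite -ltrN2.
have -> : - (x + t * (y - x)) = - x + t * (- y - - x) by ring.
by apply: convex_gt; rewrite ?ltrN2.
Qed.

Lemma convex_dist (x y c r t : R) : 0 <= t <= 1 -> `|x - c| < r -> `|y - c| < r ->
  `|x + t * (y - x) - c| < r.
Proof.
move=> t01; rewrite !ltr_distl => /andP[x1 x2] /andP[y1 y2].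
by rewrite convex_gt ?convex_lt.
Qed.

(** Two points on the same side of the graph are joined by three segments: from [p] to the height
    [y1], along that height, and on to [q]. None meets the graph, hence none meets the frontier of
    [O]. The sign [sg] selects the side. *)
Lemma graph_side O b (x0 e y0 k : R) (phi : R -> R) (sg : R) p q : 0 < k ->
  open O -> sg = 1 \/ sg = -1 ->
  (forall x, `|x - x0| < e -> `|phi x - y0| < k) ->
  (forall z, `|axis b z - x0| < e -> `|axis (~~ b) z - y0| < 2 * k -> frontier O z ->
    axis (~~ b) z = phi (axis b z)) ->
  `|axis b p - x0| < e -> `|axis (~~ b) p - y0| < 2 * k -> 0 < sg * (axis (~~ b) p - phi (axis b p)) ->
  `|axis b q - x0| < e -> `|axis (~~ b) q - y0| < 2 * k -> 0 < sg * (axis (~~ b) q - phi (axis b q)) ->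
  O p -> O q.
Proof.
move=> k0 oO sgE phik F p1 p2 p3 q1 q2 q3 Op.
(* The graph stays within [k] of [y0] and the box reaches to [2 * k]; this height lies strictly
   between. *)
pose y1 := y0 + sg * (3 / 2 * k).
have y1k : `|y1 - y0| < 2 * k.
  by rewrite /y1 addrC addKr; case: sgE => ->; rewrite ?mul1r ?mulN1r ?normrN ger0_norm; lra.
have y1phi x : `|x - x0| < e -> 0 < sg * (y1 - phi x).
  move=> /phik; rewrite /y1 ltr_distl => /andP[h1 h2].
  by case: sgE => ->; lra.
pose mp := of_axis b (axis b p) y1; pose mq := of_axis b (axis b q) y1.
have step z w : `|axis b z - x0| < e -> `|axis (~~ b) z - y0| < 2 * k ->
    `|axis b w - x0| < e -> `|axis (~~ b) w - y0| < 2 * k ->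
    (forall t, 0 <= t <= 1 -> 0 < sg * (axis (~~ b) z + t * (axis (~~ b) w - axis (~~ b) z)
       - phi (axis b z + t * (axis b w - axis b z)))) -> O z -> O w.
  move=> z1 z2 w1 w2 H Oz; apply: seg_frontier (oO) (Oz) _ => t t01 Ft.
  have := F (seg z w t); rewrite !axis_seg => /(_ _ _ Ft) E.
  have := H t t01; rewrite E; last 2 first.
  - exact: convex_dist.
  - exact: convex_dist.
  by rewrite subrr mulr0 ltxx.
have [mp1 mp2] := axis_of b (axis b p) y1.
have [mq1 mq2] := axis_of b (axis b q) y1.
have comb (u v c t : R) : 0 <= t <= 1 -> 0 < sg * (u - c) -> 0 < sg * (v - c) ->
    0 < sg * (u + t * (v - u) - c).
  move=> t01; case: sgE => ->; rewrite ?mul1r ?mulN1r ?oppr_gt0 ?subr_gt0 ?subr_lt0 => ? ?.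
    exact: convex_gt.
  exact: convex_lt.
have Omp : O mp.
  apply: step Op => //; rewrite ?mp1 ?mp2// => t t01.
  by rewrite subrr mulr0 addr0; apply: comb => //; exact: y1phi.
have Omq : O mq.
  apply: step Omp => //; rewrite ?mp1 ?mp2 ?mq1 ?mq2// => t t01.
  by rewrite subrr mulr0 addr0; apply: y1phi; exact: convex_dist.
apply: step Omq => //; rewrite ?mq1 ?mq2// => t t01.
by rewrite subrr mulr0 addr0; apply: comb => //; exact: y1phi.
Qed.

End segments.

Section boundary.
Variable R : realType.
Notation C := (R[i]^o).
Implicit Types (D O A N P : set C) (z w p q : C).

Lemma frontier_nopen D z : open D -> frontier D z -> ~ D z.
Proof. by rewrite openE => oD [_ nD] /oD. Qed.

Lemma C1_arc_axis (g : R -> C) b : C1_arc g ->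
  (forall t, derivable (axis b \o g) t 1) /\ continuous (derive1 (axis b \o g)).
Proof.
move=> [hR hI _ _]; case: b.
  by have -> : axis true \o g = @complex.Im R \o g by [].
by have -> : axis false \o g = @complex.Re R \o g by [].
Qed.

Lemma C1_arc_continuous (g : R -> C) : C1_arc g -> continuous g.
Proof.
move=> ag; have -> : g = (fun t => of_coord (complex.Re (g t), complex.Im (g t))).
  by apply/funext => t; rewrite -[LHS]to_coordK.
have [h1 _] := C1_arc_axis false ag; have [h2 _] := C1_arc_axis true ag.
by apply: continuous_of_coord2 => t; apply/differentiable_continuous/derivable1_diffP;
  [exact: h1|exact: h2].
Qed.

Lemma frontier_thin D a c L : 0 < L -> piecewise_C1_boundary D ->
  grid_thin (@of_coord R @^-1` frontier D) a c L.
Proof.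
move=> L0 [n [g [ag -> _ _]]].
have H i : grid_thin ((to_coord (R := R) \o g i) @` `[0, 1]) a c L.
  have [h1 h2] := C1_arc_axis false (ag i); have [h3 h4] := C1_arc_axis true (ag i).
  have [K HK] := C1_lipschitz h1 h2; have [M HM] := C1_lipschitz h3 h4.
  apply: (@grid_thin_lipschitz _ _ (Num.max K M)) => // s t hs ht; split.
    rewrite (le_trans (HK s t hs ht))// ler_wpM2r// le_max lexx//.
  by rewrite (le_trans (HM s t hs ht))// ler_wpM2r// le_max lexx orbT.
apply: grid_thin_sub (grid_thin_bigcup H) => p [i _ [t t01 gt]].
by exists i => //; exists t => //=; rewrite gt of_coordK.
Qed.

Lemma axis_nm b z : `|axis b z| <= nm z.
Proof. by case: b; [exact: Im_nm|exact: Re_nm]. Qed.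

Lemma axisB b z w : axis b (z - w) = axis b z - axis b w.
Proof. by case: b; rewrite /axis raddfB. Qed.

Lemma nm_axis b z : nm z <= `|axis b z| + `|axis (~~ b) z|.
Proof. by case: b => /=; rewrite (le_trans (nm_ReIm _))// addrC. Qed.

Lemma open_axis_box b (x0 y0 e k : R) :
  open [set z : C | `|axis b z - x0| < e /\ `|axis (~~ b) z - y0| < k].
Proof.
apply/open_complexP => z [z1 z2].
exists (Num.min (e - `|axis b z - x0|) (k - `|axis (~~ b) z - y0|)).
  by rewrite lt_min !subr_gt0 z1.
move=> w; rewrite lt_min => /andP[w1 w2]; split.
  rewrite (le_lt_trans (ler_distD (axis b z) _ _))// -ltrBrDr (le_lt_trans _ w1)//.
  by rewrite -axisB axis_nm.
rewrite (le_lt_trans (ler_distD (axis (~~ b) z) _ _))// -ltrBrDr (le_lt_trans _ w2)//.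
by rewrite -axisB axis_nm.
Qed.

(* At a boundary point other than an end point of an arc, [N `\` frontier D]
   has at most two sides, distinguished by [S]. *)
Lemma two_sides D : piecewise_C1_boundary D ->
  exists2 P, finite_set P & forall w, frontier D w -> ~ P w -> forall r : R, 0 < r ->
  exists N (S : C -> Prop), [/\ open N, N w, (forall z, N z -> nm (z - w) < r) &
    forall O, open O -> (forall z, N z -> frontier O z -> frontier D z) ->
      forall p q, N p -> N q -> ~ frontier D p -> ~ frontier D q -> (S p <-> S q) ->
      O p -> O q].
Proof.
move=> [n [g [ag FE gdis _]]].
exists (\bigcup_(i in [set: 'I_n]) [set g i 0; g i 1]).
  by apply: bigcup_finite => // i _; exact: finite_set2.
move=> w Fw Pw r r0.
have [i _ [t /= t01 gt]] : (\bigcup_(i in [set: 'I_n]) (g i @` `[0, 1])) w by rewrite -FE.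
have t_0 : t != 0 by apply: contra_notN Pw => /eqP t0; exists i => //; left; rewrite -gt t0.
have t_1 : t != 1 by apply: contra_notN Pw => /eqP t1; exists i => //; right; rewrite -gt t1.
move: (t01); rewrite in_itv/= => /andP[t0 t1].
have {}t_0 : 0 < t by rewrite lt_def t_0.
have {}t_1 : t < 1 by rewrite lt_def eq_sym t_1.
have [_ _ reg inj] := ag i.
have [b fb] : exists b, derive1 (axis b \o g i) t != 0.
  have [h|h] := eqVneq (derive1 (axis false \o g i) t) 0; last by exists false.
  have [h'|h'] := eqVneq (derive1 (axis true \o g i) t) 0; last by exists true.
  by have := reg t t01; case; split.
have [df cf] := C1_arc_axis b (ag i).
have ch : continuous (axis (~~ b) \o g i).
  have [dh _] := C1_arc_axis (~~ b) (ag i).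
  by move=> x; exact/differentiable_continuous/derivable1_diffP.
have dm0 : 0 < Num.min t (1 - t) / 2 by rewrite divr_gt0// lt_min t_0 subr_gt0.
have [d0 [d0_gt0 d0le finj Hgr]] := local_graph df cf ch fb dm0.
have [d0t d0t'] : d0 < t /\ d0 < 1 - t.
  by move: d0le dm0; rewrite ler_pdivlMr// pmulr_lgt0// lt_min => + /andP[? ?];
  rewrite le_min => /andP[? ?]; split; lra.
(* The parameters of the boundary far from [w]: all of every other arc, and the arc [i] outside the
   [d0]-neighbourhood of [t]. Their images form a closed set that avoids [w]. *)
pose A j : set R := if j == i then `[0, t - d0]%classic `|` `[t + d0, 1]%classic else `[0, 1]%classic.
have cA j : compact (A j).
  rewrite /A; case: ifP => _; last exact: segment_compact.
  by apply: compactU; exact: segment_compact.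
have cF : closed (\bigcup_(j in [set: 'I_n]) (g j @` A j)).
  apply: closed_bigcup => [|j _]; first exact: finite_finset.
  apply: compact_closed; first exact: complex_hausdorff.
  apply: continuous_compact => //; apply: continuous_subspaceT.
  exact/C1_arc_continuous/ag.
have nFw : ~ (\bigcup_(j in [set: 'I_n]) (g j @` A j)) w.
  move=> [j _ [s]]; rewrite /A; case: ifPn => [/eqP -> As gs|ji s01 gs].
    have s01 : s \in `[0, 1].
      move: As => []/=; rewrite !in_itv/= => /andP[h1 h2].
        by rewrite h1 (le_trans h2)// lerBlDr (le_trans t1)// lerDl ltW.
      by rewrite h2 (le_trans _ h1)// addr_ge0// ltW.
    have st : s = t by apply: inj => //; rewrite gs gt.
    move: As => []/=; rewrite st in_itv/= => /andP[h1 h2].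
      by move: h2; rewrite lerBrDr gerDl leNgt d0_gt0.
    by move: h1; rewrite gerDl leNgt d0_gt0.
  have ij : i != j by rewrite eq_sym.
  have [t'|t'] := (gdis _ _ _ _ ij t01 s01 (etrans gt (esym gs))).1.
    by move: t_0; rewrite t' ltxx.
  by move: t_1; rewrite t' ltxx.
have [rho rho0 Hrho] : exists2 rho : R, 0 < rho & forall z, nm (z - w) < rho ->
    ~ (\bigcup_(j in [set: 'I_n]) (g j @` A j)) z.
  by have /open_complexP/(_ w nFw) := closed_openC cF.
pose m := Num.min r rho; have m0 : 0 < m by rewrite lt_min r0.
(* The box has half-sides at most [k] and [2 * k], so it fits in the disc of radius [m = 4 * k]. *)
pose k := m / 4; have k0 : 0 < k by rewrite divr_gt0.
have km : m = 4 * k by rewrite /k mulrC divfK.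
clearbody k.
have [e1 e10 He1] := Hgr k k0.
pose e := Num.min e1 k; have e0 : 0 < e by rewrite lt_min e10.
pose N : set C := [set z | `|axis b z - axis b w| < e /\ `|axis (~~ b) z - axis (~~ b) w| < 2 * k].
have Nm z : N z -> nm (z - w) < m.
  move=> [z1 z2]; rewrite (le_lt_trans (nm_axis b _))// !axisB.
  have : e <= k by rewrite ge_min lexx orbT.
  by rewrite km; move: z1 z2 k0; clear; lra.
have graphP x : exists y, `|x - axis b w| < e ->
    exists s, [/\ `|s - t| < d0, axis b (g i s) = x, axis (~~ b) (g i s) = y &
      `|y - axis (~~ b) w| < k].
  have [xe|] := pselect (`|x - axis b w| < e); last by exists 0.
  have [|s [s1 s2 s3]] := He1 x.
    by rewrite /= gt (lt_le_trans xe)// ge_min lexx.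
  by exists (axis (~~ b) (g i s)) => _; exists s; split=> //; move: s3; rewrite /= gt.
have [phi phiP] := choice graphP.
have in01 s : `|s - t| < d0 -> s \in `[0, 1].
  rewrite ltr_distl in_itv/= => /andP[h1 h2]; apply/andP; split.
    by rewrite ltW// (le_lt_trans _ h1)// subr_ge0 ltW.
  by rewrite ltW// (lt_le_trans h2)// -lerBrDl ltW.
have Fgraph z : N z -> frontier D z -> axis (~~ b) z = phi (axis b z).
  move=> Nz; rewrite FE => -[j _ [s /= s01 gs]].
  have nA : ~ A j s.
    move=> As; have : ~ (\bigcup_(j in [set: 'I_n]) (g j @` A j)) z.
      by apply: Hrho; rewrite (lt_le_trans (Nm _ Nz))// ge_min lexx orbT.
    by apply; exists j => //; exists s.
  move: nA; rewrite /A; case: ifPn => [/eqP ji nA|_]; last by [].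
  have st : `|s - t| <= d0.
    rewrite ler_distl; apply/andP; split; rewrite leNgt; apply/negP => h; apply: nA.
      by left => /=; move: s01; rewrite !in_itv/= => /andP[-> _]; rewrite ltW.
    by right => /=; move: s01; rewrite !in_itv/= => /andP[_ ->]; rewrite ltW.
  have [s' [s'1 s'2 s'3 _]] := phiP _ Nz.1.
  have -> : phi (axis b z) = axis (~~ b) (g i s') by [].
  rewrite -gs ji in s'2 *; congr (axis _ (g i _)).
  by apply: finj => //; exact: ltW.
have graphF z : N z -> axis (~~ b) z = phi (axis b z) -> frontier D z.
  move=> Nz zphi; have [s [s1 s2 s3 _]] := phiP _ Nz.1.
  by rewrite FE; exists i => //; exists s; [exact: in01|rewrite -[LHS](of_axisK b) s2 s3 -zphi of_axisK].
exists N, (fun z => phi (axis b z) < axis (~~ b) z); split.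
- exact: open_axis_box.
- by split; rewrite subrr normr0// mulr_gt0.
- by move=> z /Nm zm; rewrite (lt_le_trans zm)// ge_min lexx.
move=> O oO OD p q Np Nq Fp Fq Spq.
have phik x : `|x - axis b w| < e -> `|phi x - axis (~~ b) w| < k.
  by move=> /phiP[s []].
have GF z : `|axis b z - axis b w| < e -> `|axis (~~ b) z - axis (~~ b) w| < 2 * k ->
    frontier O z -> axis (~~ b) z = phi (axis b z).
  by move=> z1 z2 Oz; exact: (Fgraph z (conj z1 z2) (OD z (conj z1 z2) Oz)).
have neq z : N z -> ~ frontier D z -> phi (axis b z) <= axis (~~ b) z -> phi (axis b z) < axis (~~ b) z.
  by move=> Nz Fz; rewrite le_eqVlt => /predU1P[h|//]; case: Fz; exact: graphF.
have [Sp|Sp] := pselect (phi (axis b p) < axis (~~ b) p).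
  apply: (graph_side (phi := phi) k0 oO (or_introl erefl) phik GF) Np.1 Np.2 _ Nq.1 Nq.2 _.
    by rewrite mul1r subr_gt0.
  by rewrite mul1r subr_gt0; exact/Spq.
apply: (graph_side (phi := phi) k0 oO (or_intror erefl) phik GF) Np.1 Np.2 _ Nq.1 Nq.2 _.
  by rewrite mulN1r opprB subr_gt0 ltNge; apply/negP => /(neq _ Np Fp).
by rewrite mulN1r opprB subr_gt0 ltNge; apply/negP => /(neq _ Nq Fq)/Spq.
Qed.

Lemma closure_meets A N z : closure A z -> open N -> N z -> exists2 w, A w & N w.
Proof. by move=> Az oN Nz; have [w []] := Az _ (open_nbhs_nbhs (conj oN Nz)); exists w. Qed.

Lemma open_disjoint_closure D O : open O -> D `&` O = set0 -> closure D `&` O = set0.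
Proof.
move=> oO DO; apply/seteqP; split=> // z [Dz Oz].
have [w Dw Ow] := closure_meets Dz oO Oz.
by have : (D `&` O) w by []; rewrite DO.
Qed.

Lemma seg_ball z p q (r t : R) : 0 <= t <= 1 -> nm (p - z) < r -> nm (q - z) < r ->
  nm (seg p q t - z) < r.
Proof.
move=> t01 pr qr; have [t0 t1] := andP t01.
have -> : seg p q t - z = (1 - t)%:C * (p - z) + t%:C * (q - z).
  case: p q z {pr qr} => a b [c d] [x y]; rewrite /seg /of_coord/=.
  by apply/eqP; rewrite eq_complex/=; apply/andP; split; apply/eqP; ring.
rewrite (le_lt_trans (nmD _ _))// !nmM !nmC !ger0_norm ?subr_ge0//.
have -> : (1 - t) * nm (p - z) + t * nm (q - z) = nm (p - z) + t * (nm (q - z) - nm (p - z)).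
  by ring.
exact: convex_lt.
Qed.

(** Multiplication by [0 +i* v] displaces [e] at a right angle to [e - p], so the two segments lie
    on different lines through [p]. *)
Lemma seg_fan p e (v t1 t2 : R) : v != 0 -> e != p ->
  seg e p t1 = seg (e + (0 +i* v) * (e - p)) p t2 -> seg e p t1 = p.
Proof.
move=> v0; case: p e => a b [c d] ep; rewrite /seg /of_coord/= => -[h1 h2].
have dd : (c - a) ^+ 2 + (d - b) ^+ 2 != 0.
  apply: contra ep; rewrite paddr_eq0 ?sqr_ge0// !sqrf_eq0 !subr_eq0.
  by move=> /andP[/eqP -> /eqP ->].
have : (1 - t2) * v * ((c - a) ^+ 2 + (d - b) ^+ 2) = 0.
  have e1 : (1 - t1) * (c - a) = (1 - t2) * ((c - a) - v * (d - b)).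
    by apply/eqP; rewrite -subr_eq0; apply/eqP; move/eqP: h1; rewrite -subr_eq0 => /eqP <-; ring.
  have e2 : (1 - t1) * (d - b) = (1 - t2) * ((d - b) + v * (c - a)).
    by apply/eqP; rewrite -subr_eq0; apply/eqP; move/eqP: h2; rewrite -subr_eq0 => /eqP <-; ring.
  have -> : (1 - t2) * v * ((c - a) ^+ 2 + (d - b) ^+ 2) =
      (1 - t2) * ((d - b) + v * (c - a)) * (c - a) - (1 - t2) * ((c - a) - v * (d - b)) * (d - b).
    by ring.
  by rewrite -e1 -e2; ring.
move=> /eqP; rewrite !mulf_eq0 (negbTE v0) (negbTE dd) !orbF subr_eq0 => /eqP t2E.
rewrite h1 h2 -t2E; apply/eqP; rewrite eq_complex/=.
by apply/andP; split; apply/eqP; ring.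
Qed.

Lemma frontier_exterior D O z : open D -> open O ->
  frontier (~` (closure D `|` closure O)) z -> frontier D z \/ frontier O z.
Proof.
move=> oD oO [cE nE].
have oE : open (~` (closure D `|` closure O)).
  by apply: closed_openC; apply: closedU; exact: closed_closure.
have nz A : open A -> A `<=` closure D `|` closure O -> ~ A z.
  by move=> oA AD Az; have [w + Aw] := closure_meets cE oA Az; case; exact: AD.
have : (closure D `|` closure O) z.
  by apply: contrapT => h; apply: nE; move: oE; rewrite openE; apply.
case=> h; [left|right]; split=> //; move=> /interior_subset; apply: nz => //.
  by move=> w Dw; left; exact: subset_closure.
by move=> w Dw; right; exact: subset_closure.
Qed.

(** Otherwise all boundary points near [z] belong to both frontiers. At a point [w] of the frontier
    of [E] near [z] that is not an end point of an arc, the three disjoint open sets [Dp], [Dm] and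
    [E] would all come arbitrarily close, while [two_sides] leaves room for only two. *)
Lemma exterior_touch (Dp Dm : set C) z : open Dp -> open Dm -> Dp `&` Dm = set0 ->
  piecewise_C1_boundary Dp -> (frontier Dp `&` frontier Dm) z ->
  closure (~` (closure Dp `|` closure Dm)) z ->
  closure ((frontier Dp `|` frontier Dm) `\` (frontier Dp `&` frontier Dm)) z.
Proof.
move=> op om dis C1 Gz; set E := ~` _ => Ez; apply: contrapT => ncl.
have oE : open E by apply: closed_openC; apply: closedU; exact: closed_closure.
have pE w : Dp w -> ~ E w by move=> Dw; apply; left; exact: subset_closure.
have mE w : Dm w -> ~ E w by move=> Dw; apply; right; exact: subset_closure.
have EcE w : E w -> ~ closure Dp w by move=> nE cw; apply: nE; left.
have FE w : frontier E w -> frontier Dp w \/ frontier Dm w by exact: frontier_exterior.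
clearbody E.
have [r r0 rH] : exists2 r : R, 0 < r & forall w, nm (w - z) < r ->
    frontier Dp w \/ frontier Dm w -> (frontier Dp `&` frontier Dm) w.
  apply: contrapT => h; apply: ncl; apply/closure_complexP => r r0.
  apply: contrapT => h2; apply: h; exists r; first exact: r0.
  move=> w wr Fw; apply: contrapT => nG; apply: h2.
  by exists w; [exact: (conj Fw nG)|exact: wr].
have [P finP HP] := two_sides C1.
(* The exceptional set is finite, so in a small disc only [z] itself can be an end point. *)
have [r1 r10 [r1r r1P]] : exists2 r1 : R, 0 < r1 & r1 <= r /\
    forall w, nm (w - z) < r1 -> P w -> w = z.
  have cP : closed (P `\` [set z]).
    apply: compact_closed; first exact: complex_hausdorff.
    by apply: finite_compact; exact: finite_setD.
  have /open_complexP/(_ z)[|r1 r10 r1H] := closed_openC cP; first by move=> [_ /=].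
  exists (Num.min r r1); first by rewrite lt_min r0.
  split; first by rewrite ge_min lexx.
  move=> w; rewrite lt_min => /andP[_ /r1H h] Pw; apply: contrapT => wz.
  exact: h.
have /closure_complexP/(_ _ r10)[e Ee er] := Ez.
have /closure_complexP/(_ _ r10)[p Dpp pr] := Gz.1.1.
have cross e' : E e' -> nm (e' - z) < r1 -> exists t, [/\ 0 <= t <= 1,
    frontier E (seg e' p t) & nm (seg e' p t - z) < r1].
  move=> Ee' er'; apply: contrapT => h; apply: (pE _ Dpp).
  apply: (seg_frontier oE Ee') => t t01 Ft; apply: h; exists t; split=> //.
  exact: seg_ball.
have [w [Fw wr wz]] : exists w, [/\ frontier E w, nm (w - z) < r1 & w <> z].
  have [t1 [_ F1 b1]] := cross e Ee er.
  have [E1|?] := pselect (seg e p t1 = z); last by exists (seg e p t1).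
  have /open_complexP/(_ e Ee)[d d0 dE] := oE.
  have ep : e != p by apply/eqP => ep; apply: (pE p Dpp); rewrite -ep.
  (* If the segment from [e] to [p] meets the frontier at [z], a start displaced sideways is used.
     Its displacement is half the distance allowed for staying in [E] and in the disc around [z]. *)
  pose v := Num.min d (r1 - nm (e - z)) / (2 * nm (e - p)).
  have nep : 0 < nm (e - p) by rewrite nm_gt0 subr_eq0.
  have m0 : 0 < Num.min d (r1 - nm (e - z)) by rewrite lt_min d0 subr_gt0.
  have v0 : 0 < v by rewrite divr_gt0// mulr_gt0.
  have e2 : nm ((0 +i* v) * (e - p)) < Num.min d (r1 - nm (e - z)).
    have nv : nm (0 +i* v) = v by rewrite /nm/= expr0n/= add0r sqrtr_sqr gtr0_norm.
    have vn : v * nm (e - p) = Num.min d (r1 - nm (e - z)) / 2.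
      by rewrite /v; field; rewrite gt_eqF.
    by rewrite nmM nv vn ltr_pdivrMr// ltr_pMr// ltr1n.
  have [||t2 [_ F2 b2]] := cross (e + (0 +i* v) * (e - p)).
  - by apply: dE; rewrite addrC addKr (lt_le_trans e2)// ge_min lexx.
  - rewrite addrAC (le_lt_trans (nmD _ _))// -ltrBrDl (lt_le_trans e2)//.
    by rewrite ge_min lexx orbT.
  have [E2|?] := pselect (seg (e + (0 +i* v) * (e - p)) p t2 = z); last first.
    by exists (seg (e + (0 +i* v) * (e - p)) p t2).
  have zp : z = p by rewrite -E1; exact: (seg_fan (lt0r_neq0 v0) ep (etrans E1 (esym E2))).
  by have := frontier_nopen op Gz.1; rewrite zp.
have [Fp Fm] := rH w (lt_le_trans wr r1r) (FE _ Fw).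
have Pw : ~ P w by move=> /(r1P _ wr).
have rw : 0 < r1 - nm (w - z) by rewrite subr_gt0.
have [N [S [oN Nw Nr NS]]] := HP w Fp Pw _ rw.
have [p' Dp' Np'] := closure_meets Fp.1 oN Nw.
have [m' Dm' Nm'] := closure_meets Fm.1 oN Nw.
have [e' Ee' Ne'] := closure_meets Fw.1 oN Nw.
have Fp' : ~ frontier Dp p' by move=> /(frontier_nopen op).
have Fm' : ~ frontier Dp m'.
  move=> [cm _]; have : (closure Dp `&` Dm) m' := conj cm Dm'.
  by rewrite open_disjoint_closure.
have Fe' : ~ frontier Dp e' by move=> [ce _]; exact: (EcE _ Ee').
have NSp := NS Dp op (fun _ _ h => h).
(* The sides are those of [frontier Dp], yet they also control [Dm], whose frontier near [z] is part
   of [frontier Dp]. *)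
have NSm : forall p q, N p -> N q -> ~ frontier Dp p -> ~ frontier Dp q -> (S p <-> S q) ->
      Dm p -> Dm q.
  apply: (NS Dm om) => u Nu Fu; refine (rH u _ (or_intror Fu)).1.
  apply: (lt_le_trans _ r1r); apply: (le_lt_trans (nm_triB _ w _)).
  by rewrite -ltrBrDr; exact: Nr.
have npm : ~ (S p' <-> S m').
  move=> h; have : (Dp `&` Dm) m' by split; [exact: (NSp _ _ Np' Nm' Fp' Fm' h Dp')|exact: Dm'].
  by rewrite dis.
have npe : ~ (S p' <-> S e').
  by move=> h; exact: (pE e' (NSp _ _ Np' Ne' Fp' Fe' h Dp') Ee').
have nme : ~ (S m' <-> S e').
  by move=> h; exact: (mE e' (NSm _ _ Nm' Ne' Fm' Fe' h Dm') Ee').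
(* Pigeonhole: three points cannot pairwise differ in the single proposition [S]. *)
move: npm npe nme; clear => npm npe nme.
by have [?|?] := pselect (S p'); have [?|?] := pselect (S m'); have [?|?] := pselect (S e');
  tauto.
Qed.

End boundary.

(** * The dbar derivative *)

Section cdf.
Variable R : realType.
Notation C := (R[i]^o).
Implicit Types (f g h : C -> C) (z w a b : C).

(** Real differentiability at [z] with Wirtinger derivatives [a] (in z) and [b] (in conj z); [b = 0]
    is complex differentiability. *)
Definition cdf f z a b := forall e : R, 0 < e -> exists2 r : R, 0 < r & forall w,
  nm (w - z) < r -> nm (f w - f z - a * (w - z) - b * conjc (w - z)) <= e * nm (w - z).

Lemma cdf_near f g z a b (r : R) : 0 < r -> (forall w, nm (w - z) < r -> f w = g w) ->
  cdf f z a b -> cdf g z a b.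
Proof.
move=> r0 fg cf e e0; have [d d0 H] := cf e e0.
exists (Num.min r d); first by rewrite lt_min r0.
move=> w; rewrite lt_min => /andP[wr wd].
by rewrite -!fg ?H// subrr nm0.
Qed.

Lemma cdf_cst z c : cdf (fun=> c) z 0 0.
Proof.
move=> e e0; exists 1 => // w _.
by rewrite subrr !mul0r !subr0 nm0 mulr_ge0 ?nm_ge0// ltW.
Qed.

Lemma cdf_conj z : cdf (@conjc R) z 0 1.
Proof.
move=> e e0; exists 1 => // w _.
rewrite mul0r subr0 mul1r (_ : _ - _ = 0) ?nm0 ?mulr_ge0 ?nm_ge0 ?ltW//.
by rewrite rmorphB subrr.
Qed.

Lemma cdfD f g z a b a' b' : cdf f z a b -> cdf g z a' b' ->
  cdf (fun w => f w + g w) z (a + a') (b + b').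
Proof.
move=> cf cg e e0; have e2 : 0 < e / 2 by rewrite divr_gt0.
have [d d0 H] := cf _ e2; have [d' d'0 H'] := cg _ e2.
exists (Num.min d d'); first by rewrite lt_min d0.
move=> w; rewrite lt_min => /andP[/H h1 /H' h2].
rewrite [leRHS](_ : _ = e / 2 * nm (w - z) + e / 2 * nm (w - z)); last by field.
apply: le_trans (lerD h1 h2); apply: le_trans (nmD _ _).
by rewrite le_eqVlt; apply/orP; left; apply/eqP; congr nm; ring.
Qed.

Lemma cdf_loc f z a b : cdf f z a b -> exists2 K : R, 0 < K & exists2 r : R, 0 < r &
  forall w, nm (w - z) < r -> nm (f w - f z) <= K * nm (w - z).
Proof.
move=> /(_ 1 ltr01)[r r0 H]; exists (1 + nm a + nm b).
  by rewrite -addrA ltr_wpDr// addr_ge0 ?nm_ge0.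
exists r => // w /H h.
have -> : f w - f z = (f w - f z - a * (w - z) - b * conjc (w - z)) + a * (w - z) + b * conjc (w - z).
  by ring.
rewrite (le_trans (nmD _ _))// !mulrDl lerD//; last by rewrite nmM nm_conj.
by rewrite (le_trans (nmD _ _))// lerD// nmM.
Qed.

Lemma cdf_continuous f z a b : cdf f z a b -> forall e : R, 0 < e -> exists2 r : R, 0 < r &
  forall w, nm (w - z) < r -> nm (f w - f z) < e.
Proof.
move=> /cdf_loc[K K0 [r r0 H]] e e0; exists (Num.min r (e / K)).
  by rewrite lt_min r0 divr_gt0.
move=> w; rewrite lt_min => /andP[/H h1 h2].
by rewrite (le_lt_trans h1)// mulrC -ltr_pdivlMr.
Qed.

Lemma cdfM f g z a b a' b' : cdf f z a b -> cdf g z a' b' ->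
  cdf (fun w => f w * g w) z (a * g z + f z * a') (b * g z + f z * b').
Proof.
move=> cf cg e e0.
have [K K0 [r r0 HK]] := cdf_loc cf; have [M M0 [s s0 HM]] := cdf_loc cg.
(* The error of the product has three terms, each allotted a third of [e]; adding 1 keeps the
   denominators positive. *)
pose e1 := e / (3 * (nm (g z) + 1)).
have gz0 : 0 < nm (g z) + 1 by rewrite ltr_wpDl// nm_ge0.
have e10 : 0 < e1 by rewrite divr_gt0// mulr_gt0.
pose e2 := e / (3 * (nm (f z) + 1)).
have fz0 : 0 < nm (f z) + 1 by rewrite ltr_wpDl// nm_ge0.
have e20 : 0 < e2 by rewrite divr_gt0// mulr_gt0.
have [d d0 H] := cf _ e10; have [d' d'0 H'] := cg _ e20.
pose e3 := e / (3 * (K * M)).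
have e30 : 0 < e3 by rewrite divr_gt0// !mulr_gt0.
exists (Num.min (Num.min r s) (Num.min e3 (Num.min d d'))).
  by rewrite !lt_min r0 s0 e30 d0.
move=> w; rewrite !lt_min => /andP[/andP[/HK h1 /HM h2] /and3P[h3 /H h4 /H' h5]].
set x := nm (w - z) in h1 h2 h3 h4 h5 *.
have x0 : 0 <= x by exact: nm_ge0.
have -> : f w * g w - f z * g z - (a * g z + f z * a') * (w - z)
    - (b * g z + f z * b') * conjc (w - z) =
  (f w - f z - a * (w - z) - b * conjc (w - z)) * g z +
  f z * (g w - g z - a' * (w - z) - b' * conjc (w - z)) +
  (f w - f z) * (g w - g z) by ring.
rewrite [leRHS](_ : _ = e / 3 * x + e / 3 * x + e / 3 * x); last by field.
rewrite (le_trans (nmD _ _))// lerD//; last first.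
  rewrite nmM (le_trans (ler_pM (nm_ge0 _) (nm_ge0 _) h1 h2))//.
  have -> : K * x * (M * x) = K * M * x * x by ring.
  rewrite ler_wpM2r// -[leRHS](_ : K * M * e3 = _); last first.
    by rewrite /e3; field; rewrite !gt_eqF.
  by rewrite ler_wpM2l ?mulr_ge0 ?ltW.
have small (A : R) : 0 <= A -> e / (3 * (A + 1)) * x * A <= e / 3 * x.
  move=> A0; have A1 : 0 < A + 1 by rewrite ltr_wpDl.
  rewrite [leLHS](_ : _ = e / 3 * x * (A / (A + 1))); last by field; rewrite gt_eqF.
  rewrite ler_piMr ?mulr_ge0 ?divr_ge0 ?(ltW e0)//.
  by rewrite ler_pdivrMr// mul1r lerDl.
rewrite (le_trans (nmD _ _))// lerD// nmM.
  by rewrite (le_trans (ler_wpM2r (nm_ge0 _) h4))// small ?nm_ge0.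
by rewrite mulrC (le_trans (ler_wpM2r (nm_ge0 _) h5))// small ?nm_ge0.
Qed.

Lemma cdfZ f z a b c : cdf f z a b -> cdf (fun w => c * f w) z (c * a) (c * b).
Proof.
move=> cf; have := cdfM (cdf_cst z c) cf.
by rewrite !mul0r !add0r.
Qed.

Lemma cdf_derivable f z a : cdf f z a 0 -> derivable f z 1.
Proof.
move=> cf; apply/cvg_ex; exists a.
move=> U /nbhs_complexP[e e0 eU].
have e2 : 0 < e / 2 by rewrite divr_gt0.
have [r r0 H] := cf _ e2.
apply/nbhs_complexP; exists r => // h hr h0; apply: eU.
have := H (h *: 1 + z); rewrite addrK [h *: 1]mulr1 mul0r subr0.
rewrite subr0 in hr; move=> /(_ hr) H1.
have nh0 : 0 < nm h by rewrite nm_gt0.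
have -> : h^-1 *: (f (h + z) - f z) - a = h^-1 * (f (h + z) - f z - a * h).
  by rewrite [in RHS]mulrBr [a * h]mulrC mulrA mulVf// mul1r.
rewrite nmM nmV mulrC ltr_pdivrMr// (le_lt_trans H1)// ltr_pM2r//.
by rewrite ltr_pdivrMr// ltr_pMr// ltr1n.
Qed.

Lemma quotient_split (x y a : C) : y != 0 -> x - a * y = y * (y^-1 * x - a).
Proof. by move=> y0; rewrite mulrBr mulrA divff// mul1r [a * _]mulrC. Qed.

Lemma derivable_cdf f z : derivable f z 1 -> exists a, cdf f z a 0.
Proof.
move=> /cvg_ex[a fa]; exists a => e e0.
have : nbhs a [set w : C | nm (w - a) < e] by apply/nbhs_complexP; exists e.
move=> /fa/nbhs_complexP[r r0 H]; exists r => // w wr.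
have [->|wz] := eqVneq w z.
  by rewrite !subrr mulr0 mul0r !subr0 nm0 mulr_ge0 ?nm_ge0// ltW.
have wz0 : w - z != 0 by rewrite subr_eq0.
have := H (w - z); rewrite subr0 => /(_ wr wz0) /=.
rewrite [(w - z) *: 1]mulr1 subrK mul0r subr0 => h.
by rewrite (quotient_split _ _ wz0) nmM mulrC ler_wpM2r ?nm_ge0// ltW.
Qed.

Definition dbar (u : R * R -> R) z : C :=
  (('D_(dir R false) u (to_coord z)) / 2) +i* (('D_(dir R true) u (to_coord z)) / 2).

Definition upd (b : bool) (p : R * R) (t : R) : R * R := if b then (p.1, t) else (t, p.2).

Lemma is_derive_upd (u : R * R -> R) (b : bool) (p : R * R) (t : R) :
  derivable u (upd b p t) (dir R b) ->
  is_derive t 1 (fun s => u (upd b p s)) ('D_(dir R b) u (upd b p t)).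
Proof.
have E : (fun h : R => h^-1 *: (((fun s => u (upd b p s)) \o shift t) (h *: 1) - u (upd b p t))) =
    (fun h : R => h^-1 *: ((u \o shift (upd b p t)) (h *: dir R b) - u (upd b p t))).
  apply/funext => h /=; congr (_ *: (u _ - _)).
  case: b; first by rewrite [RHS](_ : _ = (h * 0 + p.1, h * 1 + t))// mulr0 add0r.
  by rewrite [RHS](_ : _ = (h * 1 + t, h * 0 + p.2))// mulr0 add0r.
by move=> du; split; rewrite /derivable /derive E.
Qed.

Lemma MVT_any (F F' : R -> R) (x y : R) : (forall t : R, is_derive t 1 F (F' t)) ->
  exists2 c, `|c - x| <= `|y - x| & F y - F x = F' c * (y - x).
Proof.
move=> dF; have cF : continuous F.
  by move=> t; apply/differentiable_continuous/derivable1_diffP; have [] := dF t.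
have [xy|/ltW yx] := leP x y.
  have [c cI ->] := @MVT_segment R F F' x y xy (fun t _ => dF t) (continuous_subspaceT cF).
  exists c => //; move: cI; rewrite in_itv/= => /andP[xc cy].
  by rewrite !ger0_norm ?subr_ge0// lerD2r.
have [c cI E] := @MVT_segment R F F' y x yx (fun t _ => dF t) (continuous_subspaceT cF).
exists c; last by rewrite -opprB E; ring.
move: cI; rewrite in_itv/= => /andP[xc cy].
by rewrite !ler0_norm ?subr_le0// lerN2 lerD2r.
Qed.

(** The mean value theorem is used along the vertical segment from [z] and then along the horizontal
    one to [w]; continuity of the partial derivatives does the rest. As [u] is real, its two
    Wirtinger derivatives are conjugate. *)
Lemma ub_cdf (u : R * R -> R) z : ub 1 setT (fun _ : unit => u) ->
  cdf (toC u) z (conjc (dbar u z)) (dbar u z).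
Proof.
move=> [_ _ [du H]].
have cD (b : bool) p : {for p, continuous ('D_(dir R b) u)} by have [_ /(_ tt p I)] := H b.
have dl (b : bool) p t := is_derive_upd (du tt (upd b p t) b I).
move=> e e0; have e2 : 0 < e / 2 by rewrite divr_gt0.
have /continuous2/(_ _ e2)[r r0 Hr] := cD false (to_coord z).
have /continuous2/(_ _ e2)[s s0 Hs] := cD true (to_coord z).
exists (Num.min r s); first by rewrite lt_min r0.
move=> w; rewrite lt_min => /andP[wr ws].
set p := to_coord z in Hr Hs *; set q := to_coord w.
have qp1 : `|q.1 - p.1| <= nm (w - z) by rewrite (le_trans _ (Re_nm _))// raddfB.
have qp2 : `|q.2 - p.2| <= nm (w - z) by rewrite (le_trans _ (Im_nm _))// raddfB.
have [c1 c1l E1] := MVT_any p.1 q.1 (dl false q).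
have [c2 c2l E2] := MVT_any p.2 q.2 (dl true p).
have -> : toC u w - toC u z - conjc (dbar u z) * (w - z) - dbar u z * conjc (w - z) =
  (('D_(dir R false) u (c1, q.2) - 'D_(dir R false) u p) * (q.1 - p.1) +
   ('D_(dir R true) u (p.1, c2) - 'D_(dir R true) u p) * (q.2 - p.2))%:C.
  have uE : u q - u p = 'D_(dir R false) u (c1, q.2) * (q.1 - p.1) +
     'D_(dir R true) u (p.1, c2) * (q.2 - p.2).
    rewrite -[in RHS]E1 -[in RHS]E2 /upd/=.
    by rewrite addrA subrK.
  rewrite /toC -/p -/q.
  have -> : ((u q)%:C - (u p)%:C : C) = ('D_(dir R false) u (c1, q.2) * (q.1 - p.1) +
     'D_(dir R true) u (p.1, c2) * (q.2 - p.2))%:C by rewrite -uE rmorphB.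
  rewrite /dbar -/p /q /p; case: z w {Hr Hs wr ws qp1 qp2 c1l c2l E1 E2 uE p q} => a b [c d].
  by apply/eqP; rewrite eq_complex/=; apply/andP; split; apply/eqP; field.
rewrite nmC (le_trans (ler_normD _ _))// !normrM.
rewrite [leRHS](_ : _ = e / 2 * nm (w - z) + e / 2 * nm (w - z)); last by field.
rewrite lerD// ler_pM// ltW//.
  apply: Hr => /=; first exact: le_lt_trans (le_trans c1l qp1) wr.
  exact: le_lt_trans qp2 wr.
apply: Hs => /=; first by rewrite subrr normr0.
exact: le_lt_trans (le_trans c2l qp2) ws.
Qed.

End cdf.

(** * Green's formula for the dbar derivative *)

Section complex_green.
Variable R : realType.
Notation C := (R[i]^o).
Notation mu2 := (@plane_measure R).
Implicit Types (f g h : C -> C) (z w a b : C) (D E : set C).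

Lemma ucont_compact (u : R * R -> R) (L : R) : (forall p, {for p, continuous u}) ->
  (forall p, u p != 0 -> `|p.1| < L /\ `|p.2| < L) -> ucont u.
Proof.
move=> cu su e e0.
have e2 : 0 < e / 2 by rewrite divr_gt0.
(* The margin 1 goes with [r <= 1]: if [p] is outside [K], both [p] and [q] are outside the
   support. *)
pose K : set (R * R) := `[- (L + 1), L + 1] `*` `[- (L + 1), L + 1].
have cK : compact K by apply: compact_setX; exact: segment_compact.
have PF : ProperFilter (0 : R)^'+ by exact: at_right_proper_filter.
have := compact_near_coveringP K; move=> [/(_ cK) H _].
have := H R (0 : R)^'+ (fun r p => forall q, `|p.1 - q.1| <= r -> `|p.2 - q.2| <= r -> `|u p - u q| <= e) _.
case.
  move=> p Kp; have /continuous2/(_ _ e2)[r r0 Hr] := cu p.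
  have r2 : 0 < r / 2 by rewrite divr_gt0.
  exists ([set q | `|q.1 - p.1| < r / 2 /\ `|q.2 - p.2| < r / 2], [set s | s < r / 2]).
    split => /=; first by apply/nbhs2; exists (r / 2).
    by exists (r / 2) => //= s; rewrite /ball/= sub0r normrN => + s0; rewrite gtr0_norm.
  move=> [p' s] /= [[p1 p2] sr] q q1 q2.
  have h1 : `|u p' - u p| < e / 2 by apply: Hr; rewrite (lt_le_trans (_ : _ < r / 2))//; lra.
  have h2 : `|u q - u p| < e / 2.
    apply: Hr.
      rewrite (le_lt_trans (ler_distD p'.1 _ _))// [`|q.1 - _|]distrC [ltRHS]splitr ltrD//.
      exact: le_lt_trans sr.
    rewrite (le_lt_trans (ler_distD p'.2 _ _))// [`|q.2 - _|]distrC [ltRHS]splitr ltrD//.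
    exact: le_lt_trans sr.
  rewrite (le_trans (ler_distD (u p) _ _))// [leRHS]splitr lerD//; first exact: ltW.
  by rewrite distrC ltW.
move=> r0 /= r00 Hr0.
pose r := Num.min (r0 / 2) 1.
have r_gt0 : 0 < r by rewrite lt_min divr_gt0 /=.
have rr0 : r < r0 by rewrite gt_min ltr_pdivrMr// ltr_pMr// ltr1n.
have r1 : r <= 1 by rewrite ge_min lexx orbT.
have HK : K `<=` (fun p => forall q, `|p.1 - q.1| <= r -> `|p.2 - q.2| <= r -> `|u p - u q| <= e).
  by apply: Hr0 => //=; rewrite /ball/= sub0r normrN gtr0_norm.
exists r => // p q h1 h2.
have [Kp|nKp] := pselect (K p); first exact: HK.
have out (t : R * R) : ~ (`|t.1| < L /\ `|t.2| < L) -> u t = 0.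
  by move=> nt; apply/eqP; apply: contra_notT nt => /su.
rewrite !out ?subrr ?normr0 ?ltW// => -[l1 l2]; apply: nKp; split => /=; rewrite in_itv/= -ler_norml.
- rewrite -[p.1](subrK q.1) (le_trans (ler_normD _ _))// addrC lerD ?(le_trans h1)//; exact: ltW.
- rewrite -[p.2](subrK q.2) (le_trans (ler_normD _ _))// addrC lerD ?(le_trans h2)//; exact: ltW.
- by rewrite (le_trans (ltW l1))// lerDl.
- by rewrite (le_trans (ltW l2))// lerDl.
Qed.

Lemma bounded_compact_support (u : R * R -> R) (L : R) : (forall p, {for p, continuous u}) ->
  (forall p, u p != 0 -> `|p.1| < L /\ `|p.2| < L) -> exists M, forall p, `|u p| <= M.
Proof.
move=> cu su.
pose K : set (R * R) := `[- L, L] `*` `[- L, L].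
have cK : compact K by apply: compact_setX; exact: segment_compact.
have := compact_near_coveringP K; move=> [/(_ cK) H _].
have := H R (nbhs +oo) (fun M p => `|u p| <= M) _; case.
  move=> p Kp; have /continuous2/(_ _ ltr01)[r r0 Hr] := cu p.
  exists ([set q | `|q.1 - p.1| < r /\ `|q.2 - p.2| < r], [set M | `|u p| + 1 < M]).
    split => /=; first by apply/nbhs2; exists r.
    by exists (`|u p| + 1); split=> //; exact: num_real.
  move=> [q M] /= [[q1 q2] hM]; rewrite ltW// (le_lt_trans _ hM)//.
  by rewrite -(subrK (u p) (u q)) (le_trans (ler_normD _ _))// addrC lerD2l ltW// Hr.
move=> M0 [_ HM]; exists (Num.max 0 (M0 + 1)) => p.
have [up|up] := eqVneq (u p) 0; first by rewrite up normr0 le_max lexx.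
have [h1 h2] := su _ up; rewrite le_max (HM (M0 + 1)) ?orbT ?ltrDl//.
by split; rewrite /= in_itv/= -ler_norml ltW.
Qed.

Lemma to_coord_nm z w : `|(to_coord w).1 - (to_coord z).1| <= nm (w - z) /\
  `|(to_coord w).2 - (to_coord z).2| <= nm (w - z).
Proof.
by split; [have := Re_nm (w - z)|have := Im_nm (w - z)]; rewrite raddfB.
Qed.

Lemma ccont_axis h (b : bool) : ccont setT h -> forall p, {for p, continuous (axis b \o h \o @of_coord R)}.
Proof.
move=> ch p; apply/continuous2 => e e0.
have [d d0 H] := ch (of_coord p) I e e0.
exists (d / 2); first by rewrite divr_gt0.
move=> q q1 q2; rewrite /= -axisB (le_lt_trans (axis_nm _ _))// H//.
by rewrite (le_lt_trans (nm_ReIm _))//= [ltRHS]splitr ltrD.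
Qed.

(** In real coordinates [h_x = a + b] and [h_y = i (a - b)]; the boolean selects the imaginary or
    the real part of [h]. *)
Lemma cdf_rdiff h z a b (c : bool) : cdf h z a b ->
  rdiff (axis c \o h \o @of_coord R) (to_coord z)
    (axis c (a + b)) (if c then complex.Re a - complex.Re b else complex.Im b - complex.Im a).
Proof.
move=> ch e e0; have e2 : 0 < e / 2 by rewrite divr_gt0.
have [r r0 H] := ch _ e2; exists (r / 4); first by rewrite divr_gt0.
move=> q q1 q2; set w : C := of_coord q.
have wz : nm (w - z) <= 2 * Num.max `|q.1 - (to_coord z).1| `|q.2 - (to_coord z).2|.
  by rewrite (le_trans (nm_ReIm _))// mulr2n mulrDl mul1r raddfB raddfB lerD// le_max lexx ?orbT.
have wr : nm (w - z) < r.
  rewrite (le_lt_trans (nm_ReIm _))// !raddfB (le_lt_trans (lerD q1 q2))//; lra.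
rewrite [leRHS](_ : _ = e / 2 * (2 * Num.max `|q.1 - (to_coord z).1| `|q.2 - (to_coord z).2|)); last by field.
apply: le_trans (ler_wpM2l (ltW e2) wz); apply: le_trans (H _ wr); apply: le_trans (axis_nm c _).
rewrite le_eqVlt; apply/orP; left; apply/eqP; congr `| _ |; rewrite /= to_coordK -/w.
rewrite /w /of_coord; case: z a b (h z) (h (q.1 +i* q.2)) {ch H w wz wr q1 q2} => ? ? [? ?] [? ?] [? ?] [? ?].
by case: c; rewrite /axis/=; ring.
Qed.

(** With [A = Im h] and [B = Re h] the form [A dx + B dy] is the imaginary part of [h dz], and
    [B_x - A_y] is twice the real part of the dbar derivative; this is the factor 2 in [G]. *)
Lemma cgreen_re h g E D (L : R) : 0 < L ->
  ccont setT h -> (forall z, h z != 0 -> nm z < L) ->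
  cbdm setT g -> (forall z, D z -> nm z < L) -> (forall z, g z != 0 -> D z) ->
  grid_thin (@of_coord R @^-1` E) (- L) (- L) (2 * L) ->
  (forall z, ~ E z -> (exists a, cdf h z a (g z)) /\
     forall e : R, 0 < e -> exists2 r : R, 0 < r & forall w, nm (w - z) < r -> nm (g w - g z) < e) ->
  \int[mu2]_(p in @of_coord R @^-1` D) complex.Re (g (of_coord p)) = 0.
Proof.
move=> L0 ch hL bg DL gD thinE HE.
pose A := axis true \o h \o @of_coord R.
pose B := axis false \o h \o @of_coord R.
pose G (p : R * R) := 2 * complex.Re (g (of_coord p)).
have cA : forall p, {for p, continuous A} by exact: ccont_axis.
have cB : forall p, {for p, continuous B} by exact: ccont_axis.
have hs (p : R * R) : h (of_coord p) != 0 -> `|p.1| < L /\ `|p.2| < L.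
  by move=> /hL hp; split; apply: le_lt_trans hp;
    [exact: (Re_nm (of_coord p))|exact: (Im_nm (of_coord p))].
have sA (p : R * R) : A p != 0 -> `|p.1| < L /\ `|p.2| < L.
  by move=> Ap; apply: hs; apply: contra Ap => /eqP; rewrite /A /= => ->.
have sB (p : R * R) : B p != 0 -> `|p.1| < L /\ `|p.2| < L.
  by move=> Bp; apply: hs; apply: contra Bp => /eqP; rewrite /B /= => ->.
have uA := ucont_compact cA sA; have uB := ucont_compact cB sB.
have box (p : R * R) : `|p.1| < L /\ `|p.2| < L -> [/\ - L < p.1, p.1 < - L + 2 * L, - L < p.2 & p.2 < - L + 2 * L].
  by rewrite !ltr_norml => -[/andP[? ?] /andP[? ?]]; split; lra.
have [bg1 bg2] := bg.
have bG : bdm setT G by apply: bdmM; [exact: bdm_cst|exact: bg1].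
have [M HM] := bounded_compact_support cA sA; have [N HN] := bounded_compact_support cB sB.
have Ax c : bdm setT (fun x => A (x, c)).
  split; last by exists M => x _; exact: HM.
  apply: continuous_measurable_fun => x U /(cA (x, c))/nbhs2[r r0 rU].
  apply/nbhs_ballP; exists r => //= y xy; apply: rU; rewrite /= ?subrr ?normr0//.
  by rewrite distrC.
have By c : bdm setT (fun y => B (c, y)).
  split; last by exists N => x _; exact: HN.
  apply: continuous_measurable_fun => x U /(cB (c, x))/nbhs2[r r0 rU].
  apply/nbhs_ballP; exists r => //= y xy; apply: rU; rewrite /= ?subrr ?normr0//.
  by rewrite distrC.
have L20 : 0 < 2 * L by rewrite mulr_gt0.
have := @green_removable R A B G Ax By bG (@of_coord R @^-1` E) (- L) (- L) (2 * L) L20 uA uB.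
move=> /(_ _ _ _ thinE) H.
have G0 : \int[mu2]_(p in rect (- L) (- L + 2 * L) (- L) (- L + 2 * L)) G p = 0.
  apply: H.
  - by move=> p /sA/box.
  - by move=> p /sB/box.
  move=> p nE; have [[a ca] cg] := HE (of_coord p) nE; split.
    apply/continuous2 => e e0; have e2 : 0 < e / 2 by rewrite divr_gt0.
    have [r r0 Hr] := cg _ e2; exists (r / 2); first by rewrite divr_gt0.
    move=> q q1 q2; rewrite /G -mulrBr normrM ger0_norm// mulrC -ltr_pdivlMr//.
    rewrite -raddfB (le_lt_trans (Re_nm _))// Hr//.
    by rewrite (le_lt_trans (nm_ReIm _))//= [ltRHS]splitr ltrD.
  have r1 := cdf_rdiff true ca; have r2 := cdf_rdiff false ca.
  rewrite of_coordK in r1 r2.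
  do 4 eexists; split; [exact: r1|exact: r2|].
  by rewrite /G /axis raddfD/=; ring.
have Gint : \int[mu2]_(p in rect (- L) (- L + 2 * L) (- L) (- L + 2 * L)) complex.Re (g (of_coord p)) = 0.
  apply/eqP; rewrite -(mulrI_eq0 _ (mulfI (_ : 2 != 0 :> R)))// -RintegralZl ?G0//.
    exact: measurable_rect.
  apply: rect_integrable; exact: bg1.
rewrite -[RHS]Gint [LHS]Rintegral_mkcond [RHS]Rintegral_mkcond; apply: eq_Rintegral => p _.
rewrite /patch; case: ifPn => [|/negP nD].
  rewrite inE /= => /DL Dp; rewrite ifT// inE /rect/= !in_itv/=.
  have [|l1 l2 l3 l4] := box p; last by rewrite l1 l3 !ltW.
  by split; apply: le_lt_trans Dp; [exact: (Re_nm (of_coord p))|exact: (Im_nm (of_coord p))].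
case: ifP => // _; have -> : g (of_coord p) = 0; last by [].
by apply/eqP; apply: contra_notT nD => /gD Dp; rewrite inE.
Qed.

Lemma cgreen h g E D (L : R) : 0 < L ->
  ccont setT h -> (forall z, h z != 0 -> nm z < L) ->
  cbdm setT g -> (forall z, D z -> nm z < L) -> (forall z, g z != 0 -> D z) ->
  grid_thin (@of_coord R @^-1` E) (- L) (- L) (2 * L) ->
  (forall z, ~ E z -> (exists a, cdf h z a (g z)) /\
     forall e : R, 0 < e -> exists2 r : R, 0 < r & forall w, nm (w - z) < r -> nm (g w - g z) < e) ->
  plane_integral D g = 0.
Proof.
move=> L0 ch hL bg DL gD thinE HE.
have re := cgreen_re L0 ch hL bg DL gD thinE HE.
(* The imaginary part of [g] is the real part of [- i g], the dbar derivative of [- i h]. *)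
pose c : C := 0 -i* 1.
have nc : nm c = 1 by rewrite /nm/= expr0n/= add0r sqrrN expr1n sqrtr1.
have im : \int[mu2]_(p in @of_coord R @^-1` D) complex.Im (g (of_coord p)) = 0.
  rewrite -[RHS](@cgreen_re (fun z => c * h z) (fun z => c * g z) E D L) //.
  - apply: eq_Rintegral => p _; case: (g _) => x y /=; ring.
  - move=> z _ e e0; have [d d0 H] := ch z I e e0; exists d => // w _ wz.
    by rewrite -mulrBr nmM nc mul1r H.
  - by move=> z; rewrite mulf_eq0 negb_or => /andP[_ /hL].
  - exact: cbdmZ.
  - by move=> z; rewrite mulf_eq0 negb_or => /andP[_ /gD].
  move=> z /HE[[a ca] cg]; split; first by exists (c * a); exact: cdfZ.
  move=> e /cg[r r0 H]; exists r => // w /H.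
  by rewrite -mulrBr nmM nc mul1r.
by rewrite /plane_integral re im.
Qed.

End complex_green.

(** * Continuous and bounded functions on plane sets *)

Section preliminaries.
Variable R : realType.
Notation C := (R[i]^o).
Notation mu2 := (@plane_measure R).
Implicit Types (f g h phi : C -> C) (z w a b : C) (A B D E K : set C).

Definition cont_at f z := forall e : R, 0 < e -> exists2 r : R, 0 < r &
  forall w, nm (w - z) < r -> nm (f w - f z) < e.

Lemma ccont_sub A B f : A `<=` B -> ccont B f -> ccont A f.
Proof.
move=> AB cf z /AB Bz e e0; have [d d0 H] := cf z Bz e e0.
by exists d => // w /AB Bw; exact: H.
Qed.

Lemma ccont_eq A f g : (forall z, A z -> f z = g z) -> ccont A f -> ccont A g.
Proof.
move=> fg cf z Az e e0; have [d d0 H] := cf z Az e e0; exists d => // w Aw wz.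
rewrite -(fg _ Aw) -(fg _ Az); exact: H.
Qed.

Lemma ccont_at A f z : open A -> A z -> ccont A f -> cont_at f z.
Proof.
move=> /open_complexP oA Az cf e e0; have [d d0 H] := cf z Az e e0.
have [r r0 rA] := oA _ Az; exists (Num.min d r); first by rewrite lt_min d0.
by move=> w; rewrite lt_min => /andP[wd wr]; apply: H => //; exact: rA.
Qed.

Lemma cont_at_ccont A f : (forall z, A z -> cont_at f z) -> ccont A f.
Proof.
by move=> H z Az e e0; have [r r0 rH] := H z Az e e0; exists r => // w _; exact: rH.
Qed.

Lemma cont_at_near f g z (r : R) : 0 < r -> (forall w, nm (w - z) < r -> f w = g w) ->
  cont_at f z -> cont_at g z.
Proof.
move=> r0 fg cf e e0; have [d d0 H] := cf e e0.
exists (Num.min r d); first by rewrite lt_min r0.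
by move=> w; rewrite lt_min => /andP[wr wd]; rewrite -!fg ?H// subrr nm0.
Qed.

Lemma cdf_cont_at f z a b : cdf f z a b -> cont_at f z.
Proof. exact: cdf_continuous. Qed.

Lemma cont_at_cst z c : cont_at (fun=> c) z.
Proof. by move=> e e0; exists 1 => // w _; rewrite subrr nm0. Qed.

Lemma cont_atD f g z : cont_at f z -> cont_at g z -> cont_at (fun w => f w + g w) z.
Proof.
move=> cf cg e e0; have e2 : 0 < e / 2 by rewrite divr_gt0.
have [d d0 H] := cf _ e2; have [d' d'0 H'] := cg _ e2.
exists (Num.min d d'); first by rewrite lt_min d0.
move=> w; rewrite lt_min => /andP[/H h1 /H' h2].
by rewrite opprD addrACA (le_lt_trans (nmD _ _))// [ltRHS]splitr ltrD.
Qed.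

Lemma prod_close (x y x0 y0 : C) (d : R) : d <= 1 -> nm (x - x0) < d -> nm (y - y0) < d ->
  nm (x * y - x0 * y0) <= d * (nm x0 + nm y0 + 1).
Proof.
move=> d1 hx hy.
have -> : x * y - x0 * y0 = (x - x0) * y0 + x0 * (y - y0) + (x - x0) * (y - y0) by ring.
rewrite [leRHS](_ : _ = d * nm y0 + nm x0 * d + d); last by ring.
apply: le_trans (nmD _ _) _; apply: lerD.
  apply: le_trans (nmD _ _) _; rewrite !nmM; apply: lerD.
    by apply: ler_wpM2r; [exact: nm_ge0|exact: ltW].
  by apply: ler_wpM2l; [exact: nm_ge0|exact: ltW].
rewrite nmM -[leRHS]mulr1; apply: ler_pM (nm_ge0 _) (nm_ge0 _) (ltW hx) _.
exact: le_trans (ltW hy) d1.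
Qed.

Lemma small_prod (e A : R) : 0 < e -> 0 <= A ->
  exists2 d : R, 0 < d /\ d <= 1 & d * A < e.
Proof.
move=> e0 A0; exists (Num.min 1 (e / (A + 1))).
  by rewrite lt_min ltr01 divr_gt0 ?ltr_wpDl//= ge_min lexx.
have A1 : 0 < A + 1 by rewrite ltr_wpDl.
apply: (@le_lt_trans _ _ (e / (A + 1) * A)).
  by rewrite ler_wpM2r// ge_min lexx orbT.
by rewrite mulrAC ltr_pdivrMr// ltr_pM2l// ltrDl.
Qed.

Lemma ccontM A f g : ccont A f -> ccont A g -> ccont A (fun w => f w * g w).
Proof.
move=> cf cg z Az e e0.
have [|d [d0 d1] de] := @small_prod e (nm (f z) + nm (g z) + 1) e0.
  by rewrite !addr_ge0 ?nm_ge0.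
have [r r0 H] := cf z Az d d0; have [s s0 H'] := cg z Az d d0.
exists (Num.min r s); first by rewrite lt_min r0.
move=> w Aw; rewrite lt_min => /andP[/(H _ Aw) h1 /(H' _ Aw) h2].
by rewrite (le_lt_trans _ de)// prod_close.
Qed.

Lemma ccontD A f g : ccont A f -> ccont A g -> ccont A (fun w => f w + g w).
Proof.
move=> cf cg z Az e e0; have e2 : 0 < e / 2 by rewrite divr_gt0.
have [d d0 H] := cf _ Az _ e2; have [d' d'0 H'] := cg _ Az _ e2.
exists (Num.min d d'); first by rewrite lt_min d0.
move=> w Aw; rewrite lt_min => /andP[/(H _ Aw) h1 /(H' _ Aw) h2].
by rewrite opprD addrACA (le_lt_trans (nmD _ _))// [ltRHS]splitr ltrD.
Qed.

Lemma ccont_cst A c : ccont A (fun=> c).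
Proof. by apply: cont_at_ccont => z _; exact: cont_at_cst. Qed.

Lemma ccont_conj A : ccont A (@conjc R).
Proof. by move=> z _ e e0; exists e => // w _; rewrite -rmorphB nm_conj. Qed.

Lemma cont_atM f g z : cont_at f z -> cont_at g z -> cont_at (fun w => f w * g w) z.
Proof.
move=> cf cg e e0.
have [|d [d0 d1] de] := @small_prod e (nm (f z) + nm (g z) + 1) e0.
  by rewrite !addr_ge0 ?nm_ge0.
have [r r0 H] := cf d d0; have [s s0 H'] := cg d d0.
exists (Num.min r s); first by rewrite lt_min r0.
move=> w; rewrite lt_min => /andP[/H h1 /H' h2].
by rewrite (le_lt_trans _ de)// prod_close.
Qed.

Lemma ccont_paste A B f : closed A -> closed B -> ccont A f -> ccont B f -> ccont (A `|` B) f.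
Proof.
move=> cA cB fA fB z ABz e e0.
have H X : closed X -> ccont X f -> exists2 d : R, 0 < d & forall w, X w -> nm (w - z) < d -> nm (f w - f z) < e.
  move=> cX fX; have [Xz|nXz] := pselect (X z); first exact: fX.
  have /open_complexP/(_ z nXz)[r r0 rX] := closed_openC cX.
  by exists r => // w Xw /rX.
have [d d0 Hd] := H A cA fA; have [d' d'0 Hd'] := H B cB fB.
exists (Num.min d d'); first by rewrite lt_min d0.
by move=> w [Aw|Bw]; rewrite lt_min => /andP[wd wd']; [exact: Hd|exact: Hd'].
Qed.

Lemma ccont_bounded K f : compact K -> ccont K f -> exists2 M : R, 0 < M & forall z, K z -> nm (f z) <= M.
Proof.
move=> cK /ccontP cf; have [M M0 HM] := compact_boundedC (continuous_compact cf cK).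
by exists M => // z Kz; apply: HM; exists z.
Qed.

Lemma cbdm_cont D f (M : R) : open D -> (forall z, D z -> cont_at f z) ->
  (forall z, D z -> nm (f z) <= M) -> cbdm D f.
Proof.
move=> oD cf fM; have oW := open_of_coord oD.
have ca (b : bool) : forall p, (@of_coord R @^-1` D) p ->
    {for p, continuous (axis b \o f \o @of_coord R)}.
  move=> p Dp; apply/continuous2 => e e0.
  have [d d0 H] := cf _ Dp e e0; exists (d / 2); first by rewrite divr_gt0.
  move=> q q1 q2; rewrite /= -axisB (le_lt_trans (axis_nm _ _))// H//.
  by rewrite (le_lt_trans (nm_ReIm _))//= [ltRHS]splitr ltrD.
split; split.
- exact: continuous_measurable2 oW (ca false).
- by exists M => p Dp; rewrite (le_trans (Re_nm _))// fM.
- exact: continuous_measurable2 oW (ca true).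
- by exists M => p Dp; rewrite (le_trans (Im_nm _))// fM.
Qed.

Lemma open_bounded_finite_area D (M : R) : open D -> (forall z, D z -> nm z <= M) -> finite_area D.
Proof.
move=> oD DM; have mD := open_measurable2 (open_of_coord oD); split=> //.
apply: le_lt_trans (@rect_finite R (- (M + 1)) (M + 1) (- (M + 1)) (M + 1)).
apply: le_measure; rewrite ?inE//; first exact: measurable_rect.
move=> p /DM pM; have h1 := le_trans (Re_nm (of_coord p)) pM; have h2 := le_trans (Im_nm (of_coord p)) pM.
by split; rewrite /= in_itv/=; [move: h1|move: h2]; rewrite /= ler_norml => /andP[? ?]; apply/andP; split; lra.
Qed.

Lemma cbdm_extend D f : measurable (@of_coord R @^-1` D) -> (forall z, ~ D z -> f z = 0) ->
  cbdm D f -> cbdm setT f.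
Proof.
move=> mD f0 [[m1 [M1 b1]] [m2 [M2 b2]]].
have ext (u : R * R -> R) (M : R) : (forall p, ~ D (of_coord p) -> u p = 0) ->
    measurable_fun (@of_coord R @^-1` D) u -> (forall p, D (of_coord p) -> `|u p| <= M) ->
    bdm (@of_coord R @^-1` [set: C]) u.
  move=> u0 mu uM; split; last first.
    exists (Num.max 0 M) => p _; have [Dp|Dp] := pselect (D (of_coord p)).
      by rewrite le_max uM ?orbT.
    by rewrite u0// normr0 le_max lexx.
  rewrite preimage_setT.
  have -> : u = u \_ (@of_coord R @^-1` D).
    apply/funext => p; rewrite /patch; case: ifPn => // /negP nD; rewrite u0//.
    by move=> Dp; apply: nD; rewrite inE.
  by apply/(measurable_restrictT u mD).
by split; [apply: (ext _ M1)|apply: (ext _ M2)] => // p nD; rewrite /= f0.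
Qed.

Lemma dbar_local (u : R * R -> R) z (c r : R) : 0 < r ->
  (forall w, nm (w - z) < r -> u (to_coord w) = c) -> dbar u z = 0.
Proof.
move=> r0 uc.
have near_c : \forall p \near to_coord z, u p = cst c p.
  apply/nbhs2; exists (r / 2); first by rewrite divr_gt0.
  move=> q q1 q2; rewrite -(of_coordK q); apply: uc.
  by rewrite (le_lt_trans (nm_ReIm _))// !raddfB /= [ltRHS]splitr ltrD.
by rewrite /dbar !(near_eq_derive _ near_c) !derive_cst mul0r.
Qed.

Lemma dbar_cont (u : R * R -> R) z : ub 1 setT (fun _ : unit => u) -> cont_at (dbar u) z.
Proof.
move=> [_ _ [_ H]] e e0.
have cD (b : bool) p : {for p, continuous ('D_(dir R b) u)} by have [_ /(_ tt p I)] := H b.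
have /continuous2/(_ _ e0)[r r0 Hr] := cD false (to_coord z).
have /continuous2/(_ _ e0)[s s0 Hs] := cD true (to_coord z).
exists (Num.min r s); first by rewrite lt_min r0.
move=> w; rewrite lt_min => /andP[wr ws]; have [w1 w2] := to_coord_nm z w.
rewrite (le_lt_trans (nm_ReIm _))// !raddfB /= -!mulrBl !normrM.
rewrite !(@ger0_norm _ 2^-1)// -mulrDl ltr_pdivrMr// mulr2n mulrDr mulr1 ltrD//.
  by apply: Hr; [exact: le_lt_trans wr|exact: le_lt_trans wr].
by apply: Hs; [exact: le_lt_trans ws|exact: le_lt_trans ws].
Qed.

Lemma dbar_bounded (u : R * R -> R) : ub 1 setT (fun _ : unit => u) ->
  exists2 M : R, 0 < M & forall z, nm (dbar u z) <= M.
Proof.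
move=> [_ _ [_ H]]; have [[M HM] _ _] := H false; have [[N HN] _ _] := H true.
exists (`|M| + `|N| + 1); first by rewrite ltr_wpDl// addr_ge0.
move=> z; rewrite (le_trans (nm_ReIm _))// /dbar/= !normrM !(@ger0_norm _ 2^-1)//.
have h1 := le_trans (HM tt (to_coord z) I) (ler_norm M).
have h2 := le_trans (HN tt (to_coord z) I) (ler_norm N).
by move: h1 h2 (normr_ge0 M) (normr_ge0 N); clear; lra.
Qed.

Lemma test_cont phi z : test_function phi -> cont_at phi z.
Proof.
move=> [s1 s2 _] e e0; have e2 : 0 < e / 2 by rewrite divr_gt0.
have /continuous2/(_ _ e2)[r r0 Hr] := (s1 [::]).1 (to_coord z).
have /continuous2/(_ _ e2)[s s0 Hs] := (s2 [::]).1 (to_coord z).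
exists (Num.min r s); first by rewrite lt_min r0.
move=> w; rewrite lt_min => /andP[wr ws]; have [w1 w2] := to_coord_nm z w.
rewrite (le_lt_trans (nm_ReIm _))// !raddfB /= [ltRHS]splitr ltrD//.
  have := Hr (to_coord w); rewrite /= !to_coordK; apply; exact: le_lt_trans wr.
have := Hs (to_coord w); rewrite /= !to_coordK; apply; exact: le_lt_trans ws.
Qed.

Lemma test_bounded phi : test_function phi -> exists2 M : R, 0 < M & forall z, nm (phi z) <= M.
Proof.
move=> tf; have [_ _ cs] := tf.
have [|M M0 HM] := @ccont_bounded _ phi cs.
  by apply: cont_at_ccont => z _; exact: test_cont.
exists M => // z; have [sz|sz] := pselect (supp phi z); first exact: HM.
by rewrite (notin_supp sz) nm0 ltW.
Qed.

End preliminaries.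

(** * From the Schwarz function to the distribution *)

Section densities.
Variable R : realType.
Notation C := (R[i]^o).
Notation mu2 := (@plane_measure R).
Implicit Types (f g h phi : C -> C) (z w a b : C) (A B D E K : set C).

(** Used wherever an integral must be seen to be positive: for the support of a density and for the
    mass of the smoothed kernel. *)
Lemma Rintegral_ge_rect (W : set (R * R)) (u : R * R -> R) (x y r k : R) :
  measurable W -> (mu2 W < +oo)%E -> bdm W u -> 0 <= r ->
  (forall p, W p -> 0 <= u p) -> rect x (x + r) y (y + r) `<=` W ->
  (forall p, rect x (x + r) y (y + r) p -> k <= u p) ->
  k * (r * r) <= \int[mu2]_(p in W) u p.
Proof.
move=> mW fW bu r0 u0 QW uk.
have mQ := @measurable_rect R x (x + r) y (y + r).
have mWQ : measurable (W `\` rect x (x + r) y (y + r)) by exact: measurableD.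
have E : W = rect x (x + r) y (y + r) `|` (W `\` rect x (x + r) y (y + r)).
  by rewrite setDUK.
rewrite [in leRHS]E Rintegral_setU//; last 2 first.
- by rewrite -E; exact: bdm_integrable2.
- by apply/disj_setPS => p [Qp [_ nQp]].
rewrite -[leLHS]addr0 lerD//; last by apply: Rintegral_ge0 => // p [Wp _]; exact: u0.
have fQ := @rect_finite R x (x + r) y (y + r).
have -> : k * (r * r) = \int[mu2]_(p in rect x (x + r) y (y + r)) k.
  rewrite Rintegral_cst//; have xr : x <= x + r by rewrite lerDl.
  have yr : y <= y + r by rewrite lerDl.
  rewrite [X in fine X](mu2_rect xr yr).
  by congr (_ * (_ * _)); ring.
apply: le_Rintegral => //; [exact: bdm_integrable2 mQ fQ (bdm_cst _ _)|].
by apply: bdm_integrable2 => //; exact: bdm_sub bu.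
Qed.

Definition density D g : (C -> C) -> C := fun phi => plane_integral D (fun z => g z * phi z).

Lemma cbdm_density D g phi (L M : R) : open D -> (forall z, D z -> cont_at g z) ->
  (forall z, D z -> nm (g z) <= M) -> test_function phi -> cbdm D (fun z => g z * phi z).
Proof.
move=> oD cg gM tphi; have [N N0 phiN] := test_bounded tphi.
apply: cbdmM; [exact: cbdm_cont gM|apply: (@cbdm_cont _ D phi N oD)] => z _.
  exact: test_cont.
exact: phiN.
Qed.

Lemma density_distribution D g (L M : R) : open D -> (forall z, D z -> nm z <= L) ->
  (forall z, D z -> cont_at g z) -> (forall z, D z -> nm (g z) <= M) ->
  plane_distribution (density D g).
Proof.
move=> oD DL cg gM; have fD := open_bounded_finite_area oD DL.
have bg := cbdm_density M oD cg gM.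
split=> [a phi psi tphi tpsi|K _].
  have := plane_integralD fD (cbdmZ a (bg _ tphi)) (bg _ tpsi).
  rewrite (plane_integralZ a fD (bg _ tphi)) => <-.
  by apply: eq_plane_integral => z _; ring.
(* A bounded density is a distribution of order 0. *)
exists 0%N, (2 * M * area D) => phi N tphi _ phiN.
have hN z : nm (phi z) <= N.
  have := phiN [::] (to_coord z) isT; rewrite normE lecR /cpartial/= to_coordK.
  by rewrite -complexE.
rewrite normE lecR [leRHS](_ : _ = 2 * (M * N) * area D); last by ring.
apply: plane_integral_bound => //; first exact: bg.
by move=> z Dz; rewrite nmM ler_pM ?nm_ge0 ?gM.
Qed.

Lemma plane_integral_Re D f : complex.Re (plane_integral D f) =
  \int[mu2]_(p in @of_coord R @^-1` D) complex.Re (f (of_coord p)).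
Proof. by []. Qed.

(* Test against a bump on which [g] stays close to [g z]. *)
Lemma density_supp D g z (L M : R) : open D -> (forall z, D z -> nm z <= L) ->
  (forall z, D z -> cont_at g z) -> (forall z, D z -> nm (g z) <= M) ->
  D z -> g z != 0 -> distribution_supp (density D g) z.
Proof.
move=> oD DL cg gM Dz gz [U [oU Uz H]]; have fD := open_bounded_finite_area oD DL.
have n0 : 0 < nm (g z) by rewrite nm_gt0.
have n2 : 0 < nm (g z) / 2 by rewrite divr_gt0.
have [r1 r10 H1] := cg z Dz _ n2.
have /open_complexP/(_ z (conj Uz Dz))[r2 r20 H2] := openI oU oD.
(* The bump lives where both coordinates are within [2 * r], hence in the disc of radius [4 * r],
   strictly inside both neighbourhoods. *)
pose r : R := Num.min r1 r2 / 5; have r0 : 0 < r by rewrite divr_gt0// lt_min r10.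
have r5 : 5 * r <= r1 /\ 5 * r <= r2.
  by rewrite /r mulrCA divff ?mulr1// ge_min lexx/= ge_min lexx orbT.
pose u := bump r (to_coord z).
have hu n : ub n setT (fun _ : unit => u) by apply: ub_bump; exact: openT.
have near w : toC u w != 0 -> nm (w - z) <= 4 * r.
  rewrite /toC => h; have : u (to_coord w) != 0 by apply: contra h => /eqP ->.
  move=> /(bump_supp r0)[h1 h2]; rewrite (le_trans (nm_ReIm _))// !raddfB.
  by move: h1 h2; rewrite /=; lra.
have sb : supp (toC u) `<=` [set w | nm (w - z) <= 4 * r].
  apply: supp_sub => // w.
  move=> /closure_complexP h; apply/ler_addgt0Pr => e e0.
  have [v vz vw] := h _ e0; rewrite (le_trans (nm_triB _ v _))// addrC lerD//.
  by rewrite nm_distC ltW.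
have tu : test_function (toC u).
  apply: toC_test => //; apply: (subclosed_compact (@closed_closure _ _) (@cbox_compact _ z (4 * r))).
  by move=> w /sb h; split; rewrite -raddfB (le_trans _ h)// (Re_nm, Im_nm).
have sU : supp (toC u) `<=` U.
  by move=> w /sb h; have [] := H2 w _ => //; apply: le_lt_trans h _; case: r5; lra.
(* After multiplication by [conjc (g z)] the real part of the integrand is nonnegative, and near [z]
   it is at least [nm (g z) ^+ 2 / 2] times the bump. *)
have := H _ tu sU; rewrite /density => /(congr1 (fun w => complex.Re (conjc (g z) * w))).
have bg := cbdm_density M oD cg gM tu.
rewrite -plane_integralZ// mulr0 plane_integral_Re => I0.
have lower w : nm (w - z) < r1 -> nm (g z) ^+ 2 / 2 <= complex.Re (conjc (g z) * g w).
  move=> /H1 h.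
  have -> : conjc (g z) * g w = (nm (g z) ^+ 2)%:C + conjc (g z) * (g w - g z).
    rewrite nm_sqr; case: (g z) (g w) => a b [c d].
    by apply/eqP; rewrite eq_complex/=; apply/andP; split; apply/eqP; ring.
  have : `|complex.Re (conjc (g z) * (g w - g z))| <= nm (g z) * (nm (g z) / 2).
    by rewrite (le_trans (Re_nm _))// nmM nm_conj ler_wpM2l ?nm_ge0// ltW.
  rewrite raddfD/= ler_norml => /andP[h1 _].
  by move: h1; move: (complex.Re (_ * (_ - _))) => t; rewrite expr2; lra.
have E w : complex.Re (conjc (g z) * (g w * toC u w)) = complex.Re (conjc (g z) * g w) * u (to_coord w).
  rewrite mulrA /toC; case: (conjc (g z) * g w) => a b.
  by rewrite /= mulr0 subr0.
have far w : r1 <= nm (w - z) -> u (to_coord w) = 0.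
  move=> h; apply/eqP/negP => /negP h'.
  have : toC u w != 0 by rewrite /toC; apply: contra h' => /eqP/complexI ->.
  by move=> /near h2; case: r5; move: h h2 r0; lra.
have [] : ~ (nm (g z) ^+ 2 / 2 * (r * r) <= 0).
  apply/negP; rewrite -ltNge; apply: mulr_gt0; last exact: mulr_gt0.
  by apply: divr_gt0 => //; apply: exprn_gt0.
rewrite -[leRHS]I0.
(* On the square of side [r] with lower left corner [z] the bump equals 1, so the integral is
   positive although it was assumed to be 0. *)
apply: (@Rintegral_ge_rect _ _ (complex.Re z) (complex.Im z)) => //.
- exact: fD.1.
- exact: fD.2.
- exact: (cbdmZ _ bg).1.
- exact: ltW.
- move=> p _; rewrite E; have [/lower h|/far ->] := ltP (nm (of_coord p - z)) r1; last by rewrite mulr0.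
  by rewrite mulr_ge0 ?bump_ge0// (le_trans _ h)// mulr_ge0// sqr_ge0.
- move=> p [/=]; rewrite !in_itv/= => /andP[p1 p2] /andP[p3 p4].
  apply: (H2 _ _).2; rewrite (le_lt_trans (nm_ReIm _))// !raddfB/=.
  rewrite !ger0_norm ?subr_ge0 ?ltW//; case: r5; move: p2 p4 r0; lra.
- move=> p [/=]; rewrite !in_itv/= => /andP[p1 p2] /andP[p3 p4].
  have pr1 : nm (of_coord p - z) < r1.
    rewrite (le_lt_trans (nm_ReIm _))// !raddfB/=.
    rewrite !ger0_norm ?subr_ge0 ?ltW//; case: r5; move: p2 p4 r0; lra.
  rewrite E of_coordK /u bump1//=; first by rewrite mulr1 lower.
    by rewrite ger0_norm ?subr_ge0 ?(ltW p1)//; move: p2; lra.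
  by rewrite ger0_norm ?subr_ge0 ?(ltW p3)//; move: p4; lra.
Qed.

End densities.

Section schwarz_to_quadrature.
Variable R : realType.
Notation C := (R[i]^o).
Notation mu2 := (@plane_measure R).
Implicit Types (f g h phi S : C -> C) (z w a : C) (A D E K U O : set C) (u : R * R -> R).

Lemma frontierE D z : open D -> frontier D z <-> closure D z /\ ~ D z.
Proof. by move=> oD; rewrite /frontier; move/interior_id: oD => ->. Qed.

Lemma disjoint_closure_notin D O z : open O -> D `&` O = set0 -> O z -> ~ closure D z.
Proof.
move=> oO DO Oz Dz; have := open_disjoint_closure oO DO; rewrite -subset0.
by move=> /(_ z (conj Dz Oz)).
Qed.

Lemma closures_frontiers D O z : open D -> open O -> D `&` O = set0 ->
  closure D z -> closure O z -> (frontier D `&` frontier O) z.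
Proof.
move=> oD oO DO Dz Oz; split; apply/frontierE => //; split=> // h.
  by apply: (@disjoint_closure_notin O D z) Oz => //; rewrite setIC.
exact: (@disjoint_closure_notin D O z) Dz.
Qed.

Lemma plane_integral0 D f : (forall z, D z -> f z = 0) -> plane_integral D f = 0.
Proof.
move=> f0; rewrite (@eq_plane_integral _ D f (fun=> 0))//.
by rewrite /plane_integral /Rintegral/= !integral0.
Qed.

Lemma distribution_supp_closed (mu : (C -> C) -> C) : closed (distribution_supp mu).
Proof.
rewrite closedC; apply/open_complexP => z [U [oU Uz HU]].
move: (oU) => /open_complexP/(_ z Uz)[r r0 rU]; exists r => // w /rU Uw.
by exists U; split.
Qed.

Lemma dbar_notin_supp u z : ~ supp (toC u) z -> dbar u z = 0.
Proof.
move=> nz; have /open_complexP/(_ z nz)[r r0 rU] := closed_openC (@closed_closure _ [set z | toC u z != 0]).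
by apply: (@dbar_local _ u z 0 r r0) => w /rU/notin_supp/complexI.
Qed.

(** Where [S] may fail to be analytic the factor [1 - toC u] vanishes on a neighbourhood; elsewhere
    the product rule applies. *)
Lemma cut_cdf A K U S u z : open A -> K `<=` U -> open U ->
  (forall w, U w -> u (to_coord w) = 1) -> (forall n, ub n setT (fun _ : unit => u)) ->
  analytic_in (A `\` K) S -> A z ->
  exists a, cdf (fun w => S w * (1 - toC u w)) z a (- (S z * dbar u z)).
Proof.
move=> oA KU oU U1 uu aS Az.
have [Uz|nUz] := pselect (U z).
  have /open_complexP/(_ z Uz)[r r0 rU] := oU.
  exists 0; rewrite (@dbar_local _ u z 1 r r0) ?mulr0 ?oppr0; last first.
    by move=> w /rU; exact: U1.
  apply: (@cdf_near _ (fun=> 0) _ _ _ _ r r0) => [w /rU/U1 uw|]; last exact: cdf_cst.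
  by rewrite /toC uw subrr mulr0.
have [a aS'] : exists a, cdf S z a 0 by apply/derivable_cdf/aS; split=> // /KU.
have := cdfM aS' (cdfD (cdf_cst z 1) (cdfZ (-1) (ub_cdf z (uu 1%N)))).
rewrite [X in cdf _ _ _ X](_ : _ = - (S z * dbar u z)); last by ring.
move=> H; eexists.
apply: cdf_near ltr01 _ H => w _ ; by rewrite mulN1r.
Qed.

Lemma ccont_toC A u : (forall n, ub n setT (fun _ : unit => u)) -> ccont A (toC u).
Proof. by move=> uu; apply: cont_at_ccont => z _; exact: cdf_cont_at (ub_cdf z (uu 1%N)). Qed.

Variables (bp bm : R) (Dp Dm : set C).
Hypotheses (oDp : open Dp) (oDm : open Dm).
Hypothesis (dis : Dp `&` Dm = set0).
Hypotheses (C1p : piecewise_C1_boundary Dp) (C1m : piecewise_C1_boundary Dm).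
Variables (Sp Sm : C -> C) (Cp Cm : set C).
Hypotheses (cSp : ccont (closure Dp) Sp) (aSp : analytic_in (Dp `\` Cp) Sp).
Hypotheses (cSm : ccont (closure Dm) Sm) (aSm : analytic_in (Dm `\` Cm) Sm).
Hypotheses (bSp : forall z, (frontier Dp `\` (frontier Dp `&` frontier Dm)) z -> Sp z = bp%:C * conjc z).
Hypotheses (bSm : forall z, (frontier Dm `\` (frontier Dp `&` frontier Dm)) z -> Sm z = - (bm%:C * conjc z)).
Hypothesis (bS : forall z, (frontier Dp `&` frontier Dm) z -> Sp z - Sm z = (bp + bm)%:C * conjc z).

Local Notation D := (Dp `|` Dm).
Local Notation ext := (~` (closure Dp `|` closure Dm)).

Variable u : R * R -> R.
Hypothesis (uu : forall n, ub n setT (fun _ : unit => u)) (uD : supp (toC u) `<=` D).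
Variable U : set C.
Hypotheses (oU : open U) (KU : Cp `|` Cm `<=` U) (U1 : forall z, U z -> u (to_coord z) = 1).

Let Vp w := Sp w * (1 - toC u w) - bp%:C * conjc w.
Let Vm w := Sm w * (1 - toC u w) + bm%:C * conjc w.
Let V w := if `[< closure Dp w >] then Vp w else if `[< closure Dm w >] then Vm w else 0.
Definition cut_density w : C := if `[< Dp w >] then - (Sp w * dbar u w) else
           if `[< Dm w >] then - (Sm w * dbar u w) else 0.

Let nDD z : Dp z -> Dm z -> False.
Proof. by move=> h1 h2; have : (Dp `&` Dm) z by []; rewrite dis. Qed.

Let oD : open D. Proof. exact: openU. Qed.

Let oext : open ext.
Proof. by apply/closed_openC/closedU; exact: closed_closure. Qed.

Let toC_frontier z : frontier Dp z \/ frontier Dm z -> toC u z = 0.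
Proof.
move=> h; apply: notin_supp => /uD[Dz|Dz]; case: h => /frontierE[]//.
  by move=> cz _; apply: (@disjoint_closure_notin Dm Dp z) cz => //; rewrite setIC.
by move=> cz _; exact: (@disjoint_closure_notin Dp Dm z) cz.
Qed.

Let VpE z : closure Dp z -> V z = Vp z.
Proof. by rewrite /V; case: asboolP. Qed.

Let VmE z : closure Dm z -> V z = Vm z.
Proof.
rewrite /V; case: asboolP => [pz mz|_]; last by case: asboolP.
(* On the common boundary the cutoff is 0, and the jump condition on [Sp - Sm] says exactly that
   [Vp] and [Vm] agree. *)
have G := closures_frontiers oDp oDm dis pz mz.
rewrite /Vp /Vm toC_frontier; last by left; exact: G.1.
rewrite subr0 !mulr1; apply/eqP; rewrite -subr_eq0; apply/eqP.
have E : (bp + bm)%:C = bp%:C + bm%:C :> C by rewrite rmorphD.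
have := bS G; rewrite E => h.
by rewrite -(subrK (Sm z) (Sp z)) h; ring.
Qed.

Let V_sym z : ((frontier Dp `|` frontier Dm) `\` (frontier Dp `&` frontier Dm)) z -> V z = 0.
Proof.
move=> [F nG]; have X := toC_frontier F; case: F => F.
  rewrite VpE; last by case: F.
  by rewrite /Vp X subr0 mulr1 bSp ?subrr.
rewrite VmE; last by case: F.
by rewrite /Vm X subr0 mulr1 bSm ?addNr.
Qed.

Let ccont_V : ccont (closure Dp) V /\ ccont (closure Dm) V.
Proof.
have c1 A : ccont A (fun w => 1 - toC u w).
  have H := ccontD (@ccont_cst R A 1) (ccontM (@ccont_cst R A (-1)) (@ccont_toC A u uu)).
  by apply: ccont_eq H => z _; rewrite mulN1r.
have c2 A (c : C) : ccont A (fun w => c * conjc w) by exact: ccontM (@ccont_cst R A c) (@ccont_conj R A).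
split.
  apply: ccont_eq (ccontD (ccontM cSp (c1 _)) (c2 _ (- bp%:C))) => z /VpE ->.
  by rewrite mulNr.
by apply: ccont_eq (ccontD (ccontM cSm (c1 _)) (c2 _ bm%:C)) => z /VmE ->.
Qed.

Let V_ext z : closure ext z -> V z = 0.
Proof.
move=> Ez; have [cz|ncz] := pselect ((closure Dp `|` closure Dm) z); last first.
  rewrite /V; case: asboolP => [h|_]; first by case: ncz; left.
  by case: asboolP => // h; case: ncz; right.
have Fz : (frontier Dp `|` frontier Dm) z.
  have nD A : open A -> A `<=` closure Dp `|` closure Dm -> ~ A z.
    by move=> oA AD Az; have [w + Aw] := closure_meets Ez oA Az; case; exact: AD.
  case: cz => cz; [left|right]; apply/frontierE => //; split=> //.
    by apply: nD => // w h; left; exact: subset_closure.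
  by apply: nD => // w h; right; exact: subset_closure.
have [G|nG] := pselect ((frontier Dp `&` frontier Dm) z); last exact: V_sym.
(* At such a point of Gamma, [Vp] and [Vm] agree but are not visibly 0. The value 0 is inherited by
   continuity from nearby boundary points outside Gamma. *)
have /closure_complexP H := exterior_touch oDp oDm dis C1p G Ez.
apply/eqP; rewrite -nm_eq0 eq_le nm_ge0 andbT; apply/ler_addgt0Pr => e e0; rewrite add0r.
have [d d0 Hd] := ccont_paste (@closed_closure _ _) (@closed_closure _ _) ccont_V.1 ccont_V.2 cz e0.
have [w Fw wz] := H d d0; have := Hd w; rewrite (V_sym Fw) sub0r nmN => h; apply/ltW/h; last exact: wz.
by case: Fw => -[[Fw _]|[Fw _]] _; [left|right].
Qed.

Variables (M : R).
Hypotheses (M0 : 0 < M) (DM : forall z, D z -> nm z <= M).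

Let closure_M z : closure Dp z \/ closure Dm z -> nm z <= M.
Proof.
have H A : A `<=` D -> closure A z -> nm z <= M.
  move=> AD /closure_complexP h; apply/ler_addgt0Pr => e /h[w /AD/DM wM wz].
  rewrite -(subrK w z) (le_trans (nmD _ _))// addrC lerD//.
  by rewrite nm_distC ltW.
by case; apply: H => w; [left|right].
Qed.

Let compact_closures : compact (closure Dp) /\ compact (closure Dm).
Proof.
by split; apply: (@bounded_closed_compact _ _ M) (@closed_closure _ _) _ => z h;
  apply: closure_M; [left|right].
Qed.

Let gp z : Dp z -> cut_density z = - (Sp z * dbar u z).
Proof. by rewrite /cut_density; case: asboolP. Qed.

Let gm z : Dm z -> cut_density z = - (Sm z * dbar u z).
Proof.
by move=> mz; rewrite /cut_density; case: asboolP => [pz|_]; [case: (nDD pz mz)|case: asboolP].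
Qed.

Let near_open A f1 f2 z : open A -> A z -> (forall w, A w -> f1 w = f2 w) ->
  cont_at f1 z -> cont_at f2 z.
Proof.
move=> /open_complexP oA /oA[r r0 rA] E; apply: (@cont_at_near _ _ _ _ r r0) => w /rA.
exact: E.
Qed.

Let cont_at_N f z : cont_at f z -> cont_at (fun w => - f w) z.
Proof.
move=> cf; have := cont_atM (cont_at_cst z (-1)) cf.
by apply: cont_at_near ltr01 _ => w _; rewrite mulN1r.
Qed.

Let ccont_open A S z : open A -> A z -> ccont (closure A) S -> cont_at S z.
Proof. by move=> oA Az cS; apply: ccont_at Az _ => //; apply: ccont_sub cS; exact: subset_closure. Qed.

Lemma cut_density_cont z : D z -> cont_at cut_density z.
Proof.
move=> [pz|mz].
  apply: (@near_open Dp (fun w => - (Sp w * dbar u w)) _ _ oDp pz) => [w /gp//|]; apply: cont_at_N.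
  apply: cont_atM; [exact: ccont_open cSp|exact: dbar_cont (uu 1%N)].
apply: (@near_open Dm (fun w => - (Sm w * dbar u w)) _ _ oDm mz) => [w /gm//|]; apply: cont_at_N.
apply: cont_atM; [exact: ccont_open cSm|exact: dbar_cont (uu 1%N)].
Qed.

Lemma cut_density_bounded : exists2 N : R, 0 < N & forall z, nm (cut_density z) <= N.
Proof.
have [N1 N10 H1] := ccont_bounded compact_closures.1 cSp.
have [N2 N20 H2] := ccont_bounded compact_closures.2 cSm.
have [N3 N30 H3] := dbar_bounded (uu 1%N).
exists (Num.max N1 N2 * N3); first by rewrite mulr_gt0// lt_max N10.
have P0 : 0 <= Num.max N1 N2 * N3 by rewrite mulr_ge0 ?ltW// lt_max N10.
move=> z; rewrite /cut_density; case: asboolP => [pz|_].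
  rewrite nmN nmM ler_pM ?nm_ge0//.
  by rewrite le_max H1//; exact: subset_closure.
case: asboolP => [mz|_]; last by rewrite nm0.
rewrite nmN nmM ler_pM ?nm_ge0//.
by rewrite le_max H2 ?orbT//; exact: subset_closure.
Qed.

Lemma cut_density_supp z : cut_density z != 0 -> supp (toC u) z.
Proof.
move=> gz; apply: contrapT => /dbar_notin_supp d0; move: gz; rewrite /cut_density d0 !mulr0 oppr0.
by case: asboolP => _; [|case: asboolP => _]; rewrite eqxx.
Qed.

Variable f : C -> C.
Hypotheses (af : analytic_in D f) (cf : ccont (closure D) f).

Let s z : C := if `[< Dp z >] then - bp%:C else bm%:C.
Let G z := if `[< D z >] then (cut_density z + s z) * f z else 0.

Let f_bounded : exists2 N : R, 0 < N & forall z, D z -> nm (f z) <= N.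
Proof.
have cD : compact (closure D).
  by rewrite closureU; apply: compactU; [exact: compact_closures.1|exact: compact_closures.2].
by have [N N0 H] := ccont_bounded cD cf; exists N => // z Dz; apply: H; exact: subset_closure.
Qed.

Let f_cont z : D z -> cont_at f z.
Proof. by move=> Dz; exact: ccont_open cf. Qed.

Let s_cont z : D z -> cont_at s z.
Proof.
move=> [pz|mz].
  apply: (@near_open Dp (fun=> - bp%:C)) (cont_at_cst _ _) => // w pw.
  by rewrite /s; case: asboolP.
apply: (@near_open Dm (fun=> bm%:C)) (cont_at_cst _ _) => // w mw.
by rewrite /s; case: asboolP => // pw; case: (nDD pw mw).
Qed.

Let G_cont z : D z -> cont_at G z.
Proof.
move=> Dz; apply: (@near_open D (fun z => (cut_density z + s z) * f z)) => //.
  by move=> w Dw; rewrite /G; case: asboolP.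
by apply: cont_atM (f_cont Dz); apply: cont_atD; [exact: cut_density_cont|exact: s_cont].
Qed.

Let s_bounded z : nm (s z) <= `|bp| + `|bm|.
Proof. by rewrite /s; case: ifP => _; rewrite ?nmN nmC ?lerDl ?lerDr. Qed.

Let cbdm_gf : cbdm D (fun z => cut_density z * f z).
Proof.
have [N N0 H] := cut_density_bounded; have [N' N'0 H'] := f_bounded.
apply: cbdmM; [exact: (cbdm_cont oD cut_density_cont (fun z _ => H z))|exact: (cbdm_cont oD f_cont H')].
Qed.

Let cbdm_sf : cbdm D (fun z => s z * f z).
Proof.
have [N' N'0 H'] := f_bounded.
apply: cbdmM; [exact: (cbdm_cont oD s_cont (fun z _ => s_bounded z))|exact: (cbdm_cont oD f_cont H')].
Qed.

Let faD : finite_area D. Proof. exact: open_bounded_finite_area oD DM. Qed.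

Let int_G : plane_integral D G = 0.
Proof.
have L0 : 0 < M + 1 by rewrite addr_gt0.
pose h w := V w * f w.
have cfA A : A `<=` D -> ccont (closure A) f by move=> AD; apply: ccont_sub cf; exact: closureS.
apply: (@cgreen _ h G (frontier Dp `|` frontier Dm) D (M + 1)) => //.
(* Continuity on the plane is pasted from three closed pieces: [f] is continuous only on the closure
   of the domains, and on the third piece the product is 0. *)
- have -> : setT = closure Dp `|` closure Dm `|` closure ext.
    apply/esym; rewrite -subTset => z _; have [|] := pselect ((closure Dp `|` closure Dm) z).
      by left.
    by right; exact: subset_closure.
  have cl A : closed (closure A) by exact: closed_closure.
  apply: ccont_paste => //; first exact: closedU.
    apply: ccont_paste => //; first by apply: ccontM ccont_V.1 _; apply: cfA => ?; left.
    by apply: ccontM ccont_V.2 _; apply: cfA => ?; right.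
  apply: ccont_eq (@ccont_cst R _ 0) => z Ez; by rewrite /h V_ext// mul0r.
- move=> z hz; rewrite (le_lt_trans (closure_M _)) ?ltrDl//.
  apply: contrapT => n; move: hz; rewrite /h V_ext ?mul0r ?eqxx//.
  exact: subset_closure.
- apply: (@cbdm_extend _ D) faD.1 _ _ => [z nD|]; first by rewrite /G; case: asboolP.
  apply: cbdm_eq (cbdmD cbdm_gf cbdm_sf) => z Dz.
  by rewrite /G; case: asboolP => // _; rewrite mulrDl.
- by move=> z /DM zM; rewrite (le_lt_trans zM)// ltrDl.
- by move=> z; rewrite /G; case: asboolP; rewrite ?eqxx.
- by rewrite preimage_setU; apply: grid_thinU; apply: frontier_thin => //; rewrite mulr_gt0.
move=> z nF.
have nz A : open A -> ~ frontier A z -> A z \/ ~ closure A z.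
  move=> oA nA; have [Az|nAz] := pselect (A z); [by left|right => cz].
  by apply: nA; apply/frontierE.
have G0 : (forall w, ~ D w -> G w = 0) by move=> w nw; rewrite /G; case: asboolP.
case: (nz _ oDp (fun k => nF (or_introl k))) => [pz|npz].
  have Dz : D z by left.
  split; last exact: G_cont.
  have [a Ha] := @cut_cdf Dp Cp U Sp u z oDp (fun w k => KU (or_introl k)) oU U1 uu aSp pz.
  have [c Hc] := derivable_cdf (af Dz).
  have := cdfM (cdfD Ha (cdfZ (- bp%:C) (cdf_conj z))) Hc.
  rewrite !mulr0 !addr0 mulr1 => H.
  move: (oDp) => /open_complexP/(_ z pz)[r r0 rD].
  eexists; have -> : G z = (- (Sp z * dbar u z) + - bp%:C) * f z.
    by rewrite /G /s; case: asboolP => // _; case: asboolP => // _; rewrite gp.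
  apply: (@cdf_near _ _ h z _ _ r r0 _ H) => w /rD pw.
  by rewrite /h (VpE (@subset_closure _ Dp _ pw)) mulNr.
case: (nz _ oDm (fun k => nF (or_intror k))) => [mz|nmz].
  have Dz : D z by right.
  split; last exact: G_cont.
  have [a Ha] := @cut_cdf Dm Cm U Sm u z oDm (fun w k => KU (or_intror k)) oU U1 uu aSm mz.
  have [c Hc] := derivable_cdf (af Dz).
  have := cdfM (cdfD Ha (cdfZ bm%:C (cdf_conj z))) Hc.
  rewrite !mulr0 !addr0 mulr1 => H.
  move: (oDm) => /open_complexP/(_ z mz)[r r0 rD].
  eexists; have -> : G z = (- (Sm z * dbar u z) + bm%:C) * f z.
    rewrite /G /s; case: asboolP => // _; rewrite gm//.
    by case: asboolP => // pz; case: (nDD pz mz).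
  apply: (@cdf_near _ _ h z _ _ r r0 _ H) => w /rD pw.
  by rewrite /h (VmE (@subset_closure _ Dm _ pw)).
have Ez : ext z by case.
move: oext => /open_complexP/(_ z Ez)[r r0 rE].
have nD w : ext w -> ~ D w.
  by move=> k [pw|mw]; apply: k; [left|right]; exact: subset_closure.
have Gz : forall w, nm (w - z) < r -> G w = 0 by move=> w /rE/nD/G0.
split.
  exists 0; rewrite G0; last exact: nD.
  apply: (@cdf_near _ (fun=> 0) _ _ _ _ r r0) (cdf_cst _ _) => w /rE Ew.
  by rewrite /h (V_ext (@subset_closure _ ext _ Ew)) mul0r.
by apply: (@cont_at_near _ (fun=> 0) _ _ r r0) (cont_at_cst _ _) => w /Gz.
Qed.

Lemma schwarz_density : plane_integral D (fun z => cut_density z * f z) =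
  bp%:C * plane_integral Dp f - bm%:C * plane_integral Dm f.
Proof.
have := int_G; rewrite (@eq_plane_integral _ D G (fun z => cut_density z * f z + s z * f z)); last first.
  by move=> z Dz; rewrite /G; case: asboolP => // _; rewrite mulrDl.
rewrite plane_integralD ?cbdm_gf ?cbdm_sf// => /eqP; rewrite addr_eq0 => /eqP ->.
have fp : finite_area Dp by apply: open_bounded_finite_area oDp _ => z h; apply: DM; left.
have fm : finite_area Dm by apply: open_bounded_finite_area oDm _ => z h; apply: DM; right.
rewrite (plane_integralU fp fm dis cbdm_sf).
have [N N0 H] := f_bounded.
have bfp : cbdm Dp f.
  by apply: cbdm_cont oDp _ (fun z k => H z (or_introl k)) => z h; apply: f_cont; left.
have bfm : cbdm Dm f.
  by apply: cbdm_cont oDm _ (fun z k => H z (or_intror k)) => z h; apply: f_cont; right.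
rewrite (@eq_plane_integral _ Dp _ (fun z => - bp%:C * f z)); last first.
  by move=> z pz; rewrite /s; case: asboolP.
rewrite (@eq_plane_integral _ Dm _ (fun z => bm%:C * f z)); last first.
  by move=> z mz; rewrite /s; case: asboolP => // pz; case: (nDD pz mz).
by rewrite !plane_integralZ// opprD mulNr opprK.
Qed.

End schwarz_to_quadrature.

Section forward.
Variable R : realType.
Notation C := (R[i]^o).

Lemma schwarz_quadrature (bp bm : R) (Dp Dm : set C) (Sp Sm : C -> C) :
  open Dp -> open Dm -> bounded_set Dp -> bounded_set Dm -> Dp `&` Dm = set0 ->
  piecewise_C1_boundary Dp -> piecewise_C1_boundary Dm ->
  two_phase_Schwarz_function bp bm Dp Dm Sp Sm ->
  exists mu : (C -> C) -> C, plane_distribution mu /\ two_phase_quadrature_domain bp bm Dp Dm mu.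
Proof.
move=> oDp oDm bDp bDm dis C1p C1m.
move=> [Cp [Cm [[cCp CpD cCm CmD] [/ccontP cSp aSp] [/ccontP cSm aSm] [bSp bSm] bS]]].
have oD : open (Dp `|` Dm) by exact: openU.
have KD : Cp `|` Cm `<=` Dp `|` Dm by apply: setUSS.
have [u [uu cu uD [U [oU KU U1]]]] := cutoff_exists oD (compactU cCp cCm) KD.
have [Mp Mp0 HMp] := bounded_setC bDp; have [Mm Mm0 HMm] := bounded_setC bDm.
have [M M0 DM] : exists2 M : R, 0 < M & forall z, (Dp `|` Dm) z -> nm z <= M.
  exists (Num.max Mp Mm); first by rewrite lt_max Mp0.
  by move=> z [/HMp|/HMm] h; rewrite le_max h ?orbT.
set g := cut_density Dp Dm Sp Sm u.
have gc : forall z, (Dp `|` Dm) z -> cont_at g z by move=> z Dz; exact: (cut_density_cont oDp oDm dis cSp cSm uu Dz).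
have [N N0] := cut_density_bounded cSp cSm uu DM; rewrite -/g => gN.
have gs : forall z, g z != 0 -> supp (toC u) z by move=> z gz; exact: cut_density_supp gz.
exists (density (Dp `|` Dm) g); split.
  exact: density_distribution DM gc (fun z _ => gN z).
have suppD : distribution_supp (density (Dp `|` Dm) g) `<=` supp (toC u).
  move=> z; apply: contraPP => nz; apply; exists (~` supp (toC u)); split=> //.
    by apply: closed_openC; exact: closed_closure.
  move=> phi _ sphi; apply: plane_integral0 => w _.
  have [->|/gs gw] := eqVneq (g w) 0; first by rewrite mul0r.
  have -> : phi w = 0 by apply: notin_supp => /sphi; apply.
  by rewrite mulr0.
split.
  split; last exact: subset_trans suppD uD.
  by apply: (subclosed_compact _ cu suppD); exact: distribution_supp_closed.
move=> f af /ccontP cf chi tchi schi [W [oW sW W1]].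
rewrite -(schwarz_density oDp oDm dis C1p C1m cSp aSp cSm aSm bSp bSm bS uu uD oU KU U1 M0 DM af cf).
apply: eq_plane_integral => z Dz; rewrite -/g.
have [->|gz] := eqVneq (g z) 0; first by rewrite !mul0r.
(* The cutoff [chi] is known to be 1 only near the distribution support; [density_supp] places every
   point of [D] with [g z != 0] there. *)
rewrite W1 ?mul1r//; apply: sW; exact: density_supp DM gc (fun z _ => gN z) Dz gz.
Qed.

End forward.

(** * From the distribution to the Schwarz function *)

Section moments.
Variable R : realType.
Notation C := (R[i]^o).
Implicit Types (I : Type) (f g phi : C -> C) (z w a : C) (W : set (R * R)) (u : R * R -> R).

Definition cub I n W (F : I -> C -> C) :=
  ub n W (fun i p => complex.Re (F i (of_coord p))) /\
  ub n W (fun i p => complex.Im (F i (of_coord p))).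

Lemma cub_union I n V W (F : I -> C -> C) : cub n V F -> cub n W F -> cub n (V `|` W) F.
Proof. by move=> [h1 h2] [k1 k2]; split; exact: ub_union. Qed.

Lemma cub_eq I n W (F G : I -> C -> C) : open W ->
  (forall i z, W (to_coord z) -> F i z = G i z) -> cub n W F -> cub n W G.
Proof.
move=> oW FG [h1 h2]; split; [apply: ub_eq oW _ h1|apply: ub_eq oW _ h2] => i p Wp;
  by rewrite FG// of_coordK.
Qed.

Lemma cub_mul I n W (F G : I -> C -> C) : open W -> cub n W F -> cub n W G ->
  cub n W (fun i z => F i z * G i z).
Proof.
move=> oW [f1 f2] [g1 g2]; split.
  apply: ub_eq oW _ (ub_add oW (ub_mul oW f1 g1) (ub_opp oW (ub_mul oW f2 g2))) => i p _.
  by case: (F _ _) (G _ _) => ? ? [].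
apply: ub_eq oW _ (ub_add oW (ub_mul oW f1 g2) (ub_mul oW f2 g1)) => i p _.
by case: (F _ _) (G _ _) => ? ? [].
Qed.

Lemma cub_inv I n W (F : I -> C -> C) (d : R) : open W -> 0 < d ->
  (forall i z, W (to_coord z) -> d <= nm (F i z)) -> cub n W F ->
  cub n W (fun i z => (F i z)^-1).
Proof.
move=> oW d0 dF [f1 f2].
have E z : z^-1 = (complex.Re z / nm z ^+ 2) +i* (- (complex.Im z) / nm z ^+ 2) :> C.
  by rewrite nm_sqr mulNr; case: z => x y.
have hN : ub n W (fun i p => nm (F i (of_coord p)) ^+ 2).
  apply: ub_eq oW _ (ub_add oW (ub_mul oW f1 f1) (ub_mul oW f2 f2)) => i p _.
  by rewrite nm_sqr !expr2.
have hV : ub n W (fun i p => (nm (F i (of_coord p)) ^+ 2)^-1).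
  apply: (ub_inv oW (exprn_gt0 2 d0) _ hN) => i p Wp.
  rewrite ger0_norm ?exprn_ge0 ?nm_ge0// lerXn2r ?nnegrE ?nm_ge0 ?(ltW d0)//.
  by apply: dF; rewrite of_coordK.
split.
  by apply: ub_eq oW _ (ub_mul oW f1 hV) => i p _; rewrite E.
by apply: ub_eq oW _ (ub_mul oW (ub_opp oW f2) hV) => i p _; rewrite E.
Qed.

Lemma ub_coord I n W (b : bool) (L : R) : open W -> (forall p, W p -> `|coord b p| <= L) ->
  ub n W (fun _ : I => coord b).
Proof.
move=> oW hL; case: n => [|n].
  by split=> //; [exists L => _ p; exact: hL|move=> _ p _; exact: coord_continuous].
have D b' p : is_derive p (dir R b') (coord b) ((b == b')%:R : R).
  have := @is_derive_coord R id (fun=> 1) b b' 1 0 p (is_derive_id _ _).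
  by rewrite mulr1 mul1r; congr is_derive; apply/funext => q; rewrite mul1r addr0.
split; [by exists L => _ p; exact: hL|by move=> _ p _; exact: coord_continuous|].
split; first by move=> _ p b' _; have [] := D b' p.
move=> b'; apply: (@ub_eq _ I n W (fun _ => cst (b == b')%:R)) => //.
  by move=> _ p _; rewrite (@derive_val _ _ _ _ _ _ _ (D b' p)).
exact: (@ub_cst _ I n W (fun=> (b == b')%:R) _ (fun=> lexx _)).
Qed.

Lemma cub_shift I n W (c : I -> C) (L M : R) : open W ->
  (forall z, W (to_coord z) -> nm z <= L) -> (forall i, nm (c i) <= M) ->
  cub n W (fun i z => z - c i).
Proof.
move=> oW WL cM.
have hc (b : bool) : ub n W (fun _ : I => coord b).
  apply: (@ub_coord _ _ _ _ L) => // p Wp.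
  have := WL (of_coord p); rewrite of_coordK => /(_ Wp) h.
  by case: b; [rewrite (le_trans _ h)// (Im_nm (of_coord p))|rewrite (le_trans _ h)// (Re_nm (of_coord p))].
have cR (i : I) : `|- complex.Re (c i)| <= M by rewrite normrN (le_trans (Re_nm _)).
have cI (i : I) : `|- complex.Im (c i)| <= M by rewrite normrN (le_trans (Im_nm _)).
split.
  by apply: ub_eq oW _ (ub_add oW (hc false) (ub_cst n W cR)) => i p _; rewrite raddfB.
by apply: ub_eq oW _ (ub_add oW (hc true) (ub_cst n W cI)) => i p _; rewrite raddfB.
Qed.

Lemma cub_toC I n W u : open W -> ub n W (fun _ : unit => u) -> cub n W (fun _ : I => toC u).
Proof.
move=> oW uu; split.
  apply: ub_eq oW _ (ub_comp (fun _ : I => tt) uu) => i p _.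
  by rewrite /= /toC of_coordK.
exact: (@ub_cst _ I n W (fun=> 0) _ (fun=> lexx _)).
Qed.

Lemma cub_cpartial I n (F : I -> C -> C) : cub n setT F ->
  exists M : R, forall i p s, (size s <= n)%N -> nm (cpartial s (F i) p) <= M.
Proof.
move=> [/ub_partialS[M1 h1] /ub_partialS[M2 h2]]; exists (M1 + M2) => i p s sn.
rewrite (le_trans (nm_ReIm _))// lerD//; [exact: h1|exact: h2].
Qed.

Lemma cub_test I (F : I -> C -> C) i : (forall n, cub n setT F) -> compact (supp (F i)) ->
  test_function (F i).
Proof.
by move=> H cF; split=> //; apply: ub_smooth => n; have [h1 h2] := H n;
  [exact: ub_comp (fun _ : unit => i) h1|exact: ub_comp (fun _ : unit => i) h2].
Qed.

(** * Holomorphy of the Cauchy transform of a distribution *)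

Section cauchy_transform.
Variables (mu : (C -> C) -> C) (u : R * R -> R).
Hypotheses (hmu : plane_distribution mu) (uu : forall n, ub n setT (fun _ : unit => u)).
Hypothesis cu : compact (supp (toC u)).
Variable z : C.
Hypothesis zu : ~ supp (toC u) z.

Let X := toC u.

Let far : exists2 r : R, 0 < r & forall w, supp X w -> 2 * r <= nm (w - z).
Proof.
have /open_complexP/(_ z zu)[r r0 rU] := closed_openC (@closed_closure _ [set w | X w != 0]).
exists (r / 2); first by rewrite divr_gt0.
move=> w sw; rewrite [2 * _](_ : _ = r); last by field.
rewrite leNgt; apply/negP => wr; exact: (rU w wr sw).
Qed.

(* The family [chi(w) / ((w - z)^j (w - z - h))], with [h] near [0]. *)
Let family (r : R) (j : nat) (h : {h : C | nm h <= r}) w : C :=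
  X w * ((w - z)^-1 ^+ j * (w - (z + sval h))^-1).

Let family_cub (r : R) j : 0 < r -> (forall w, supp X w -> 2 * r <= nm (w - z)) ->
  forall n, cub n setT (@family r j).
Proof.
move=> r0 rX n.
have [L L0 XL] := compact_boundedC cu.
(* For [w] in [A] and [h] of modulus at most [r], the modulus of [w - z - h] is at least [r / 2].
   With the complement of the support of [X], where the family is 0, [A] covers the plane. *)
pose A : set C := [set w | nm w < L + 1 /\ r + r / 2 < nm (w - z)].
have oA : open (@of_coord R @^-1` A).
  apply/open_of_coord/open_complexP => w [w1 w2].
  exists (Num.min (L + 1 - nm w) (nm (w - z) - (r + r / 2))).
    by rewrite lt_min !subr_gt0 w1.
  move=> v; rewrite lt_min => /andP[h1 h2]; split.
    by rewrite -(subrK w v) (le_lt_trans (nmD _ _))// -ltrBrDr.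
  have := nm_triB w v z; rewrite (nm_distC w v); move: h1 h2; lra.
have oB : open (@of_coord R @^-1` (~` supp X)).
  by apply/open_of_coord/closed_openC; exact: closed_closure.
have AE (w : C) : (@of_coord R @^-1` A) (to_coord w) -> A w by rewrite /= to_coordK.
have -> : setT = @of_coord R @^-1` A `|` @of_coord R @^-1` (~` supp X).
  apply/esym; rewrite -subTset => p _; have [sp|sp] := pselect (supp X (of_coord p)); last by right.
  left; split; first by apply: le_lt_trans (XL _ sp) _; rewrite ltrDl.
  by apply: lt_le_trans _ (rX _ sp); move: r0; lra.
apply: cub_union; last first.
  apply: (@cub_eq _ n _ (fun _ _ => 0)) => //.
    by move=> h w /=; rewrite to_coordK => nw; rewrite /family (notin_supp nw) mul0r.
  by split; exact: (@ub_cst _ _ n _ (fun=> 0) _ (fun=> lexx _)).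
apply: cub_mul => //.
  by apply: cub_toC => //; apply: ub_sub (uu n).
have inv0 : cub n (@of_coord R @^-1` A) (fun (_ : {h : C | nm h <= r}) w => (w - z)^-1).
  apply: (@cub_inv _ _ _ _ r oA r0) => [h w /AE[_ wz]|].
    by apply/ltW/(lt_trans _ wz); rewrite ltrDl divr_gt0.
  by apply: (@cub_shift _ n _ (fun=> z) (L + 1) (nm z)) => // w /AE[wL _]; exact: ltW.
apply: cub_mul => //.
  elim: j => [|j IH].
    apply: (@cub_eq _ n _ (fun _ => cst (1 : C))) => //.
    by split; [exact: (@ub_cst _ _ n _ (fun=> 1) _ (fun=> lexx _))|
      exact: (@ub_cst _ _ n _ (fun=> 0) _ (fun=> lexx _))].
  by apply: cub_eq oA _ (cub_mul oA inv0 IH) => h w _; rewrite exprS.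
apply: (@cub_inv _ _ _ _ (r / 2)) => //; first by rewrite divr_gt0.
  move=> [h hr] w /AE[_ wz] /=; rewrite opprD addrA.
  have := nm_triB (w - z) h 0; rewrite !subr0; move: hr wz r0; lra.
apply: (@cub_shift _ n _ _ (L + 1) (nm z + r)) => //.
  by move=> w /AE[wL _]; exact: ltW.
by move=> [h hr]; rewrite (le_trans (nmD _ _))// lerD2l.
Qed.

Let supp_family r j (h : {h : C | nm h <= r}) : supp (family j h) `<=` supp X.
Proof.
apply: closureS => w /=; apply: contra => /eqP E.
by rewrite /family E mul0r.
Qed.

Let test_family r j (h : {h : C | nm h <= r}) : 0 < r ->
  (forall w, supp X w -> 2 * r <= nm (w - z)) -> test_function (family j h).
Proof.
move=> r0 rX; apply: cub_test; first exact: family_cub.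
apply: (subclosed_compact _ cu (@supp_family r j h)); exact: closed_closure.
Qed.

(** Expanding [1 / (v - z - h)] to second order in [h] leaves [h ^+ 2] times a member of [family 2].
    The derivatives of this member are bounded uniformly in [h], so by continuity of [mu] the
    remainder is quadratic. The derivative is the value of [mu] at [X / (v - z)^2]. *)
Lemma cauchy_transform_cdf : exists a, cdf (fun w => mu (fun v => X v * (v - w)^-1)) z a 0.
Proof.
have [r r0 rX] := far.
have [lin bd] := hmu.
have [N [c Hc]] := bd _ cu.
have [M HM] := cub_cpartial (family_cub 2 r0 rX N).
have nm00 : nm (0 : C) <= r by rewrite nm0 ltW.
pose o : {h : C | nm h <= r} := exist _ 0 nm00.
exists (mu (family 1 o)) => e e0.
pose B := `|c * M| + 1; have B0 : 0 < B by rewrite ltr_wpDl.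
exists (Num.min r (e / B)); first by rewrite lt_min r0 divr_gt0.
move=> w; rewrite lt_min => /andP[wr wB].
pose h : {h : C | nm h <= r} := exist _ (w - z) (ltW wr).
have t0 := test_family 0 o r0 rX; have t1 := test_family 1 o r0 rX.
have t2 := test_family 2 h r0 rX.
have tw := test_family 0 h r0 rX.
have E0 : (fun v => X v * (v - z)^-1) = family 0 o.
  by apply/funext => v; rewrite /family /= addr0 expr0 mul1r.
have Ew : (fun v => X v * (v - w)^-1) = family 0 h.
  by apply/funext => v; rewrite /family /= [z + _]addrC subrK expr0 mul1r.
have nz v : X v != 0 -> v - z != 0 /\ v - (z + (w - z)) != 0.
  move=> Xv; have sv : supp X v by exact: subset_closure.
  have := rX _ sv; rewrite -!nm_gt0 opprD addrA => h1.
  have := nm_triB (v - z) (w - z) 0; rewrite !subr0 => T; by split; lra.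
(* The resolvent identity, applied for [j = 0] and [j = 1]. It also has to hold where [X] vanishes,
   since there the denominators may be 0. *)
have rec j : family j h = (fun v => (w - z) * family j.+1 h v + family j o v).
  apply/funext => v; rewrite /family /= addr0.
  have [->|Xv] := eqVneq (X v) 0; first by rewrite !mul0r mulr0 addr0.
  have [h1 h2] := nz _ Xv.
  by rewrite exprSr; field; rewrite h1 h2.
have M01 : mu (family 0 h) = (w - z) * mu (family 1 h) + mu (family 0 o).
  by rewrite {1}rec lin//; exact: test_family.
have M12 : mu (family 1 h) = (w - z) * mu (family 2 h) + mu (family 1 o).
  by rewrite {1}rec lin.
rewrite E0 Ew M01 M12 mul0r subr0.
rewrite (_ : _ - _ - _ = (w - z) * (w - z) * mu (family 2 h)); last by ring.
have : nm (mu (family 2 h)) <= c * M.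
  rewrite -lecR -normE; apply: (Hc _ M t2 (@supp_family r 2 h)).
  by move=> s p sN; rewrite normE lecR; exact: HM.
move=> mb; rewrite -[X in nm X]mulrA nmM mulrC nmM.
rewrite ler_wpM2r ?nm_ge0// (@le_trans _ _ (nm (w - z) * B))//.
  by rewrite ler_wpM2l ?nm_ge0// (le_trans mb)// (le_trans (ler_norm _))// lerDl.
by rewrite -ler_pdivlMr// ltW.
Qed.

End cauchy_transform.

End moments.

(** * Invariance of the plane measure under point reflections *)

Section reflection.
Variable R : realType.
Notation C := (R[i]^o).
Notation mu2 := (@plane_measure R).
Notation leb := (@lebesgue_measure R).
Notation mR := (measurableTypeR R).

Definition refl1 (a : R) (x : mR) : mR := a - x.

Lemma measurable_refl1 a : measurable_fun setT (refl1 a).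
Proof.
apply: (@continuous_measurable_fun R (fun x => a - x)) => x.
by apply: continuousB; [exact: cst_continuous|exact: cvg_id].
Qed.

Lemma lebesgue_refl1 a (A : set (measurableTypeR R)) : measurable A ->
  pushforward leb (refl1 a) A = leb A.
Proof.
move=> mA; apply/esym/lebesgue_measure_unique => //=.
  exact: measurable_refl1.
move=> _ X [[x y] _ <-]; rewrite /pushforward.
(* It suffices to compare on half-open intervals; reflection exchanges which end is included, which
   does not change the length. *)
rewrite /= (_ : refl1 a @^-1` _ = [set` `[a - y, a - x[]); last first.
  by apply/seteqP; split=> t; rewrite /refl1 /= !in_itv/= => /andP[h1 h2]; apply/andP; split; lra.
rewrite /= !lebesgue_measure_itv/= !lte_fin.
have -> : (a - y < a - x) = (x < y) by rewrite ltrD2l ltrN2.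
by case: ifP => // _; rewrite -!EFinB; congr (_%:E); ring.
Qed.

Definition refl2 (a : R * R) (p : mR * mR) : mR * mR := (refl1 a.1 p.1, refl1 a.2 p.2).

Lemma measurable_refl2 a : measurable_fun setT (refl2 a).
Proof.
apply: measurable_fun_pair.
  by apply: measurableT_comp (@measurable_refl1 _) _; exact: measurable_fst.
by apply: measurableT_comp (@measurable_refl1 _) _; exact: measurable_snd.
Qed.

Lemma plane_measure_refl2 a (A : set (mR * mR)) : measurable A ->
  pushforward mu2 (refl2 a) A = mu2 A.
Proof.
move=> mA; rewrite /plane_measure; apply/esym.
apply: (@product_measure_unique _ _ _ _ R leb leb (pushforward (leb \x leb)%E (refl2 a))) => //=.
  exact: measurable_refl2.
move=> _ X Y mX mY; rewrite /pushforward.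
have -> : refl2 a @^-1` (X `*` Y) = (refl1 a.1 @^-1` X) `*` (refl1 a.2 @^-1` Y) by [].
have mr b (Z : set (measurableTypeR R)) : measurable Z -> measurable (refl1 b @^-1` Z).
  by move=> mZ; rewrite -(setTI (_ @^-1` _)); exact: measurable_refl1.
rewrite /plane_measure product_measure1E; [|exact: mr|exact: mr].
by rewrite -(lebesgue_refl1 a.1 mX) -(lebesgue_refl1 a.2 mY).
Qed.

Lemma Rintegral_refl2 a (D : set (mR * mR)) (u : mR * mR -> R) : measurable D -> (mu2 D < +oo)%E ->
  measurable_fun setT u -> bdm D u ->
  \int[mu2]_(p in D) u p = \int[mu2]_(p in refl2 a @^-1` D) u (refl2 a p).
Proof.
move=> mD fD mu bu; rewrite /Rintegral; congr fine.
have mr := measurable_refl2 a.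
have mrD : measurable (refl2 a @^-1` D).
  by rewrite -(setTI (_ @^-1` _)); exact: mr.
have := @integral_pushforward _ _ _ _ R (refl2 a) mr (@lebesgue_measure R \x @lebesgue_measure R)%E D (EFin \o u).
move=> /(_ _ _ mD) H; rewrite -[RHS]H.
- by apply: eq_measure_integral => A mA _; exact/esym/plane_measure_refl2.
- exact/measurable_EFinP.
- have fr : ((leb \x leb)%E (refl2 a @^-1` D) < +oo)%E.
    apply: le_lt_trans fD; rewrite le_eqVlt; apply/orP; left; apply/eqP.
    exact: (plane_measure_refl2 a mD).
  apply: (@bdm_integrable _ _ R (leb \x leb)%E _ (u \o refl2 a) mrD fr).
  split; first by apply: measurable_funTS; exact: measurableT_comp mu mr.
  by case: bu => _ [M uM]; exists M => p /uM.
Qed.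

Lemma of_coord_refl2 (a : C) (p : R * R) : of_coord (refl2 (to_coord a) p) = a - of_coord p.
Proof. by case: a. Qed.

(** It makes an odd function integrate to 0 over a disc, and moves a disc to the origin. *)
Lemma plane_integral_refl (a : C) (D : set C) (f : C -> C) : finite_area D ->
  ccont setT f -> cbdm D f ->
  plane_integral D f = plane_integral [set z | D (a - z)] (fun z => f (a - z)).
Proof.
move=> [mD fD] cf [f1 f2]; rewrite /plane_integral.
have E : @of_coord R @^-1` [set z | D (a - z)] = refl2 (to_coord a) @^-1` (@of_coord R @^-1` D).
  by apply/seteqP; split=> p /=; rewrite of_coord_refl2.
have ax (b : bool) : measurable_fun setT (axis b \o f \o @of_coord R).
  by apply: continuous_measurable2 (@openT _) _ => p _; exact: ccont_axis.
rewrite (Rintegral_refl2 (to_coord a) mD fD (ax false) f1).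
rewrite (Rintegral_refl2 (to_coord a) mD fD (ax true) f2) E.
by congr (_ +i* _); apply: eq_Rintegral => p _; rewrite /= of_coord_refl2.
Qed.

End reflection.

(** * An odd C^1 regularization of 1/w *)

Section kernel.
Variable R : realType.
Notation C := (R[i]^o).
Implicit Types (w h : C).
Variable E : R.
Hypothesis E0 : 0 < E.

Definition capinv (t : R) : R := (Num.max t E)^-1.

Let max_gt0 t : 0 < Num.max t E.
Proof. by rewrite lt_max E0 orbT. Qed.

Lemma capinv_ge0 t : 0 <= capinv t.
Proof. by rewrite invr_ge0 ltW. Qed.

Lemma capinv_le t : capinv t <= E^-1.
Proof. by rewrite lef_pV2 ?posrE// le_max lexx orbT. Qed.

Lemma capinv_far t : E <= t -> capinv t = t^-1.
Proof. by move=> h; rewrite /capinv; move/max_idPl: h => ->. Qed.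

Lemma capinv_near t : t <= E -> capinv t = E^-1.
Proof. by move=> h; rewrite /capinv; move/max_idPr: h => ->. Qed.

Lemma capinv_lip s t : `|capinv s - capinv t| <= E^-1 ^+ 2 * `|s - t|.
Proof.
wlog st : s t / s <= t => [H|].
  by have [|/ltW] := leP s t; [exact: H|rewrite distrC [`|s - t|]distrC; exact: H].
have ps := max_gt0 s; have pt := max_gt0 t.
have -> : capinv s - capinv t = capinv s * capinv t * (Num.max t E - Num.max s E).
  by rewrite /capinv; field; rewrite !gt_eqF.
have h1 : 0 <= Num.max t E - Num.max s E <= t - s.
  by have [tE|tE] := leP t E; have [sE|sE] := leP s E; apply/andP; split; lra.
case/andP: h1 => h1 h2.
rewrite normrM (ger0_norm h1) ger0_norm ?mulr_ge0 ?capinv_ge0// ler_pM ?mulr_ge0 ?capinv_ge0//.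
  by rewrite expr2 ler_pM ?capinv_ge0 ?capinv_le.
by rewrite distrC ger0_norm// subr_ge0.
Qed.

(** It is [t^-1] for [t >= E], and for [t <= E] the tangent line of [t^-1] at [E]. A single formula
    covers both cases, and its derivative is [- capinv t ^+ 2] throughout. *)
Definition profile (t : R) : R := 2 * capinv t - t * capinv t ^+ 2.

(** The left side factors as [capinv s - capinv t] times [2 - s * (capinv s + capinv t)]. The first
    factor is Lipschitz; the second is of order [s - t] unless the first is 0, which happens when
    both arguments are at most [E]. *)
Lemma profile_taylor s t : 0 <= s -> 0 <= t ->
  `|profile s - profile t + (s - t) * capinv t ^+ 2| <= 2 * E^-1 ^+ 3 * (s - t) ^+ 2.
Proof.
move=> s0 t0.
have -> : profile s - profile t + (s - t) * capinv t ^+ 2 =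
    (capinv s - capinv t) * (2 - s * (capinv s + capinv t)).
  by rewrite /profile; ring.
have iE : 0 < E^-1 by rewrite invr_gt0.
have key : `|2 - s * (capinv s + capinv t)| <= 2 * (E^-1 * `|s - t|) \/ capinv s = capinv t.
  have [sE|/ltW sE] := leP s E; have [tE|/ltW tE] := leP t E.
  - by right; rewrite !capinv_near.
  - left; rewrite capinv_near// capinv_far//.
    have t1 : 0 < t by rewrite (lt_le_trans E0).
    have h1 : 0 <= 1 - s / E by rewrite subr_ge0 ler_pdivrMr// mul1r.
    have h2 : 0 <= 1 - s / t by rewrite subr_ge0 ler_pdivrMr// mul1r (le_trans sE).
    have -> : 2 - s * (E^-1 + t^-1) = (1 - s / E) + (1 - s / t) by ring.
    rewrite (ger0_norm (addr_ge0 h1 h2)) distrC ger0_norm; last by rewrite subr_ge0 (le_trans sE).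
    rewrite mulr2n mulrDl mul1r lerD//.
      have -> : 1 - s / E = E^-1 * (E - s) by field; rewrite gt_eqF.
      by rewrite ler_wpM2l ?(ltW iE)// lerD2r.
    have -> : 1 - s / t = t^-1 * (t - s) by field; rewrite gt_eqF.
    by rewrite ler_wpM2r ?subr_ge0 ?(le_trans sE)// lef_pV2 ?posrE.
  - left; rewrite (capinv_far sE) (capinv_near tE).
    have s1 : 0 < s by rewrite (lt_le_trans E0).
    have -> : 2 - s * (s^-1 + E^-1) = E^-1 * (E - s) by field; rewrite !gt_eqF.
    rewrite normrM (gtr0_norm iE) mulrCA ler_wpM2l ?(ltW iE)// ler0_norm ?subr_le0//.
    by rewrite ger0_norm ?subr_ge0 ?(le_trans tE)//; lra.
  - left; rewrite (capinv_far sE) (capinv_far tE).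
    have s1 : 0 < s by rewrite (lt_le_trans E0).
    have t1 : 0 < t by rewrite (lt_le_trans E0).
    have -> : 2 - s * (s^-1 + t^-1) = t^-1 * (t - s) by field; rewrite !gt_eqF.
    rewrite normrM gtr0_norm ?invr_gt0// distrC mulr2n mulrDl mul1r.
    rewrite (@le_trans _ _ (E^-1 * `|s - t|)) ?lerDl ?mulr_ge0 ?(ltW iE)//.
    by rewrite ler_wpM2r// lef_pV2 ?posrE.
case: key => [key|->]; last first.
  rewrite subrr mul0r normr0; apply: mulr_ge0 (sqr_ge0 _).
  by apply: mulr_ge0 => //; apply/exprn_ge0/ltW.
rewrite normrM (le_trans (ler_pM _ _ (capinv_lip s t) key))//.
rewrite -(real_normK (num_real (s - t))) le_eqVlt; apply/orP; left; apply/eqP; ring.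
Qed.

(* [1 / w] off the disc of radius [sqrt E], a C^1 odd extension inside. *)
Definition kern w : C := conjc w * (profile (nm w ^+ 2))%:C.

(** This and [kern_dbar] are the Wirtinger derivatives of [kern], by the chain rule with
    [nm w ^+ 2 = w * conjc w] and profile derivative [- capinv ^+ 2]. *)
Definition kern_d w : C := - (conjc w * conjc w * (capinv (nm w ^+ 2) ^+ 2)%:C).

Definition kern_dbar w : C := (profile (nm w ^+ 2) - nm w ^+ 2 * capinv (nm w ^+ 2) ^+ 2)%:C.

Lemma mul_conj w : w * conjc w = (nm w ^+ 2)%:C.
Proof.
rewrite nm_sqr; case: w => x y.
by apply/eqP; rewrite eq_complex/=; apply/andP; split; apply/eqP; ring.
Qed.

Lemma kern_far w : E <= nm w ^+ 2 -> kern w = w^-1 /\ kern_dbar w = 0.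
Proof.
move=> h; rewrite /kern /kern_dbar /profile capinv_far//.
have t0 : nm w ^+ 2 != 0 by rewrite gt_eqF// (lt_le_trans E0).
have w0 : w != 0 by rewrite -nm_eq0; apply: contraNneq t0 => ->; rewrite expr0n.
have e (t : R) : t != 0 -> 2 / t - t * t^-1 ^+ 2 = t^-1 /\ t * t^-1 ^+ 2 = t^-1.
  by move=> t0'; split; field.
have [-> ->] := e _ t0; split; last by rewrite subrr.
by apply: (mulfI w0); rewrite mulrA mul_conj divff// -rmorphM/= divff.
Qed.

Lemma kernN w : kern (- w) = - kern w.
Proof. by rewrite /kern nmN rmorphN mulNr. Qed.

Lemma kern_dbarN w : kern_dbar (- w) = kern_dbar w.
Proof. by rewrite /kern_dbar nmN. Qed.

Lemma kern_near w : nm w ^+ 2 <= E -> nm (kern w) <= 2 * nm w / E.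
Proof.
move=> h; rewrite /kern nmM nm_conj nmC [leRHS](_ : _ = nm w * (2 / E)); last by ring.
rewrite ler_wpM2l ?nm_ge0// /profile capinv_near//.
have i0 : 0 < E^-1 by rewrite invr_gt0.
have h2 : nm w ^+ 2 * E^-1 ^+ 2 <= E^-1.
  by rewrite expr2 mulrA ler_piMl ?(ltW i0)// ler_pdivrMr// mul1r.
have h3 : 0 <= nm w ^+ 2 * E^-1 ^+ 2 by rewrite mulr_ge0 ?sqr_ge0.
by rewrite ger0_norm; lra.
Qed.

Lemma kern_dbar_ge0 w : 0 <= complex.Re (kern_dbar w).
Proof.
rewrite /= /profile; have [h|/ltW h] := leP (nm w ^+ 2) E; last first.
  by have := (kern_far h).2; rewrite /kern_dbar /profile => /(congr1 (@complex.Re R))/= ->.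
rewrite capinv_near//.
have i0 : 0 < E^-1 by rewrite invr_gt0.
have h2 : nm w ^+ 2 * E^-1 ^+ 2 <= E^-1.
  by rewrite expr2 mulrA ler_piMl ?(ltW i0)// ler_pdivrMr// mul1r.
lra.
Qed.

Lemma kern_dbar_gt0 w : nm w ^+ 2 <= E / 2 -> E^-1 <= complex.Re (kern_dbar w).
Proof.
move=> h; rewrite /= /profile capinv_near; last by move: E0 h; lra.
have i0 : 0 < E^-1 by rewrite invr_gt0.
have h2 : nm w ^+ 2 * E^-1 ^+ 2 <= E^-1 / 2.
  rewrite [_ ^+ 2 in X in _ * X]expr2 mulrA mulrC ler_wpM2l ?(ltW i0)// ler_pdivrMr//.
  by rewrite mulrC.
lra.
Qed.

(** The bound is explicit because it has to be uniform in [w] over a bounded set, where the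
    remainder will be integrated. *)
Lemma kern_taylor w h : nm (kern (w + h) - kern w - kern_d w * h - kern_dbar w * conjc h) <=
  (2 * E^-1 ^+ 3 * (nm w + nm h) * (2 * nm w + nm h) ^+ 2 + E^-1 ^+ 2 * (3 * nm w + nm h))
  * nm h ^+ 2.
Proof.
pose t := nm w ^+ 2; pose s := nm (w + h) ^+ 2; pose q := capinv t ^+ 2.
have stE : (s - t)%:C = h * conjc w + w * conjc h + h * conjc h :> C.
  have -> : (s - t)%:C = s%:C - t%:C :> C by rewrite rmorphB.
  rewrite -!mul_conj rmorphD; ring.
have st : `|s - t| <= nm h * (2 * nm w + nm h).
  rewrite -nmC stE (le_trans (nmD _ _))// !nmM !nm_conj mulrDr lerD//.
  by rewrite (le_trans (nmD _ _))// !nmM !nm_conj; lra.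
have -> : kern (w + h) - kern w - kern_d w * h - kern_dbar w * conjc h =
   conjc (w + h) * (profile s - profile t + (s - t) * q)%:C -
   q%:C * (conjc w * (h * conjc h) + conjc h * (s - t)%:C).
  have -> : (profile s - profile t + (s - t) * q)%:C =
     (profile s)%:C - (profile t)%:C + (s - t)%:C * q%:C :> C.
    by rewrite -rmorphM -rmorphB -rmorphD.
  rewrite /kern /kern_d /kern_dbar -/s -/t -/q.
  have -> : (profile t - t * q)%:C = (profile t)%:C - w * conjc w * q%:C :> C.
    by rewrite mul_conj -/t -rmorphM -rmorphB.
  rewrite stE rmorphD; ring.
have tay := @profile_taylor s t (sqr_ge0 _) (sqr_ge0 _).
have q0 : 0 <= q by rewrite exprn_ge0 ?capinv_ge0.
have qE : q <= E^-1 ^+ 2 by rewrite lerXn2r ?nnegrE ?capinv_ge0 ?capinv_le// invr_ge0 ltW.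
have nh := nm_ge0 h; have nw := nm_ge0 w.
have i0 : 0 <= E^-1 by rewrite invr_ge0 ltW.
rewrite (le_trans (nmB _ _))// [leRHS]mulrDl lerD//.
  rewrite nmM nm_conj nmC.
  rewrite (le_trans (ler_pM (nm_ge0 _) (normr_ge0 _) (nmD w h) tay))//.
  rewrite [leLHS](_ : _ = 2 * E^-1 ^+ 3 * (nm w + nm h) * (s - t) ^+ 2); last by ring.
  rewrite -[leRHS]mulrA ler_wpM2l ?mulr_ge0 ?exprn_ge0 ?addr_ge0//.
  rewrite -(real_normK (num_real (s - t))) mulrC -exprMn lerXn2r ?nnegrE//.
  by rewrite mulr_ge0 ?addr_ge0 ?mulr_ge0.
rewrite nmM nmC ger0_norm// -[leRHS]mulrA ler_pM ?nm_ge0//.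
rewrite (le_trans (nmD _ _))// !nmM !nm_conj nmC.
have : nm h * `|s - t| <= nm h * (nm h * (2 * nm w + nm h)) by rewrite ler_wpM2l.
move: (nm h * `|_|) => X; rewrite expr2 => hX.
apply: le_trans (lerD (lexx _) hX) _; rewrite le_eqVlt; apply/orP; left; apply/eqP; ring.
Qed.

Lemma cont_at_sqr (phi : R -> R) (K : R) w : 0 < K ->
  (forall s t, `|phi s - phi t| <= K * `|s - t|) ->
  cont_at (fun v : C => (phi (nm v ^+ 2))%:C : C) w.
Proof.
move=> K0 phiK.
have : cont_at (fun v : C => v * conjc v) w.
  apply: cont_atM; last by apply: (@cdf_cont_at _ _ _ 0 1); exact: cdf_conj.
  by move=> e e0; exists e.
move=> H e e0; have [r r0 Hr] := H (e / K) (divr_gt0 e0 K0).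
exists r => // v /Hr; rewrite !mul_conj -!rmorphB !nmC ltr_pdivlMr// mulrC => h.
exact: le_lt_trans (phiK _ _) h.
Qed.

Lemma kern_d_cont w : cont_at kern_d w.
Proof.
have cc : cont_at (@conjc R : C -> C) w by exact: cdf_cont_at (cdf_conj w).
have iE : 0 < E^-1 ^+ 2 by rewrite exprn_gt0// invr_gt0.
have cp := cont_at_sqr w iE capinv_lip.
have := cont_atM (cont_at_cst w (-1)) (cont_atM (cont_atM cc cc) (cont_atM cp cp)).
apply: cont_at_near ltr01 _ => v _; rewrite /kern_d mulN1r expr2.
by congr (- (_ * _)); rewrite rmorphM.
Qed.

Lemma kern_dbar_cont w : cont_at kern_dbar w.
Proof.
have cc : cont_at (@conjc R : C -> C) w by exact: cdf_cont_at (cdf_conj w).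
have iE : 0 < E^-1 ^+ 2 by rewrite exprn_gt0// invr_gt0.
have cp := cont_at_sqr w iE capinv_lip.
have ct := @cont_at_sqr id 1 w ltr01 (fun s t => ltac:(by rewrite mul1r)).
have := cont_atM (cont_at_cst w (2 : R)%:C) (cont_atD cp (cont_atM (cont_at_cst w (-1 : R)%:C) (cont_atM ct (cont_atM cp cp)))).
apply: cont_at_near ltr01 _ => v _; rewrite /kern_dbar /profile.
move: (nm v ^+ 2) => t; move: (capinv t) => p.
have -> : 2 * p - t * p ^+ 2 - t * p ^+ 2 = 2 * (p + (-1) * (t * (p * p))) by ring.
by apply/eqP; rewrite eq_complex/=; apply/andP; split; apply/eqP; ring.
Qed.

End kernel.

(** * Geometric limits and integrals over small discs *)

Section potential.
Variable R : realType.
Notation C := (R[i]^o).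
Notation mu2 := (@plane_measure R).
Implicit Types (f g F : C -> C) (z w v h : C) (A B : set C).

(** Approaching [z] in a direction [c] shows [(a - a') * c + (b - b') * conjc c = 0]; the directions
    1 and i then force [b = b']. *)
Lemma cdf_unique f z a b a' b' : cdf f z a b -> cdf f z a' b' -> b = b'.
Proof.
move=> H H'; suff E (c : C) : nm c = 1 -> (a - a') * c + (b - b') * conjc c = 0.
  pose i : C := 0 +i* 1.
  have i1 : nm i = 1 by rewrite /nm/= expr0n expr1n/= add0r sqrtr1.
  have i0 : i != 0 by rewrite -nm_eq0 i1 oner_eq0.
  have n1 : nm 1 = 1 :> R by rewrite (_ : 1 = 1%:C)// nmC normr1.
  have h1 := E 1 n1; have h2 := E i i1.
  have ci : conjc i = - i by apply/eqP; rewrite eq_complex/= oppr0 !eqxx.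
  move: h2; rewrite ci mulrN -mulrBl => /eqP; rewrite mulf_eq0 (negPf i0) orbF subr_eq0 => /eqP h2.
  move: h1; rewrite rmorph1 !mulr1 h2 => /eqP.
  by rewrite -mulr2n mulrn_eq0/= subr_eq0 => /eqP.
move=> c1; apply/eqP; rewrite -nm_eq0 eq_le nm_ge0 andbT; apply/ler_addgt0Pr => e e0; rewrite add0r.
have e2 : 0 < e / 2 by rewrite divr_gt0.
have [r r0 Hr] := H _ e2; have [s s0 Hs] := H' _ e2.
pose d : R := Num.min r s / 2.
have d0 : 0 < d by rewrite divr_gt0// lt_min r0.
have [dr ds] : d < r /\ d < s.
  have : d < Num.min r s by rewrite /d gtr_pMr ?lt_min ?r0// invf_lt1// ltr1n.
  by rewrite lt_min => /andP.
pose w := z + d%:C * c.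
have wz : w - z = d%:C * c by rewrite /w addrAC subrr add0r.
have nwz : nm (w - z) = d by rewrite wz nmM c1 mulr1 nmC gtr0_norm.
have h1 := Hr w; have h2 := Hs w; rewrite nwz in h1 h2.
have := le_trans (nmB _ _) (lerD (h2 ds) (h1 dr)).
rewrite (_ : _ - _ - _ - _ - _ = d%:C * ((a - a') * c + (b - b') * conjc c)); last first.
  have -> : conjc (w - z) = d%:C * conjc c.
    by rewrite wz rmorphM; congr (_ * _); apply/eqP; rewrite eq_complex/= oppr0 !eqxx.
  by rewrite wz; ring.
by rewrite nmM nmC gtr0_norm// -mulrDl -splitr mulrC ler_pM2r.
Qed.

Lemma kern_taylor_le (E L : R) w h : 0 < E -> nm w <= L -> nm h <= 1 ->
  nm (kern E (w + h) - kern E w - kern_d E w * h - kern_dbar E w * conjc h) <=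
  (2 * E^-1 ^+ 3 * (L + 1) * (2 * L + 1) ^+ 2 + E^-1 ^+ 2 * (3 * L + 1)) * nm h ^+ 2.
Proof.
move=> E0 wL h1; apply: le_trans (kern_taylor E0 w h) _.
have i0 : 0 <= E^-1 by rewrite invr_ge0 ltW.
have nw := nm_ge0 w; have nh := nm_ge0 h.
apply: ler_wpM2r; first exact: sqr_ge0.
apply: lerD; last by apply: ler_wpM2l; [exact: exprn_ge0|lra].
apply: ler_pM.
- by rewrite !mulr_ge0 ?exprn_ge0 ?addr_ge0.
- exact: sqr_ge0.
- by apply: ler_wpM2l; [rewrite mulr_ge0 ?exprn_ge0|lra].
- by rewrite lerXn2r ?nnegrE; lra.
Qed.

Lemma kern_cdf (E : R) z : 0 < E -> cdf (kern E) z (kern_d E z) (kern_dbar E z).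
Proof.
move=> E0 e e0; set L := nm z.
pose K := 2 * E^-1 ^+ 3 * (L + 1) * (2 * L + 1) ^+ 2 + E^-1 ^+ 2 * (3 * L + 1).
have L0 : 0 <= L by exact: nm_ge0.
have i0 : 0 <= E^-1 by rewrite invr_ge0 ltW.
have K0 : 0 <= K.
  by rewrite /K addr_ge0// !mulr_ge0 ?exprn_ge0 ?addr_ge0 ?mulr_ge0.
exists (Num.min 1 (e / (K + 1))); first by rewrite lt_min ltr01 divr_gt0// ltr_wpDl.
move=> w; rewrite lt_min => /andP[/ltW w1 w2].
have := @kern_taylor_le E L z _ E0 (lexx L) w1; rewrite [z + _]addrC subrK => h.
apply: le_trans h _; rewrite expr2 mulrA ler_wpM2r ?nm_ge0//.
have K1 : 0 < K + 1 by rewrite ltr_wpDl.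
move: w2; rewrite ltr_pdivlMr// => w2; apply: le_trans (ltW w2).
by rewrite mulrC ler_wpM2l ?nm_ge0// lerDl.
Qed.

Definition eps (n : nat) : R := 2^-1 ^+ n.

Lemma eps_gt0 n : 0 < eps n.
Proof. by rewrite exprn_gt0// invr_gt0. Qed.

Lemma epsS n : eps n = 2 * eps n.+1.
Proof. by rewrite /eps exprS mulrA divff ?mul1r. Qed.

Lemma eps_le m n : (m <= n)%N -> eps n <= eps m.
Proof. by move=> mn; apply: ler_wiXn2l mn; [rewrite invr_ge0|rewrite invf_le1 ?ler1n]. Qed.

Lemma eps_small (d : R) : 0 < d -> exists N, eps N < d.
Proof.
by move=> /(pow2_small 1)[n h]; exists n; move: h; rewrite /eps exprVn div1r.
Qed.

(** The intervals of radius [2 * K * eps n] around [x n] are nested, as [eps n] is twice [eps n.+1];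
    the supremum of their left ends lies in all of them. *)
Lemma geometric_limitR (x : nat -> R) (K : R) :
  (forall n, `|x n.+1 - x n| <= K * eps n) ->
  exists l, forall n, `|l - x n| <= 2 * K * eps n.
Proof.
move=> H; have K0 : 0 <= K.
  by have := le_trans (normr_ge0 _) (H 0%N); rewrite /eps expr0 mulr1.
pose lo n := x n - 2 * K * eps n; pose hi n := x n + 2 * K * eps n.
have loS n : lo n <= lo n.+1.
  rewrite /lo; have := H n; rewrite ler_norml epsS => /andP[h _].
  rewrite mulrCA mulrA in h; rewrite [2 * K * (2 * _)]mulrCA; move: h; lra.
have hiS n : hi n.+1 <= hi n.
  rewrite /hi; have := H n; rewrite ler_norml epsS => /andP[_ h].
  rewrite mulrCA mulrA in h; rewrite [2 * K * (2 * _)]mulrCA; move: h; lra.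
have lom m n : (m <= n)%N -> lo m <= lo n.
  elim: n => [|n IH]; first by rewrite leqn0 => /eqP ->.
  by rewrite leq_eqVlt => /predU1P[->//|/IH h]; exact: le_trans (loS n).
have him m n : (m <= n)%N -> hi n <= hi m.
  elim: n => [|n IH]; first by rewrite leqn0 => /eqP ->.
  by rewrite leq_eqVlt => /predU1P[->//|/IH h]; exact: le_trans (hiS n) h.
have lohi n : lo n <= hi n.
  have : 0 <= 2 * K * eps n by rewrite !mulr_ge0// ltW// eps_gt0.
  by rewrite /lo /hi; lra.
have lh m n : lo m <= hi n.
  have [mn|/ltnW nm'] := leqP m n; first exact: le_trans (lom _ _ mn) (lohi n).
  exact: le_trans (lohi m) (him _ _ nm').
have ne : range lo !=set0 by exists (lo 0%N), 0%N.
have hs : has_sup (range lo) by split=> //; exists (hi 0%N) => _ [m _ <-].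
exists (sup (range lo)) => n.
have h1 : lo n <= sup (range lo) by apply: sup_upper_bound => //; exists n.
have h2 : sup (range lo) <= hi n by apply: ge_sup => // _ [m _ <-].
by rewrite ler_distl; move: h1 h2; rewrite /lo /hi => -> ->.
Qed.

Lemma geometric_limit (x : nat -> C) (K : R) :
  (forall n, nm (x n.+1 - x n) <= K * eps n) ->
  exists l : C, forall n, nm (l - x n) <= 4 * K * eps n.
Proof.
move=> H.
have [l1 H1] : exists l, forall n, `|l - complex.Re (x n)| <= 2 * K * eps n.
  by apply: geometric_limitR => n; rewrite -raddfB (le_trans (Re_nm _)).
have [l2 H2] : exists l, forall n, `|l - complex.Im (x n)| <= 2 * K * eps n.
  by apply: geometric_limitR => n; rewrite -raddfB (le_trans (Im_nm _)).
exists (l1 +i* l2) => n; rewrite (le_trans (nm_ReIm _))// !raddfB/=.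
by rewrite [leRHS](_ : _ = 2 * K * eps n + 2 * K * eps n) ?lerD//; ring.
Qed.

Definition disc z (r : R) : set C := [set w | nm (w - z) < r].

Lemma open_disc z r : open (disc z r).
Proof.
apply/open_complexP => w wr; exists (r - nm (w - z)); first by rewrite subr_gt0.
move=> v vw; rewrite /disc/= (le_lt_trans (nm_triB _ w _))//.
by rewrite -ltrBrDr.
Qed.

Lemma area_disc A z (r : R) : 0 < r -> measurable (@of_coord R @^-1` A) -> A `<=` disc z r ->
  finite_area A /\ area A <= 4 * r ^+ 2.
Proof.
move=> r0 mA Ar.
have h1 : complex.Re z - r <= complex.Re z + r by lra.
have h2 : complex.Im z - r <= complex.Im z + r by lra.
have le : (mu2 (@of_coord R @^-1` A) <= (4 * r ^+ 2)%:E)%E.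
  have := mu2_rect h1 h2; rewrite (_ : (_ - _) * _ = 4 * r ^+ 2); last by ring.
  move=> <-; apply: le_measure; rewrite ?inE//; first exact: measurable_rect.
  move=> p /Ar; rewrite /disc/= => h.
  have a1 := le_lt_trans (Re_nm _) h; have a2 := le_lt_trans (Im_nm _) h.
  move: a1 a2; rewrite !raddfB/= !ltr_norml => /andP[a1 a2] /andP[a3 a4].
  by split; rewrite /= in_itv/=; apply/andP; split; lra.
have fA : (mu2 (@of_coord R @^-1` A) < +oo)%E by rewrite (le_lt_trans le)// ltry.
split; first by split.
rewrite /area -lee_fin fineK//; rewrite ge0_fin_numE//.
Qed.

Lemma plane_integral_supp A B f : finite_area A -> measurable (@of_coord R @^-1` B) ->
  cbdm A f -> (forall z, A z -> ~ B z -> f z = 0) ->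
  plane_integral A f = plane_integral (A `&` B) f.
Proof.
move=> [mA fA] mB bf f0.
have sub D : D `<=` A -> measurable (@of_coord R @^-1` D) -> finite_area D.
  move=> DA mD; split=> //; apply: le_lt_trans fA.
  by apply: le_measure; rewrite ?inE// => p /DA.
have m1 : measurable (@of_coord R @^-1` (A `&` B)) by rewrite preimage_setI; exact: measurableI.
have m2 : measurable (@of_coord R @^-1` (A `\` B)).
  by rewrite setDE preimage_setI preimage_setC; apply: measurableI => //; exact: measurableC.
have E : A = (A `&` B) `|` (A `\` B) by rewrite setUIDK.
rewrite [in LHS]E plane_integralU.
- by rewrite [X in _ + X]plane_integral0 ?addr0// => z [Az nBz]; exact: f0.
- exact: sub (@subIsetl _ _ _) m1.
- exact: sub (@subDsetl _ _ _) m2.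
- by apply/seteqP; split=> // z [[_ Bz] [_ nBz]].
- by rewrite -E.
Qed.

Lemma cont_at_shift F z w : cont_at F (w - z) -> cont_at (fun v => F (v - z)) w.
Proof.
move=> cF e /cF[r r0 H]; exists r => // v vw; apply: H.
by rewrite opprB addrA subrK.
Qed.

Lemma cbdm_shift A (L : R) F z : open A -> (forall w, A w -> nm w <= L) ->
  (forall w, cont_at F w) -> cbdm A (fun w => F (w - z)).
Proof.
move=> oA AL cF.
have [M M0 HM] := @ccont_bounded _ _ F (@cbox_compact _ 0 (L + nm z)) (cont_at_ccont (fun w _ => cF w)).
apply: (cbdm_cont oA (fun w _ => cont_at_shift (cF (w - z))) (M := M)) => w Aw.
have h : nm (w - z) <= L + nm z by rewrite (le_trans (nmB _ _))// lerD2r AL.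
by apply: HM; split; rewrite subr0 (le_trans _ h)// (Re_nm, Im_nm).
Qed.

End potential.

(** * The Cauchy potential of an open set *)

Section area_potential.
Variable R : realType.
Notation C := (R[i]^o).
Notation mu2 := (@plane_measure R).
Implicit Types (f g F T : C -> C) (z w v h : C) (A B : set C) (n N : nat).

Definition sqeps n : R := eps R n ^+ 2.

Lemma sqeps_gt0 n : 0 < sqeps n.
Proof. by rewrite exprn_gt0// eps_gt0. Qed.

Lemma disc_far z w n : ~ disc z (eps R n) w -> sqeps n <= nm (w - z) ^+ 2.
Proof.
move=> /negP; rewrite -leNgt => h.
by rewrite lerXn2r ?nnegrE ?nm_ge0 ?(ltW (eps_gt0 R n)).
Qed.

Lemma kern_bound n w : nm (kern (sqeps n) w) <= 2 / eps R n.
Proof.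
have e0 := eps_gt0 R n; have [h|/ltW h] := leP (nm w ^+ 2) (sqeps n).
  apply: le_trans (kern_near (sqeps_gt0 n) h) _.
  have : nm w <= eps R n by rewrite -(ler_pXn2r (_ : 0 < 2)%N) ?nnegrE ?nm_ge0 ?(ltW e0).
  move=> hw; rewrite ler_pdivrMr ?sqeps_gt0// /sqeps expr2 mulrA divfK ?gt_eqF//.
  by rewrite ler_pM2l.
rewrite (kern_far (sqeps_gt0 n) h).1 nmV.
have hw : eps R n <= nm w by rewrite -(ler_pXn2r (_ : 0 < 2)%N) ?nnegrE ?nm_ge0 ?(ltW e0).
have w0 : 0 < nm w by rewrite (lt_le_trans e0).
rewrite (@le_trans _ _ (eps R n)^-1)// ?lef_pV2 ?posrE//.
by rewrite ler_pMl ?invr_gt0// ler1n.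
Qed.

Definition pot A n z := plane_integral A (fun w => kern (sqeps n) (w - z)).

(** Integration in polar coordinates would give pi for every [n]; the proof gets by with constancy
    in [n] and positivity. *)
Definition kern_mass n : C := plane_integral (disc 0 (eps R n)) (kern_dbar (sqeps n)).

Lemma measurable_disc z (r : R) : measurable (@of_coord R @^-1` disc z r).
Proof. exact: (open_measurable2 (open_of_coord (@open_disc R z r))). Qed.

Lemma finite_area_disc z (r : R) : 0 < r -> finite_area (disc z r).
Proof. by move=> r0; have [] := @area_disc R (disc z r) z r r0 (measurable_disc z r) (@subset_refl _ _). Qed.

Section fixed_domain.
Variables (A : set C) (L : R).
Hypotheses (oA : open A) (AL : forall z, A z -> nm z <= L).

Let fA : finite_area A. Proof. exact: open_bounded_finite_area oA AL. Qed.

Let bA F z : (forall w, cont_at F w) -> cbdm A (fun w => F (w - z)).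
Proof. exact: cbdm_shift oA AL. Qed.

Let ckern n w : cont_at (kern (sqeps n)) w.
Proof. exact: cdf_cont_at (kern_cdf w (sqeps_gt0 n)). Qed.

(** Differentiation under the integral sign: the quadratic remainder of the kernel is uniform over
    the bounded set [A]. The minus signs come from [z] entering through [w - z]. *)
Lemma pot_cdf n z : cdf (pot A n) z
  (- plane_integral A (fun w => kern_d (sqeps n) (w - z)))
  (- plane_integral A (fun w => kern_dbar (sqeps n) (w - z))).
Proof.
set E := sqeps n; have E0 : 0 < E := sqeps_gt0 n.
move=> e e0.
have [L1 L10 HL1] : exists2 L1 : R, 0 <= L1 & forall v, A v -> nm (v - z) <= L1.
  exists (`|L| + nm z); first by rewrite addr_ge0 ?nm_ge0.
  move=> v Av; rewrite (le_trans (nmB _ _))// lerD2r (le_trans (AL Av))//.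
  exact: ler_norm.
pose K := 2 * E^-1 ^+ 3 * (L1 + 1) * (2 * L1 + 1) ^+ 2 + E^-1 ^+ 2 * (3 * L1 + 1).
have i0 : 0 <= E^-1 by rewrite invr_ge0 ltW.
have K0 : 0 <= K by rewrite /K addr_ge0// !mulr_ge0 ?exprn_ge0 ?addr_ge0 ?mulr_ge0.
pose B := 2 * K * area A + 1.
have B0 : 0 < B by rewrite ltr_wpDl// !mulr_ge0 ?area_ge0.
exists (Num.min 1 (e / B)); first by rewrite lt_min ltr01 divr_gt0.
move=> w; rewrite lt_min => /andP[/ltW w1]; rewrite ltr_pdivlMr// => w2.
set h := w - z in w1 w2 *.
pose rem v := kern E (v - w) + ((-1) * kern E (v - z) +
   (h * kern_d E (v - z) + conjc h * kern_dbar E (v - z))).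
have c1 := bA w (ckern n); have c2 := cbdmZ (-1) (bA z (ckern n)).
have c3 := cbdmZ h (bA z (kern_d_cont E0)).
have c4 := cbdmZ (conjc h) (bA z (kern_dbar_cont E0)).
have -> : pot A n w - pot A n z - (- plane_integral A (fun w => kern_d E (w - z))) * h -
    (- plane_integral A (fun w => kern_dbar E (w - z))) * conjc h = plane_integral A rem.
  rewrite /rem (plane_integralD fA c1 (cbdmD c2 (cbdmD c3 c4))).
  rewrite (plane_integralD fA c2 (cbdmD c3 c4)) (plane_integralD fA c3 c4).
  rewrite (plane_integralZ (-1) fA (bA z (ckern n))) (plane_integralZ h fA (bA z (kern_d_cont E0))).
  rewrite (plane_integralZ (conjc h) fA (bA z (kern_dbar_cont E0))) /pot -/E; ring.
have remK v : A v -> nm (rem v) <= K * nm h ^+ 2.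
  move=> /HL1 vz.
  have h1 : nm (- h) <= 1 by rewrite nmN.
  have := kern_taylor_le E0 vz h1; rewrite nmN.
  congr (nm _ <= _); rewrite /rem.
  have -> : v - z + - h = v - w by rewrite /h opprB addrA subrK.
  by rewrite rmorphN; ring.
apply: le_trans (plane_integral_bound fA (cbdmD c1 (cbdmD c2 (cbdmD c3 c4))) remK) _.
rewrite [leLHS](_ : _ = 2 * K * area A * nm h * nm h); last by ring.
rewrite ler_wpM2r ?nm_ge0//; apply: le_trans (ltW w2).
by rewrite mulrC ler_wpM2l ?nm_ge0// lerDl.
Qed.

Let diff m n z w := kern (sqeps m) (w - z) + (-1) * kern (sqeps n) (w - z).

Let bdiff m n z : cbdm A (diff m n z).
Proof. exact: (cbdmD (bA z (ckern m)) (cbdmZ (-1) (bA z (ckern n)))). Qed.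

Let diff_far m n z w : (m <= n)%N -> ~ disc z (eps R m) w -> diff m n z w = 0.
Proof.
move=> mn /disc_far h; have h' : sqeps n <= nm (w - z) ^+ 2.
  by rewrite (le_trans _ h)// lerXn2r ?nnegrE ?(ltW (eps_gt0 _ _))// eps_le.
by rewrite /diff (kern_far (sqeps_gt0 m) h).1 (kern_far (sqeps_gt0 n) h').1 mulN1r subrr.
Qed.

Let pot_diff m n z : (m <= n)%N -> pot A m z - pot A n z =
  plane_integral (A `&` disc z (eps R m)) (diff m n z).
Proof.
move=> mn; rewrite -(@plane_integral_supp _ A (disc z (eps R m)) (diff m n z) fA (measurable_disc _ _) (bdiff m n z)).
  have c2 := cbdmZ (-1) (bA z (ckern n)).
  by rewrite (plane_integralD fA (bA z (ckern m)) c2) (plane_integralZ (-1) fA (bA z (ckern n))) mulN1r.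
by move=> w _; exact: diff_far.
Qed.

(** The two kernels differ only on a disc of radius [eps n], where the difference is at most
    [2 / eps n + 2 / eps n.+1 = 6 / eps n]. The area is at most [4 * eps n ^+ 2], and
    [plane_integral_bound] adds a factor 2. *)
Lemma pot_step n z : nm (pot A n.+1 z - pot A n z) <= 48 * eps R n.
Proof.
rewrite nm_distC (pot_diff z (leqnSn n)).
have e0 := eps_gt0 R n; have e1 := eps_gt0 R n.+1.
have mI : measurable (@of_coord R @^-1` (A `&` disc z (eps R n))).
  by rewrite preimage_setI; apply: measurableI (measurable_disc _ _); case: fA.
have [fI aI] := area_disc e0 mI (@subIsetr _ _ _).
have M w : (A `&` disc z (eps R n)) w -> nm (diff n n.+1 z w) <= 6 / eps R n.
  move=> _; rewrite /diff mulN1r (le_trans (nmB _ _))//.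
  apply: le_trans (lerD (kern_bound n _) (kern_bound n.+1 _)) _.
  rewrite le_eqVlt; apply/orP; left; apply/eqP; rewrite epsS; field; rewrite gt_eqF//.
have bI : cbdm (A `&` disc z (eps R n)) (diff n n.+1 z).
  by apply: cbdm_sub (bdiff n n.+1 z); [case: fA|exact: subIsetl].
apply: le_trans (plane_integral_bound fI bI M) _.
have : 2 * (6 / eps R n) * area (A `&` disc z (eps R n)) <= 2 * (6 / eps R n) * (4 * eps R n ^+ 2).
  by rewrite ler_wpM2l// !mulr_ge0// invr_ge0 ltW.
by rewrite [in X in _ <= X](_ : _ * (_ * _) = 48 * eps R n)//; field; rewrite gt_eqF.
Qed.

(** The difference of two kernels is odd and lives on the disc of radius [eps m]. If [A] contains
    the disc, the point reflection in [z] shows that the integral is its own opposite. *)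
Lemma pot_stable m n z : (m <= n)%N ->
  disc z (eps R m) `<=` A \/ A `&` disc z (eps R m) = set0 -> pot A m z = pot A n z.
Proof.
move=> mn H; apply/eqP; rewrite -subr_eq0; apply/eqP; rewrite pot_diff//.
case: H => [DA|->]; last by apply: plane_integral0.
have e0 := eps_gt0 R m.
have -> : A `&` disc z (eps R m) = disc z (eps R m) by rewrite setIidr.
set I := plane_integral _ _; suff : I = - I.
  by move=> /eqP; rewrite -addr_eq0 -mulr2n mulrn_eq0 => /eqP.
have bD : cbdm (disc z (eps R m)) (diff m n z) by apply: cbdm_sub (bdiff m n z) => //; case: fA.
have cD : ccont setT (diff m n z).
  apply: cont_at_ccont => w _; apply: cont_atD.
    exact: cont_at_shift.
  apply: cont_atM (cont_at_cst _ _) _; exact: cont_at_shift.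
have fD := finite_area_disc z e0.
rewrite {1}/I (plane_integral_refl (z + z) fD cD bD).
have -> : [set w | disc z (eps R m) (z + z - w)] = disc z (eps R m).
  have E w : nm (z + z - w - z) = nm (w - z) by rewrite -nmN; congr nm; ring.
  by apply/seteqP; split=> w; rewrite /disc/= E.
rewrite /I -mulN1r -plane_integralZ//; apply: eq_plane_integral => w _.
have E : z + z - w - z = - (w - z) by ring.
by rewrite /diff E !kernN; ring.
Qed.

Lemma pot_limit : exists T, forall z n, nm (T z - pot A n z) <= 192 * eps R n.
Proof.
have H z : exists l : C, forall n, nm (l - pot A n z) <= 192 * eps R n.
  have [l Hl] := geometric_limit (fun n => pot_step n z).
  by exists l => n; rewrite (_ : 192 = 4 * 48)//; ring.
by have [T HT] := choice H; exists T.
Qed.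

Variable T : C -> C.
Hypothesis HT : forall z n, nm (T z - pot A n z) <= 192 * eps R n.

Lemma pot_limit_cont z : cont_at T z.
Proof.
(* [576 = 3 * 192]: each of the three differences gets a third of [e]. *)
move=> e e0; have [N HN] := eps_small (divr_gt0 e0 (ltr0n R 576)).
have e3 : 0 < e / 3 by rewrite divr_gt0.
have [r r0 Hr] := cdf_cont_at (pot_cdf N z) e3.
exists r => // w /Hr h.
have h1 := HT w N; have := HT z N; rewrite nm_distC => h2.
have -> : T w - T z = (T w - pot A N w) + (pot A N w - pot A N z) + (pot A N z - T z) by ring.
rewrite (le_lt_trans (nmD _ _))// (le_lt_trans (lerD (nmD _ _) (lexx _)))//.
by move: HN h h1 h2; lra.
Qed.

Lemma pot_limit_eq z N : disc z (eps R N) `<=` A \/ A `&` disc z (eps R N) = set0 ->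
  T z = pot A N z.
Proof.
move=> H; apply/eqP; rewrite -subr_eq0 -nm_eq0 eq_le nm_ge0 andbT.
apply/ler_addgt0Pr => e e0; rewrite add0r.
have [k hk] := eps_small (divr_gt0 e0 (ltr0n R 192)).
have := HT z (maxn N k); rewrite -(pot_stable (leq_maxl N k) H).
move=> h; apply: le_trans h _; have := eps_le R (leq_maxr N k).
by move: hk; lra.
Qed.

Let disc_trans z w N : nm (w - z) < eps R N -> disc w (eps R N) `<=` disc z (2 * eps R N).
Proof.
move=> wz v; rewrite /disc/= => h; rewrite (le_lt_trans (nm_triB _ w _))//.
by move: wz h; lra.
Qed.

(** The doubled radius leaves room for the discs of radius [eps N] around all points near [z], so
    [T] equals [pot A N] on a neighbourhood and not only at [z]. The reflection that carries the
    disc to the origin preserves the even function [kern_dbar]. *)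
Lemma pot_limit_cdf_in z N : disc z (2 * eps R N) `<=` A ->
  exists a, cdf T z a (- kern_mass N).
Proof.
move=> DA; have e0 := eps_gt0 R N.
have Hin w : nm (w - z) < eps R N -> disc w (eps R N) `<=` A.
  by move=> /disc_trans h; exact: subset_trans h DA.
have DA1 : disc z (eps R N) `<=` A by apply: Hin; rewrite subrr nm0.
have -> : kern_mass N = plane_integral A (fun w => kern_dbar (sqeps N) (w - z)).
  rewrite (@plane_integral_supp _ A (disc z (eps R N)) _ fA (measurable_disc _ _) (bA z (kern_dbar_cont (sqeps_gt0 N)))).
    rewrite (setIidr DA1); set f := fun w => _.
    have cf : ccont setT f.
      by apply: cont_at_ccont => w _; apply: cont_at_shift; exact: kern_dbar_cont (sqeps_gt0 N) _.
    have bf : cbdm (disc z (eps R N)) f.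
      by apply: cbdm_sub (bA z (kern_dbar_cont (sqeps_gt0 N))) => //; case: fA.
    rewrite (plane_integral_refl z (finite_area_disc z e0) cf bf).
    have -> : [set w | disc z (eps R N) (z - w)] = disc 0 (eps R N).
      have E w : nm (z - w - z) = nm (w - 0) by rewrite -nmN; congr nm; ring.
      by apply/seteqP; split=> w; rewrite /disc/= E.
    apply: eq_plane_integral => w _; rewrite /f.
    by rewrite (_ : z - w - z = - w) ?kern_dbarN//; ring.
  by move=> w _ /disc_far h; exact: (kern_far (sqeps_gt0 N) h).2.
eexists; apply: (@cdf_near _ (pot A N) T z _ _ _ e0) (pot_cdf N z) => w wz.
by apply/esym/pot_limit_eq; left; exact: Hin.
Qed.

Lemma pot_limit_out z : ~ closure A z ->
  T z = plane_integral A (fun w => (w - z)^-1) /\ exists a, cdf T z a 0.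
Proof.
move=> nA; have /open_complexP/(_ z nA)[r r0 rA] := closed_openC (@closed_closure _ A).
have [N HN] := eps_small (divr_gt0 r0 (ltr0n R 2)).
have e0 := eps_gt0 R N.
have Hin w : nm (w - z) < eps R N -> A `&` disc w (eps R N) = set0.
  move=> wz; apply/seteqP; split=> // v [Av vw].
  have := disc_trans wz vw; rewrite /disc/= => vz.
  apply: (rA v _ (@subset_closure _ A _ Av)); move: vz HN; lra.
have z0 : A `&` disc z (eps R N) = set0 by apply: Hin; rewrite subrr nm0.
have far w : A w -> sqeps N <= nm (w - z) ^+ 2.
  by move=> Aw; apply: disc_far => dw; have : (A `&` disc z (eps R N)) w by []; rewrite z0.
split.
  rewrite (pot_limit_eq (or_intror z0)); apply: eq_plane_integral => w /far h.
  exact: (kern_far (sqeps_gt0 N) h).1.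
exists (- plane_integral A (fun w => kern_d (sqeps N) (w - z))).
have <- : - plane_integral A (fun w => kern_dbar (sqeps N) (w - z)) = 0.
  rewrite plane_integral0 ?oppr0// => w /far h; exact: (kern_far (sqeps_gt0 N) h).2.
apply: (@cdf_near _ (pot A N) T z _ _ _ e0) (pot_cdf N z) => w wz.
by apply/esym/pot_limit_eq; right; exact: Hin.
Qed.

End fixed_domain.

(** Both masses are read off as the dbar derivative at 0 of one limit potential, that of a disc
    large enough for all [n]. *)
Lemma kern_mass_cst n : kern_mass n = kern_mass 0.
Proof.
have oD := @open_disc R 0 4.
have DL z : disc 0 4 z -> nm z <= 4 by rewrite /disc/= subr0 => /ltW.
have [T HT] := pot_limit oD DL.
have sub m : disc 0 (2 * eps R m) `<=` disc 0 4.
  move=> w; rewrite /disc/= => h; apply: lt_le_trans h _.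
  by have := eps_le R (leq0n m); rewrite {2}/eps expr0; lra.
have [a Ha] := pot_limit_cdf_in oD DL HT (sub n).
have [b Hb] := pot_limit_cdf_in oD DL HT (sub 0%N).
by apply: oppr_inj; exact: cdf_unique Ha Hb.
Qed.

Lemma kern_mass_gt0 : exists2 c : R, 0 < c & kern_mass 0 = c%:C.
Proof.
exists (complex.Re (kern_mass 0)); last first.
  rewrite [LHS]complexE; congr (_ +i* _).
  rewrite /kern_mass /plane_integral /= /Rintegral integral0_eq//.
have E : sqeps 0 = 1 by rewrite /sqeps /eps expr0 expr1n.
have D : eps R 0 = 1 by rewrite /eps expr0.
have [mD fD] := @finite_area_disc 0 1 ltr01.
rewrite /kern_mass plane_integral_Re D E.
have [b1 _] := @cbdm_shift R (disc 0 1) 1 (kern_dbar 1) 0 (@open_disc R _ _)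
  ltac:(by move=> w; rewrite /disc/= subr0 => /ltW) (kern_dbar_cont ltr01).
have sub p : rect 0 (0 + 2^-1) 0 (0 + 2^-1) p -> nm (@of_coord R p) ^+ 2 <= 1 / 2.
  move=> [/=]; rewrite !in_itv/= !add0r => /andP[p1 p2] /andP[p3 p4].
  rewrite nm_sqr /=.
  have h1 : p.1 ^+ 2 <= 2^-1 ^+ 2 by rewrite lerXn2r ?nnegrE ?invr_ge0// ltW.
  have h2 : p.2 ^+ 2 <= 2^-1 ^+ 2 by rewrite lerXn2r ?nnegrE ?invr_ge0// ltW.
  by apply: le_trans (lerD h1 h2) _; rewrite le_eqVlt; apply/orP; left; apply/eqP; field.
(* On the square of side 1/2 at the origin the squared modulus is at most 1/2, so [kern_dbar_gt0]
   bounds the density below by 1. *)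
apply: (@lt_le_trans _ _ (1 * (2^-1 * 2^-1))); first by rewrite mul1r mulr_gt0// invr_gt0.
apply: (@Rintegral_ge_rect R _ _ 0 0) => //.
- apply: bdm_eq b1 => p _ /=; by rewrite subr0.
- by move=> p _; exact: kern_dbar_ge0 ltr01 _.
- move=> p /sub h; rewrite /disc/= subr0.
  have := le_lt_trans h (_ : 1 / 2 < 1 ^+ 2); rewrite expr1n ltr_pdivrMr// mul1r ltr1n => /(_ isT).
  by rewrite -[X in _ < X](expr1n _ 2) ltr_pXn2r ?nnegrE ?nm_ge0.
- move=> p /sub h; by have := @kern_dbar_gt0 R 1 ltr01 _ h; rewrite invr1.
Qed.

End area_potential.

(** * Construction of the Schwarz pair *)

Section quadrature_to_schwarz.
Variable R : realType.
Notation C := (R[i]^o).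
Implicit Types (f g T : C -> C) (z w a : C) (A D K U : set C).

Lemma area_potential_exists A (L : R) : open A -> (forall z, A z -> nm z <= L) ->
  exists T, [/\ forall z, cont_at T z,
    forall z, A z -> exists a, cdf T z a (- kern_mass R 0)
  & forall z, ~ closure A z ->
      T z = plane_integral A (fun w => (w - z)^-1) /\ exists a, cdf T z a 0].
Proof.
move=> oA AL; have [T HT] := pot_limit oA AL; exists T; split.
- by move=> z; exact: (pot_limit_cont oA AL HT).
- move=> z Az; move: (oA) => /open_complexP/(_ z Az)[r r0 rA].
  have [N HN] := eps_small (divr_gt0 r0 (ltr0n R 2)).
  rewrite -(kern_mass_cst R N); apply: (pot_limit_cdf_in oA AL HT) => w.
  by rewrite /disc/= => h; apply: rA; move: h HN; lra.
- by move=> z; exact: (pot_limit_out oA AL HT).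
Qed.

Lemma cdf_shift f z w a b : cdf f (w - z) a b -> cdf (fun v => f (v - z)) w a b.
Proof.
move=> cf e /cf[r r0 H]; exists r => // v; have := H (v - z).
by rewrite opprB addrA subrK.
Qed.

(** Near [w] the inverse coincides with [kern E] once [E] is at most the squared modulus there. *)
Lemma cdf_inv w : w != 0 -> exists a, cdf (fun v : C => v^-1) w a 0.
Proof.
rewrite -nm_gt0 => w0; pose E := (nm w / 2) ^+ 2.
have w2 : 0 < nm w / 2 by rewrite divr_gt0.
have E0 : 0 < E by rewrite exprn_gt0.
have far v : nm (v - w) < nm w / 2 -> E <= nm v ^+ 2.
  move=> h; rewrite lerXn2r ?nnegrE ?nm_ge0 ?(ltW w2)//.
  have := nm_triB w v 0; rewrite !subr0 (nm_distC w v); move: h; lra.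
have Ew : E <= nm w ^+ 2 by apply: far; rewrite subrr nm0.
exists (kern_d E w); rewrite -(kern_far E0 Ew).2.
apply: (@cdf_near _ (kern E) _ _ _ _ _ w2) (kern_cdf w E0) => v /far h.
exact: (kern_far E0 h).1.
Qed.

Lemma cauchy_kernel_analytic D z : ~ closure D z ->
  analytic_in D (fun w => (w - z)^-1) /\ ccont (closure D) (fun w => (w - z)^-1).
Proof.
move=> nD.
have H w : w != z -> exists a, cdf (fun w : C => (w - z)^-1) w a 0.
  by rewrite -subr_eq0 => /cdf_inv[a Ha]; exists a; exact: cdf_shift Ha.
split=> w Dw; have wz : w != z.
- by apply/eqP => wz; apply: nD; rewrite -wz; exact: subset_closure.
- by have [a] := H w wz; exact: cdf_derivable.
- by apply/eqP => wz; apply: nD; rewrite -wz.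
- move=> e e0; have [a Ha] := H w wz; have [d d0 Hd] := cdf_cont_at Ha e0.
  by exists d; [exact: d0|move=> v _; exact: Hd].
Qed.

(** Inside [X], belonging to [A] means not belonging to the open set [B], so the intersection is
    closed. *)
Lemma closedI_supp (X : set C) A B : compact X -> X `<=` A `|` B -> open B ->
  A `&` B = set0 -> compact (X `&` A).
Proof.
move=> cX XAB oB AB.
have cl : closed X by apply: compact_closed cX; exact: complex_hausdorff.
have -> : X `&` A = X `&` ~` B.
  apply/seteqP; split=> z [Xz h]; split=> //.
    by move=> Bz; have : (A `&` B) z by []; rewrite AB.
  by case: (XAB z Xz).
apply: (subclosed_compact _ cX) => [|z []//].
by apply: closedI => //; exact: open_closedC.
Qed.

Lemma cont_at_closure0 A f z : cont_at f z -> closure A z -> (forall w, A w -> f w = 0) -> f z = 0.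
Proof.
move=> cf /closure_complexP Az f0; apply/eqP; rewrite -nm_eq0 eq_le nm_ge0 andbT.
apply/ler_addgt0Pr => e e0; rewrite add0r; have [r r0 Hr] := cf e e0.
have [w Aw /Hr] := Az r r0; rewrite (f0 _ Aw) sub0r nmN; exact: ltW.
Qed.

Lemma closureI_open A U z : closure A z -> open U -> U z -> closure (A `&` U) z.
Proof.
move=> /closure_complexP Az /open_complexP oU Uz; have [r r0 rU] := oU z Uz.
apply/closure_complexP => s s0.
have [|w Aw] := Az (Num.min r s); first by rewrite lt_min r0.
by rewrite lt_min => /andP[/rU wr ws]; exists w.
Qed.

Variables (bp bm : R) (Dp Dm : set C).
Hypotheses (oDp : open Dp) (oDm : open Dm) (dis : Dp `&` Dm = set0).
Hypotheses (sp : frontier Dp `<=` closure (~` closure Dp)) (sm : frontier Dm `<=` closure (~` closure Dm)).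
Variable L : R.
Hypotheses (DpL : forall z, Dp z -> nm z <= L) (DmL : forall z, Dm z -> nm z <= L).
Variable mu : (C -> C) -> C.
Hypotheses (dmu : plane_distribution mu) (qmu : two_phase_quadrature_domain bp bm Dp Dm mu).

Local Notation D := (Dp `|` Dm).

Lemma quadrature_schwarz : exists Sp Sm, two_phase_Schwarz_function bp bm Dp Dm Sp Sm.
Proof.
have oD : open D by exact: openU.
have dis' : Dm `&` Dp = set0 by rewrite setIC.
have [[cK KD] quad] := qmu.
have [u [uu cu uD [U [oU KU U1]]]] := cutoff_exists oD cK KD.
(* The cutoff [u] defines the Cauchy transform [M], which is known to be holomorphic only off the
   support of [u]. The second cutoff is 1 around that support and erases what happens there. *)
have [u2 [uu2 cu2 uD2 [U2 [oU2 KU2 U21]]]] := cutoff_exists oD cu uD.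
have [Tp [Tpc Tpin Tpout]] := area_potential_exists oDp DpL.
have [Tm [Tmc Tmin Tmout]] := area_potential_exists oDm DmL.
have [c c0 cE] := kern_mass_gt0 R; rewrite cE in Tpin Tmin.
have cC : c%:C != 0 :> C by rewrite -nm_eq0 nmC gtr0_norm// gt_eqF.
pose M z := mu (fun w => toC u w * (w - z)^-1).
have Mcdf z : ~ supp (toC u) z -> exists a, cdf M z a 0 by exact: cauchy_transform_cdf.
pose v z := bp%:C * Tp z + (- bm%:C * Tm z + - 1 * M z).
have v_cont z : ~ supp (toC u) z -> cont_at v z.
  move=> /Mcdf[a Ma]; apply: cont_atD; first exact: cont_atM (cont_at_cst _ _) (Tpc z).
  apply: cont_atD; first exact: cont_atM (cont_at_cst _ _) (Tmc z).
  exact: cont_atM (cont_at_cst _ _) (cdf_cont_at Ma).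
have nDp z : Dp z -> ~ closure Dm z by exact: disjoint_closure_notin.
have nDm z : Dm z -> ~ closure Dp z by exact: disjoint_closure_notin.
have v_ext z : ~ closure Dp z -> ~ closure Dm z -> v z = 0.
  move=> npz nmz; have nDz : ~ closure D z by rewrite closureU => -[].
  (* Off the closure of [D] the Cauchy kernel is an admissible function in the quadrature identity,
     and the identity for it reads [v z = 0]. *)
  have [af cf] := cauchy_kernel_analytic nDz.
  have := quad _ af ((ccontP _ _).2 cf) (toC u) (toC_test uu cu) uD.
  move=> /(_ (ex_intro _ U (And3 oU KU _))) H.
  have E : M z = bp%:C * Tp z - bm%:C * Tm z.
    rewrite (Tpout z npz).1 (Tmout z nmz).1; apply: H => w /U1 uw.
    by rewrite /toC uw.
  by rewrite /v E; ring.
have D_notin z : supp (toC u2) z -> ~ (frontier Dp z \/ frontier Dm z).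
  move=> /uD2[pz|mz] [[cz nz]|[cz nz]].
  - by apply: nz; move: (oDp); rewrite openE; exact.
  - exact: (nDp _ pz).
  - exact: (nDm _ mz).
  - by apply: nz; move: (oDm); rewrite openE; exact.
have su z : ~ supp (toC u2) z -> ~ supp (toC u) z.
  move=> n2 /KU2/U21 h; apply: n2; apply: subset_closure.
  by rewrite /= /toC h oner_neq0.
(* One formula for both phases, with [b = bp] and [b = - bm]; it is continuous on the whole
   plane. *)
pose S (b : R) z : C := (1 - toC u2 z) * (b%:C * conjc z + c%:C^-1 * v z).
have S_cont b z : cont_at (S b) z.
  have [/KU2 Uz|nz] := pselect (supp (toC u) z).
    move: (oU2) => /open_complexP/(_ z Uz)[r r0 rU].
    apply: (@cont_at_near _ (fun=> 0) _ _ r r0) (cont_at_cst _ _) => w /rU/U21 h.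
    by rewrite /S /toC h subrr mul0r.
  have c1 : cont_at (fun w => 1 - toC u2 w) z.
    have := cont_atD (cont_at_cst z 1) (cont_atM (cont_at_cst z (-1)) (cdf_cont_at (ub_cdf z (uu2 1%N)))).
    by apply: cont_at_near ltr01 _ => w _; rewrite mulN1r.
  apply: cont_atM c1 _; apply: cont_atD; apply: cont_atM (cont_at_cst _ _) _.
    exact: cdf_cont_at (cdf_conj z).
  exact: v_cont.
have S_analytic (b : R) z a : ~ supp (toC u2) z -> cdf v z a (- (b%:C * c%:C)) ->
    derivable (S b) z 1.
  move=> nz va.
  have := cdfD (cdfZ b%:C (cdf_conj z)) (cdfZ c%:C^-1 va).
  (* The dbar derivative [b] of the conjugate term cancels that of [v / c]. *)
  rewrite (_ : _ + c%:C^-1 * - _ = 0); last by field.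
  move=> H; apply: (@cdf_derivable _ _ _ (b%:C * 0 + c%:C^-1 * a)).
  have /open_complexP/(_ z nz)[r r0 rU] := closed_openC (@closed_closure _ [set w | toC u2 w != 0]).
  apply: (@cdf_near _ _ _ _ _ _ r r0) H => w /rU/notin_supp h.
  by rewrite /S h subr0 mul1r.
have S_frontier b z : frontier Dp z \/ frontier Dm z -> S b z = b%:C * conjc z + c%:C^-1 * v z.
  move=> F; rewrite /S; have -> : toC u2 z = 0 by apply: notin_supp => /D_notin; apply.
  by rewrite subr0 mul1r.
exists (S bp), (S (- bm)), (supp (toC u2) `&` Dp), (supp (toC u2) `&` Dm).
have out A z : (A `\` (supp (toC u2) `&` A)) z -> ~ supp (toC u2) z.
  by move=> [Az n] sz; apply: n; split.
split.
- split; [|exact: subIsetr| |exact: subIsetr].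
  + exact: closedI_supp cu2 uD2 oDm dis.
  + by apply: closedI_supp cu2 _ oDp dis'; rewrite setUC.
- split; first by apply/ccontP; apply: cont_at_ccont => z _; exact: S_cont.
  move=> z Az; have nz := out _ _ Az; have pz := Az.1.
  (* In [Dp] only [Tp] has a nonzero dbar derivative: [Dp] is off the closure of [Dm], so [Tm] is
     holomorphic there. *)
  have [a1 h1] := Tpin z pz; have [a2 h2] := (Tmout z (nDp z pz)).2.
  have [a3 h3] := Mcdf z (su z nz).
  apply: (S_analytic bp z _ nz).
  have := cdfD (cdfZ bp%:C h1) (cdfD (cdfZ (- bm%:C) h2) (cdfZ (-1) h3)).
  by rewrite !mulr0 !addr0 mulrN; exact.
- split; first by apply/ccontP; apply: cont_at_ccont => z _; exact: S_cont.
  move=> z Az; have nz := out _ _ Az; have mz := Az.1.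
  have [a1 h1] := Tmin z mz; have [a2 h2] := (Tpout z (nDm z mz)).2.
  have [a3 h3] := Mcdf z (su z nz).
  apply: (S_analytic (- bm) z _ nz).
  have := cdfD (cdfZ bp%:C h2) (cdfD (cdfZ (- bm%:C) h1) (cdfZ (-1) h3)).
  rewrite !mulr0 add0r addr0.
  have -> : (- bm)%:C = - bm%:C :> C by rewrite rmorphN.
  by rewrite mulrN mulNr; exact.
- have nsupp z : frontier Dp z \/ frontier Dm z -> ~ supp (toC u) z.
    by move=> F; apply: su => /D_notin; apply.
  split=> z [F nG].
    rewrite S_frontier; last by left.
    have nmz : ~ closure Dm z.
      by move=> mz; apply: nG; exact: closures_frontiers F.1 mz.
    (* Outside Gamma the point is not in the closure of [Dm], and by one-sidedness it is a limit of
       points off the closure of [Dp], hence off both closures, where [v] is 0. *)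
    rewrite (@cont_at_closure0 (~` closure Dp `&` ~` closure Dm) v z) ?mulr0 ?addr0//.
    + by apply: v_cont; apply: nsupp; left.
    + by apply: closureI_open (sp F) _ nmz; apply: closed_openC; exact: closed_closure.
    + by move=> w [h1 h2]; exact: v_ext.
  rewrite S_frontier; last by right.
  have npz : ~ closure Dp z.
    by move=> pz; apply: nG; exact: closures_frontiers pz F.1.
  rewrite (@cont_at_closure0 (~` closure Dm `&` ~` closure Dp) v z) ?mulr0 ?addr0.
  + by rewrite rmorphN mulNr.
  + by apply: v_cont; apply: nsupp; right.
  + by apply: closureI_open (sm F) _ npz; apply: closed_openC; exact: closed_closure.
  + by move=> w [h1 h2]; exact: v_ext.
(* The two copies of [v / c] cancel. *)
- move=> z [Fp Fm]; rewrite !S_frontier; [|by left|by left].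
  have -> : (bp + bm)%:C = bp%:C + bm%:C :> C by rewrite rmorphD.
  have -> : (- bm)%:C = - bm%:C :> C by rewrite rmorphN.
  ring.
Qed.

End quadrature_to_schwarz.

Theorem theorem4p3 (R : realType) (bp bm : R) (Dp Dm : set (R[i]^o))
    (hbp : 0 < bp) (hbm : 0 < bm)
    (hDp : plane_domain Dp) (hDm : plane_domain Dm)
    (hbDp : bounded_set Dp) (hbDm : bounded_set Dm)
    (hdisj : Dp `&` Dm = set0)
    (hC1p : piecewise_C1_boundary Dp) (hC1m : piecewise_C1_boundary Dm) :
  (exists Sp Sm : R[i]^o -> R[i]^o,
     two_phase_Schwarz_function bp bm Dp Dm Sp Sm) <->
  (exists mu : (R[i]^o -> R[i]^o) -> R[i]^o,
     plane_distribution mu /\ two_phase_quadrature_domain bp bm Dp Dm mu).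
Proof.
have [oDp _ _] := hDp; have [oDm _ _] := hDm.
split=> [[Sp [Sm S]]|[mu [dmu qmu]]].
  exact: (schwarz_quadrature oDp oDm hbDp hbDm hdisj hC1p hC1m S).
have [np [gp [_ _ _ sp]]] := hC1p; have [nm [gm [_ _ _ sm]]] := hC1m.
have [Lp _ HLp] := bounded_setC hbDp; have [Lm _ HLm] := bounded_setC hbDm.
apply: (@quadrature_schwarz R bp bm Dp Dm oDp oDm hdisj sp sm (Num.max Lp Lm) _ _ mu dmu qmu) => z.
  by move=> /HLp h; rewrite le_max h.
by move=> /HLm h; rewrite le_max h orbT.
Qed.
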